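(* Let $T>0$, $\alpha\in(0,2)$ and $0<\varepsilon_0<1$. There exists a constant $C>0$, depending only on $\varepsilon_0$, $\alpha$ and $T$, such that for all $(u_0,u_1)\in H^1_\alpha\times L^2(0,1)$ and all $f\in L^1(0,T;L^2(0,1))$, if $u$ is the weak solution of problem (P) with data $(f,u_0,u_1)$, then $$\frac{1}{\varepsilon^3}\int_0^T\int_{1-\varepsilon}^1 |u(t,x)|^2\,dx\,dt\le C\Big(\|f\|_{L^1(0,T;L^2(0,1))}^2+\|u_0\|_{H^1_\alpha}^2+\|u_1\|_{L^2(0,1)}^2\Big)\quad\text{for all }\varepsilon\in(0,\varepsilon_0].$$
   Context: Let $T>0$, $\alpha\in(0,2)$, $Q=(0,T)\times(0,1)$. The case $\alpha\in(0,1)$ is the weakly degenerate case (WDC), $\alpha\in[1,2)$ the strongly degenerate case (SDC). In the WDC, $H^1_\alpha$ is the set of $u\in L^2(0,1)$ that are absolutely continuous on $[0,1]$, with $x^{\alpha/2}u_x\in L^2(0,1)$ and $u(0)=u(1)=0$. In the SDC, $H^1_\alpha$ is the set of $u\in L^2(0,1)$ that are locally absolutely continuous on $(0,1]$, with $x^{\alpha/2}u_x\in L^2(0,1)$ and $u(1)=0$. In both cases $\|u\|_{H^1_\alpha}=(\|u\|_{L^2(0,1)}^2+\|x^{\alpha/2}u_x\|_{L^2(0,1)}^2)^{1/2}$. Problem (P): $u_{tt}-(x^\alpha u_x)_x=f$ in $Q$; $u(t,1)=0$ for $t\in(0,T)$; $u(t,0)=0$ if $\alpha\in(0,1)$, or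 $(x^\alpha u_x)(t,0)=0$ if $\alpha\in[1,2)$; $u(0,\cdot)=u_0$, $u_t(0,\cdot)=u_1$. Weak solution: given $f\in L^1(0,T;L^2(0,1))$ and $(u_0,u_1)\in H^1_\alpha\times L^2(0,1)$, a function $u\in C([0,T];H^1_\alpha)\cap C^1([0,T];L^2(0,1))$ is a weak solution of (P) if $u(0,\cdot)=u_0$ and $$\int_Q(-u_t\varphi_t+x^\alpha u_x\varphi_x)\,dx\,dt-\int_0^1u_1\varphi(0,x)\,dx=\int_Q f\varphi\,dx\,dt$$ for all $\varphi\in L^2(0,T;H^1_\alpha)$ with $\varphi_t\in L^2(Q)$ and $\varphi(T,\cdot)=0$. (For such data a weak solution exists and is unique.) *)

(* Defs.v *)
From HB Require Import structures.
From mathcomp Require Import all_boot all_order all_algebra.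
From mathcomp Require Import all_classical all_reals all_analysis.
Set Implicit Arguments. Unset Strict Implicit. Unset Printing Implicit Defensive.
Import Order.TTheory GRing.Theory Num.Theory.
Import numFieldNormedType.Exports.
Local Open Scope classical_set_scope.
Local Open Scope ring_scope.

Section Defs.
Variable R : realType.
Let mu := (@lebesgue_measure R).

Definition I01 : set R := `]0, 1[.
Definition Icc (a b : R) : set R := `[a, b].


Definition RI (D : set R) (f : R -> R) : R := Rintegral mu D f.

Definition inL2 (v : R -> R) : Prop :=
  measurable_fun I01 v /\
  (\int[mu]_(x in I01) ((v x) ^+ 2)%:E < +oo)%E.

Definition wint (alpha : R) (g : R -> R) : \bar R :=
  (\int[mu]_(x in I01) ((x `^ alpha) * (g x) ^+ 2)%:E)%E.

(* w is the (locally) absolutely continuous function on (0,1] (resp. [0,1]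
   in the WDC) with a.e. derivative g, x^{alpha/2} g in L^2(0,1),
   w(1) = 0, and w(0) = 0 in the WDC.  Local absolute continuity on (0,1]
   is expressed as: g is integrable on every [x,1], 0 < x <= 1, and
   w(x) = w(1) - int_x^1 g; absolute continuity on [0,1] additionally as:
   g integrable on [0,1] and w(0) = w(1) - int_0^1 g. *)
Definition H1rep (alpha : R) (w g : R -> R) : Prop :=
  measurable_fun I01 g /\ (wint alpha g < +oo)%E /\
  w 1 = 0 /\
  (forall x, 0 < x <= 1 ->
     mu.-integrable (Icc x 1) (fun y => (g y)%:E) /\ w x = w 1 - RI (Icc x 1) g) /\
  (alpha < 1 ->
     mu.-integrable (Icc 0 1) (fun y => (g y)%:E) /\ w 0 = w 1 - RI (Icc 0 1) g /\
     w 0 = 0).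

Definition H1a (alpha : R) (v g : R -> R) : Prop :=
  inL2 v /\
  exists w, {ae mu, forall x, 0 < x < 1 -> v x = w x} /\ H1rep alpha w g.

Definition H1norm2 (alpha : R) (v g : R -> R) : \bar R :=
  ((\int[mu]_(x in I01) ((v x) ^+ 2)%:E) + wint alpha g)%E.

Definition L2dist2 (v w : R -> R) : R := RI I01 (fun x => (v x - w x) ^+ 2).

Definition H1dist2 (alpha : R) (v g w h : R -> R) : R :=
  L2dist2 v w + RI I01 (fun x => x `^ alpha * (g x - h x) ^+ 2).

Definition CH1 (T alpha : R) (u ux : R -> R -> R) : Prop :=
  (forall t, 0 <= t <= T -> H1a alpha (u t) (ux t)) /\
  (forall t0, 0 <= t0 <= T ->
     (fun t => H1dist2 alpha (u t) (ux t) (u t0) (ux t0))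
       @ within (Icc 0 T) (nbhs t0) --> (0 : R)).

Definition C1L2 (T : R) (u ut : R -> R -> R) : Prop :=
  (forall t, 0 <= t <= T -> inL2 (u t) /\ inL2 (ut t)) /\
  (forall t0, 0 <= t0 <= T ->
     ((fun t => L2dist2 (ut t) (ut t0)) @ within (Icc 0 T) (nbhs t0) --> (0 : R)) /\
     ((fun t => L2dist2 (fun x => (u t x - u t0 x) / (t - t0)) (ut t0))
        @ within [set t | 0 <= t <= T /\ t != t0] (nbhs t0) --> (0 : R))).

Definition L1L2norm (T : R) (f : R -> R -> R) : \bar R :=
  (\int[mu]_(t in (Icc 0 T))
     (Num.sqrt (fine (\int[mu]_(x in I01) ((f t x) ^+ 2)%:E)))%:E)%E.

Definition inL1L2 (T : R) (f : R -> R -> R) : Prop :=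
  measurable_fun ((Icc 0 T) `*` I01) (fun p : R * R => f p.1 p.2) /\
  {ae mu, forall t, 0 <= t <= T ->
     (\int[mu]_(x in I01) ((f t x) ^+ 2)%:E < +oo)%E} /\
  (L1L2norm T f < +oo)%E.

(* Admissible test functions: phi in L^2(0,T;H^1_alpha) with phi_x = phix,
   phi_t = psi in L^2(Q), and phi(T,.) = 0; the latter two are encoded by
   phi(t,x) = - int_t^T psi(s,x) ds (for a.e. x, all t in [0,T]). *)
Definition testfun (T alpha : R) (phi phix psi : R -> R -> R) : Prop :=
  measurable_fun ((Icc 0 T) `*` I01) (fun p : R * R => psi p.1 p.2) /\
  (\int[mu]_(t in (Icc 0 T)) \int[mu]_(x in I01) ((psi t x) ^+ 2)%:E < +oo)%E /\
  {ae mu, forall x, 0 < x < 1 -> forall t, 0 <= t <= T ->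
     mu.-integrable (Icc t T) (fun s => (psi s x)%:E) /\
     phi t x = - RI (Icc t T) (fun s => psi s x)} /\
  measurable_fun ((Icc 0 T) `*` I01) (fun p : R * R => phi p.1 p.2) /\
  measurable_fun ((Icc 0 T) `*` I01) (fun p : R * R => phix p.1 p.2) /\
  {ae mu, forall t, 0 <= t <= T -> H1a alpha (phi t) (phix t)} /\
  (\int[mu]_(t in (Icc 0 T)) H1norm2 alpha (phi t) (phix t) < +oo)%E.

Definition weak_solution (T alpha : R) (f : R -> R -> R) (u0 u1 : R -> R)
    (u ux ut : R -> R -> R) : Prop :=
  CH1 T alpha u ux /\ C1L2 T u ut /\
  {ae mu, forall x, 0 < x < 1 -> u 0 x = u0 x} /\
  forall phi phix psi, testfun T alpha phi phix psi ->
    RI (Icc 0 T) (fun t => RI I01 (fun x =>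
          - ut t x * psi t x + x `^ alpha * ux t x * phix t x))
    - RI I01 (fun x => u1 x * phi 0 x)
    = RI (Icc 0 T) (fun t => RI I01 (fun x => f t x * phi t x)).

End Defs.
Arguments I01 {R}.

(* Main.v *)
Require Import Defs.
From HB Require Import structures.
From mathcomp Require Import all_boot all_order all_algebra.
From mathcomp Require Import all_classical all_reals all_analysis measurable_realfun.
From mathcomp Require Import ring lra.
Import Order.TTheory GRing.Theory Num.Theory.
Import numFieldNormedType.Exports.
Set Implicit Arguments. Unset Strict Implicit. Unset Printing Implicit Defensive.
Local Open Scope classical_set_scope.
Local Open Scope ring_scope.

(** Testing the weak formulation with products [theta(t) v(x)] bounds
    [(u_t(t) - u_t(s), v) + int_s^t a(u, v)] by [|v| int_s^t |f|], where
    [a(u, v) = int x^alpha u_x v_x].  A Dini-derivative argument turns this into a product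
    rule for [(u_t(t), v(t))] along curves [v] that are differentiable in L^2 and continuous
    in the energy space.  The curve [v = u(t + h) - u(t - h)], [h -> 0], gives the energy bound.
    For the boundary layer the multiplier [q u_x] is not admissible, so it is replaced by
    [v(y) = k^-1 int_y^(y+k) q zeta] with [zeta(x) = (u(x) - u(x - k)) / k] and
    [q(x) = (x - dl) (1 - x) / (1 - x + eps)] on [[dl, 1]], where [dl = (1 - eps0) / 2]:
    [v] lies in the energy space, vanishes near 0, and a discrete integration by parts
    produces [- q'] times [zeta^2 / 2].  As [- q'] is of size [1 / eps] on [[1 - eps, 1]]
    and [q'] is bounded above, [int_0^T int_(1-eps)^1 zeta^2] is at most [C eps] times the
    data, uniformly in [k].  Since [u] vanishes at 1, [int_(1-eps)^1 u^2] is at most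
    [2 eps^2 int_(1-eps)^1 zeta^2] plus an error [O(k eps)] times the energy, and
    [k = eps^2 dl / 2] makes both terms [O(eps^3)]. *)

(** * Integrals and continuity on intervals *)

(** The obstacle is regularity: [u(t)] lies only in the energy space and [u_t(t)] only in L^2, so
    neither the energy law (formally tested with [u_t]) nor the multiplier law (formally tested with
    [q u_x]) comes from a direct choice of test function, and no smoother solutions are used as
    approximations. Both are reached by finite differences. In time the step tends to 0; in space
    the step [k] stays positive, because an error of order eps^3 is allowed. At fixed [k] the
    averaged multiplier is a bounded operator on L^2 with norm of order 1 / k, but this norm serves
    only for continuity and differentiability in time: every bound that enters the final constant is
    free of 1 / k. The multiplier vanishes near 0, so gradients are needed in unweighted L^2 only on
    [dl / 2, 1], and the weakly and strongly degenerate cases are treated alike. As eps <= eps0 = 1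
    - 2 dl, the layer lies in [2 dl, 1], where x - dl >= dl; this keeps - q' of order 1 / eps
    there. *)

Section Calculus.
Context {R : realType}.
Local Notation mu := (@lebesgue_measure R).
Local Notation mset := (@measurable _ (measurableTypeR R)).
Implicit Types (D E : set R) (f g F G P : R -> R) (a b c x y r e : R).

Definition intg D f : Prop := mu.-integrable D (EFin \o f).

Lemma measurable_Icc a b : mset (Icc a b).
Proof. exact: measurable_itv. Qed.
Hint Resolve measurable_Icc : core.

Lemma Icc_sub a b c d : c <= a -> b <= d -> Icc a b `<=` Icc c d.
Proof.
move=> ca bd x; rewrite /Icc /= !in_itv /= => /andP[ax xb].
by rewrite (le_trans ca ax) (le_trans xb bd).
Qed.

Lemma IccP a b x : Icc a b x <-> a <= x <= b.
Proof. by rewrite /Icc /= in_itv. Qed.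

Lemma intgD D f g : mset D -> intg D f -> intg D g -> intg D (fun x => f x + g x).
Proof. by move=> mD hf hg; have := @integrableD _ (measurableTypeR R) R mu D mD _ _ hf hg. Qed.

Lemma intgN D f : mset D -> intg D f -> intg D (fun x => - f x).
Proof. by move=> mD hf; have := @integrableN _ (measurableTypeR R) R mu D _ hf. Qed.

Lemma intgB D f g : mset D -> intg D f -> intg D g -> intg D (fun x => f x - g x).
Proof. by move=> mD hf hg; have := @integrableB _ (measurableTypeR R) R mu D mD _ _ hf hg. Qed.

Lemma intgZ D r f : mset D -> intg D f -> intg D (fun x => r * f x).
Proof. by move=> mD hf; have := @integrableZl _ (measurableTypeR R) R mu D mD r _ hf. Qed.

Lemma intg_measurable D f : intg D f -> measurable_fun D f.
Proof. by move=> /integrableP[/measurable_EFinP]. Qed.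

Lemma intg_le D f g : mset D -> measurable_fun D f ->
  (forall x, D x -> `|f x| <= g x) -> intg D g -> intg D f.
Proof.
move=> mD mf fg hg; apply: (@le_integrable _ (measurableTypeR R) R mu _ mD _ _ _ _ hg); first exact/measurable_EFinP.
move=> x Dx /=; rewrite lee_fin (le_trans (fg x Dx)) //; exact: ler_norm.
Qed.

Lemma intg_sub D E f : mset D -> mset E -> E `<=` D -> intg D f -> intg E f.
Proof. by move=> mD mE ED; exact: (@integrableS _ (measurableTypeR R) R mu). Qed.

Lemma intg_eq D f g : mset D -> (forall x, D x -> f x = g x) -> intg D f -> intg D g.
Proof. by move=> mD fg; apply: (@eq_integrable _ (measurableTypeR R) R mu _ mD) => x /set_mem Dx /=; rewrite fg. Qed.

Lemma intg_abs D f : mset D -> intg D f -> intg D (fun x => `|f x|).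
Proof. by move=> mD; exact: (@integrable_norm _ (measurableTypeR R) R mu). Qed.

Lemma RID D f g : mset D -> intg D f -> intg D g ->
  RI D (fun x => f x + g x) = RI D f + RI D g.
Proof. exact: (@RintegralD _ (measurableTypeR R) R mu). Qed.

Lemma RIB D f g : mset D -> intg D f -> intg D g ->
  RI D (fun x => f x - g x) = RI D f - RI D g.
Proof. exact: (@RintegralB _ (measurableTypeR R) R mu). Qed.

Lemma RIZ D r f : mset D -> intg D f -> RI D (fun x => r * f x) = r * RI D f.
Proof. by move=> mD hf; exact: (@RintegralZl _ (measurableTypeR R) R mu D f r mD hf). Qed.

Lemma RIN D f : mset D -> intg D f -> RI D (fun x => - f x) = - RI D f.
Proof.
move=> mD hf; rewrite -mulN1r -RIZ //; congr RI; apply/funext => x.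
by rewrite mulN1r.
Qed.

Lemma RI_eq D f g : (forall x, D x -> f x = g x) -> RI D f = RI D g.
Proof. by move=> fg; apply: (@eq_Rintegral _ (measurableTypeR R) R mu) => x /set_mem; exact: fg. Qed.

Lemma RI_le D f g : mset D -> intg D f -> intg D g ->
  (forall x, D x -> f x <= g x) -> RI D f <= RI D g.
Proof. exact: (@le_Rintegral _ (measurableTypeR R) R mu). Qed.

Lemma RI_ge0 D f : (forall x, D x -> 0 <= f x) -> 0 <= RI D f.
Proof. exact: (@Rintegral_ge0 _ (measurableTypeR R) R mu). Qed.

Lemma RI_abs D f : mset D -> intg D f -> `|RI D f| <= RI D (fun x => `|f x|).
Proof. exact: (@le_normr_Rintegral _ (measurableTypeR R) R mu). Qed.

Lemma RI_point a f : RI (Icc a a) f = 0.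
Proof. by rewrite /RI /Icc set_itv1 Rintegral_set1. Qed.

Lemma lebesgue_Icc a b : a <= b -> mu (Icc a b) = (b - a)%:E.
Proof.
move=> ab; have := @lebesgue_measure_itv R `[a, b]; rewrite /= lte_fin /Icc => ->.
case: ltP => [_|ba]; first by rewrite -EFinB.
by have -> : a = b; [apply/le_anti/andP | rewrite subrr].
Qed.

Lemma RI_cst a b r : a <= b -> RI (Icc a b) (fun=> r) = r * (b - a).
Proof.
move=> ab; rewrite /RI Rintegral_cst //; congr (_ * _).
exact: (congr1 fine (lebesgue_Icc ab)).
Qed.

Lemma intg_cst a b r : intg (Icc a b) (fun=> r).
Proof.
have [ab|ba] := leP a b; last first.
  by rewrite /Icc set_itv_ge ?bnd_simp -?ltNge //; exact: integrable_set0.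
apply: (@measurable_bounded_integrable _ (measurableTypeR R) R mu _ _ (measurable_Icc a b)).
- by apply: (@eq_ind_r _ _ (fun m => m < +oo)%E _ _ (lebesgue_Icc ab)); rewrite ltry.
- exact: measurable_cst.
- by exists `|r|; split => // M rM x _ /=; exact: ltW.
Qed.

Lemma RI_chasles a b c f : a <= b -> b <= c -> intg (Icc a c) f ->
  RI (Icc a c) f = RI (Icc a b) f + RI (Icc b c) f.
Proof.
move=> ab bc hf.
have hbc : intg (Icc b c) f by apply: intg_sub hf => //; exact: Icc_sub.
have := @Rintegral_itvB R f (BLeft a) (BRight c) b hf.
rewrite !bnd_simp => /(_ ab bc); rewrite (Rintegral_itv_obnd_cbnd (r := b)); last first.
  apply: intg_sub hbc => //; apply: subset_itvr; by rewrite bnd_simp.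
by rewrite /RI /Icc => <-; rewrite addrC subrK.
Qed.

Lemma RI_norm_le a b f M : a <= b -> intg (Icc a b) f ->
  (forall x, a <= x <= b -> `|f x| <= M) -> `|RI (Icc a b) f| <= M * (b - a).
Proof.
move=> ab hf hM; rewrite -RI_cst //.
apply: (le_trans (RI_abs (measurable_Icc a b) hf)).
apply: RI_le; [exact: measurable_Icc | exact: intg_abs | exact: intg_cst |].
by move=> x /IccP; exact: hM.
Qed.

(** Epsilon-delta form, because the Dini arguments consume explicit radii [d]. It is vacuous when
    [b < a], so an interval such as [[0, T - h]] needs no side condition. *)
Definition contI a b F : Prop := forall x, a <= x <= b -> forall e, 0 < e ->
  exists2 d, 0 < d & forall y, a <= y <= b -> `|y - x| < d -> `|F y - F x| < e.

Lemma contI_within a b F : contI a b F <-> {within `[a, b], continuous F}.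
Proof.
split=> [cF|/subspace_continuousP cF].
  apply/subspace_continuousP => x xab; apply/cvgrPdist_lt => e e0.
  have [|d d0 hd] := cF x _ e e0; first exact/IccP.
  exists d => //= y /= xy yab; rewrite distrC; apply: hd; first exact/IccP.
  by rewrite distrC.
move=> x xab e e0; have /cF : (`[a, b]%classic : set R) x by exact/IccP.
move=> /cvgrPdist_lt /(_ e e0) [d /= d0 hd]; exists d => // y yab yx.
by rewrite distrC; apply: hd; [rewrite /= distrC | exact/IccP].
Qed.

Lemma contI_sub a b c d F : a <= c -> d <= b -> contI a b F -> contI c d F.
Proof.
move=> ac db cF x /andP[cx xd] e e0.
have [|k k0 hk] := cF x _ e e0; first by rewrite (le_trans ac cx) (le_trans xd db).
exists k => // y /andP[cy yd]; apply: hk.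
by rewrite (le_trans ac cy) (le_trans yd db).
Qed.

Lemma contI_cst a b r : contI a b (fun=> r).
Proof. by move=> x _ e e0; exists 1 => // y _ _; rewrite subrr normr0. Qed.

Lemma contI_id a b : contI a b (fun x => x).
Proof. by move=> x _ e e0; exists e. Qed.

Lemma contID a b F G : contI a b F -> contI a b G -> contI a b (fun x => F x + G x).
Proof.
move=> /contI_within cF /contI_within cG; apply/contI_within => x.
exact: (continuousD (cF x) (cG x)).
Qed.

Lemma contIM a b F G : contI a b F -> contI a b G -> contI a b (fun x => F x * G x).
Proof.
move=> /contI_within cF /contI_within cG; apply/contI_within => x.
exact: (continuousM (cF x) (cG x)).
Qed.

Lemma contIZ a b r F : contI a b F -> contI a b (fun x => r * F x).
Proof. by move=> cF; apply: contIM => //; exact: contI_cst. Qed.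

Lemma contIN a b F : contI a b F -> contI a b (fun x => - F x).
Proof.
move=> /contI_within cF; apply/contI_within => x; exact: (continuousN (cF x)).
Qed.

Lemma contIB a b F G : contI a b F -> contI a b G -> contI a b (fun x => F x - G x).
Proof. by move=> cF cG; apply: contID => //; exact: contIN. Qed.

Lemma contI_eq a b F G : (forall x, a <= x <= b -> F x = G x) -> contI a b F -> contI a b G.
Proof.
move=> FG cF x xab e e0; have [d d0 hd] := cF x xab e e0.
by exists d => // y yab yx; rewrite -!FG //; exact: hd.
Qed.

Lemma intg_contI a b F : contI a b F -> intg (Icc a b) F.
Proof.
move=> /contI_within cF.
by apply: (@continuous_compact_integrable R F (Icc a b)) => //; exact: segment_compact.
Qed.

Lemma contI_bounded a b F : contI a b F ->
  exists2 M, 0 < M & forall x, a <= x <= b -> `|F x| <= M.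
Proof.
move=> /contI_within cF.
have [M [_ hM]] : bounded_set (F @` `[a, b]).
  by apply/compact_bounded/continuous_compact => //; exact: segment_compact.
exists (`|M| + 1) => [|x xab]; first by rewrite ltr_pwDr.
apply: (hM (`|M| + 1)); first by rewrite ltr_pwDr // ler_norm.
by exists x => //; exact/IccP.
Qed.

Lemma contI_RI a b f : intg (Icc a b) f -> contI a b (fun x => RI (Icc a x) f).
Proof.
move=> hf; have [ab|ba] := leP a b; last first.
  by move=> x /andP[ax xb]; have := le_lt_trans (le_trans ax xb) ba; rewrite ltxx.
by apply/contI_within; exact: (parameterized_integral_continuous ab hf).
Qed.

Lemma RI_mean a b F x : contI a b F -> a <= x < b -> forall e, 0 < e ->
  exists2 d, 0 < d & forall h, 0 < h < d -> x + h <= b ->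
    `|RI (Icc x (x + h)) F - h * F x| <= e * h.
Proof.
move=> cF /andP[ax xb] e e0; have [|d d0 hd] := cF x _ e e0; first by rewrite ax ltW.
exists d => // h /andP[h0 hd'] xhb.
have xxh : x <= x + h by rewrite lerDl ltW.
have iF : intg (Icc x (x + h)) F.
  by apply: intg_contI; apply: contI_sub cF.
have -> : h * F x = RI (Icc x (x + h)) (fun=> F x) by rewrite RI_cst //; ring.
rewrite -RIB //; last exact: intg_cst.
have -> : e * h = e * (x + h - x) by ring.
apply: RI_norm_le => //; first by apply: intgB => //; exact: intg_cst.
move=> y /andP[xy yxh]; apply/ltW/hd; first by rewrite (le_trans ax xy) (le_trans yxh).
rewrite ger0_norm ?subr_ge0 //; apply: le_lt_trans hd'; lra.
Qed.

(* The set of [x] up to which [G - e P] stays below its value at [a] is closed by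
   continuity and open to the right by the Dini condition. *)
Lemma dini_le a b G P : a <= b -> contI a b G -> contI a b P ->
  (forall x, a <= x < b -> forall e, 0 < e -> exists2 d, 0 < d & forall h, 0 < h < d ->
     x + h <= b -> G (x + h) - G x <= e * (P (x + h) - P x)) ->
  G b <= G a.
Proof.
move=> ab cG cP hG.
suff main e : 0 < e -> G b - G a <= e * (P b - P a).
  rewrite -subr_le0; apply/ler_addgt0Pr => e e0; rewrite add0r.
  have [PP|PP] := leP (P b - P a) 0.
    by apply: (le_trans (main 1 ltr01)); rewrite mul1r (le_trans PP) ?ltW.
  have := main (e / (P b - P a)); rewrite divr_gt0 // => /(_ isT).
  by rewrite divfK // gt_eqF.
move=> e0; pose H x := G x - e * P x.
have cH : contI a b H by apply: contIB => //; exact: contIZ.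
suff : H b <= H a by rewrite /H; lra.
pose S := [set x | a <= x <= b /\ forall y, a <= y <= x -> H y <= H a].
have Sa : S a.
  split; first by rewrite lexx.
  by move=> y /andP[ay ya]; have -> : y = a by apply/le_anti; rewrite ya.
have Sb : ubound S b by move=> x [/andP[]].
have hs : has_sup S by split; [exists a | exists b].
set s := sup S.
have as_ : a <= s by apply: sup_upper_bound.
have sb : s <= b by apply: ge_sup => //; exists a.
have Hs y : a <= y < s -> H y <= H a.
  move=> /andP[ay ys]; have := @sup_adherent _ S (s - y).
  rewrite subr_gt0 => /(_ ys hs) [z [_ hz]]; rewrite -/s opprB addrCA subrr addr0 => yz.
  by apply: hz; rewrite ay ltW.
have HsE : H s <= H a.
  have [sa|sa] := leP s a; first by have -> : s = a by apply/le_anti; rewrite sa.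
  rewrite leNgt; apply/negP => has_.
  have [||d d0 hd] := cH s _ (H s - H a); [by rewrite as_ | by rewrite subr_gt0 |].
  pose y := Num.max a (s - d / 2).
  have ys : a <= y < s by rewrite /y le_max lexx /= gt_max sa /=; lra.
  have := hd y; have := Hs y ys; move/andP: ys => [ay ys].
  rewrite ay (le_trans (ltW ys) sb) => Hy /(_ isT).
  have ysd : `|y - s| < d.
    rewrite ler0_norm ?subr_le0 ?ltW // opprB.
    have : s - d / 2 <= y by rewrite /y le_max lexx orbT.
    lra.
  move=> /(_ ysd); rewrite ltr_norml; lra.
have [bs|sltb] := leP b s; first by have -> : b = s by apply/le_anti; rewrite bs.
have [|d d0 hd] := hG s _ e e0; first by rewrite as_.
pose h := Num.min (d / 2) (b - s).
have h0 : 0 < h by rewrite /h lt_min subr_gt0 sltb andbT divr_gt0.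
have hb : s + h <= b.
  have : h <= b - s by rewrite /h ge_min lexx orbT.
  lra.
have hd2 : h <= d / 2 by rewrite /h ge_min lexx.
suff : S (s + h) by move=> /(sup_upper_bound hs); rewrite -/s; lra.
split; first by rewrite hb andbT; lra.
move=> y /andP[ay ysh]; have [ys|sy] := ltP y s; first by apply: Hs; rewrite ay.
have [->//|yns] := eqVneq y s.
have sy' : s < y by rewrite lt_neqAle eq_sym yns.
have := hd (y - s); rewrite subr_gt0 sy' /= (_ : s + (y - s) = y); last by ring.
have -> : y - s < d by lra.
move=> /(_ isT (le_trans ysh hb)); move: HsE; rewrite /H; lra.
Qed.

Section Shift.
Variable c : R.
Let phi : measurableTypeR R -> measurableTypeR R := fun x => x + c.

Let mphi : measurable_fun setT phi.
Proof. exact: (@measurable_funD _ _ R setT (@id R) (cst c)). Qed.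

(** Uniqueness of Lebesgue measure reduces translation invariance to intervals []u, v]], whose
    translates keep their length. *)
Lemma lebesgue_shift (A : set R) : mset A -> pushforward mu phi A = mu A.
Proof.
move=> mA; apply/esym/lebesgue_measure_unique => //= _ [[u v]] _ <-.
rewrite /pushforward (_ : phi @^-1` _ = `]u - c, v - c]%classic); last first.
  by apply/seteqP; split => x /=; rewrite !in_itv /= /phi ltrBlDr lerBrDr.
have := @lebesgue_measure_itv R `]u, v]; have := @lebesgue_measure_itv R `]u - c, v - c].
rewrite /= !lte_fin ltrD2r => -> ->; case: ifP => // _.
by rewrite -!EFinB; congr _%:E; ring.
Qed.
End Shift.

End Calculus.

(** * Absolutely continuous functions on an interval *)

Section Primitives.
Context {R : realType}.
Local Notation mu := (@lebesgue_measure R).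
Local Notation mset := (@measurable _ (measurableTypeR R)).
Implicit Types (D E : set R) (f g F G P : R -> R) (a b c x y r e h : R).
Hint Resolve measurable_Icc : core.

Section Shift.
Variable c : R.
Let phi : measurableTypeR R -> measurableTypeR R := fun x => x + c.

Let mphi : measurable_fun setT phi.
Proof. exact: (@measurable_funD _ _ R setT (@id R) (cst c)). Qed.

Lemma ge0_integral_shift D (f : R -> \bar R) : mset D ->
  measurable_fun (D : set (measurableTypeR R)) f -> (forall x, D x -> 0 <= f x)%E ->
  (\int[mu]_(x in phi @^-1` D) f (x + c)%R = \int[mu]_(x in D) f x)%E.
Proof.
move=> mD mf f0.
have := @ge0_integral_pushforward _ _ _ _ R phi mphi mu D f mD mf.
rewrite /comp /phi => <-; last by move=> x /set_mem; exact: f0.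
by apply: eq_measure_integral => A mA _; exact: lebesgue_shift.
Qed.

Let preimage_Icc a b : phi @^-1` (Icc (a + c) (b + c)) = Icc a b.
Proof.
by apply/seteqP; split => x; rewrite /phi /Icc /= !in_itv /= !lerD2r.
Qed.

Let mshift D (f : R -> \bar R) : mset D ->
  measurable_fun (D : set (measurableTypeR R)) f ->
  measurable_fun (phi @^-1` D) (fun x : measurableTypeR R => f (x + c)).
Proof.
move=> mD mf; apply: (@measurable_comp _ _ _ _ _ _ D f _ phi) => //.
  by move=> y [x + <-].
exact: measurable_funTS.
Qed.

Lemma intg_shift a b f : intg (Icc (a + c) (b + c)) f -> intg (Icc a b) (fun x => f (x + c)).
Proof.
move=> /integrableP[mf hf]; apply/integrableP.
have mI : mset (Icc (a + c) (b + c)) by [].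
split; first by have := mshift mI mf; rewrite preimage_Icc.
have mfa : measurable_fun (Icc (a + c) (b + c) : set (measurableTypeR R))
    (fun x => `|(f x)%:E|)%E by exact: measurableT_comp.
have := ge0_integral_shift mI mfa; rewrite preimage_Icc /= => -> //.
Qed.

Lemma RI_shift a b f : intg (Icc (a + c) (b + c)) f ->
  RI (Icc a b) (fun x => f (x + c)) = RI (Icc (a + c) (b + c)) f.
Proof.
move=> /integrableP[mf hf]; have mI : mset (Icc (a + c) (b + c)) by [].
apply: (congr1 fine); rewrite integralE [RHS]integralE.
have mp := measurable_funepos mf; have mn := measurable_funeneg mf.
have := ge0_integral_shift mI mn; rewrite preimage_Icc => <-; last first.
  by move=> x _; exact: funeneg_ge0.
have := ge0_integral_shift mI mp; rewrite preimage_Icc => <-; last first.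
  by move=> x _; exact: funepos_ge0.
by congr (_ - _)%E; apply: eq_integral => x _; rewrite !(funeposE, funenegE).
Qed.
End Shift.

Lemma intg_mul_contI a b f G : contI a b G -> intg (Icc a b) f ->
  intg (Icc a b) (fun x => f x * G x).
Proof.
move=> cG hf; have [M M0 hM] := contI_bounded cG.
apply: (@intg_le R _ _ (fun x => M * `|f x|)) => //.
- exact: measurable_funM (intg_measurable hf) (intg_measurable (intg_contI cG)).
- by move=> x /IccP xab; rewrite normrM mulrC ler_wpM2r // hM.
- by apply: intgZ => //; exact: intg_abs.
Qed.

(** [F] is absolutely continuous on [[a, b]] with almost everywhere derivative [f], expressed
    through increments so that no pointwise derivative has to be taken. *)
Definition prim a b F f : Prop := intg (Icc a b) f /\
  forall x y, a <= x -> x <= y -> y <= b -> F y - F x = RI (Icc x y) f.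

Lemma prim_sub a b c d F f : a <= c -> d <= b -> prim a b F f -> prim c d F f.
Proof.
move=> ac db [hf hF]; split; first by apply: intg_sub hf => //; exact: Icc_sub.
by move=> x y cx xy yd; apply: hF => //; [exact: le_trans cx | exact: le_trans db].
Qed.

Lemma prim_contI a b F f : prim a b F f -> contI a b F.
Proof.
move=> [hf hF]; have := contI_RI hf.
move=> c x xab; move/andP: (xab) => [ax xb].
apply: (contI_eq (F := fun x => F a + RI (Icc a x) f)) xab.
  move=> y /andP[ay yb]; rewrite -hF //; ring.
by apply: contID => //; exact: contI_cst.
Qed.

Lemma prim_RI a b f : intg (Icc a b) f -> prim a b (fun x => RI (Icc a x) f) f.
Proof.
move=> hf; split=> // x y ax xy yb; rewrite (RI_chasles ax xy); first by ring.
by apply: intg_sub hf => //; exact: Icc_sub.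
Qed.

Lemma primD a b F G f g : prim a b F f -> prim a b G g ->
  prim a b (fun x => F x + G x) (fun x => f x + g x).
Proof.
move=> [hf hF] [hg hG]; split; first exact: intgD.
move=> x y ax xy yb; rewrite RID //; first by rewrite -hF // -hG //; ring.
  by apply: intg_sub hf => //; exact: Icc_sub.
by apply: intg_sub hg => //; exact: Icc_sub.
Qed.

Lemma primZ a b r F f : prim a b F f -> prim a b (fun x => r * F x) (fun x => r * f x).
Proof.
move=> [hf hF]; split; first exact: intgZ.
move=> x y ax xy yb; rewrite RIZ //; first by rewrite -hF // -mulrBr.
by apply: intg_sub hf => //; exact: Icc_sub.
Qed.

Lemma primB a b F G f g : prim a b F f -> prim a b G g ->
  prim a b (fun x => F x - G x) (fun x => f x - g x).
Proof.
move=> hF /(primZ (-1)) hG; have := primD hF hG.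
by congr prim; apply/funext => x; rewrite mulN1r.
Qed.

Lemma prim_shift a b c F f : prim (a + c) (b + c) F f ->
  prim a b (fun x => F (x + c)) (fun x => f (x + c)).
Proof.
move=> [hf hF]; split; first exact: intg_shift.
move=> x y ax xy yb; rewrite RI_shift; first by rewrite hF // lerD2r.
by apply: intg_sub hf => //; apply: Icc_sub; rewrite lerD2r.
Qed.

Lemma prim_intg a b F f : prim a b F f -> intg (Icc a b) f. Proof. by case. Qed.

Lemma prim_eq a b F f G g : (forall x, a <= x <= b -> F x = G x) ->
  (forall x, a <= x <= b -> f x = g x) -> prim a b F f -> prim a b G g.
Proof.
move=> FG fg [hf hF]; split; first by apply: intg_eq hf => // x /IccP; exact: fg.
move=> x y ax xy yb; rewrite -!FG ?hF //.
- apply: RI_eq => z /IccP /andP[xz zy]; rewrite fg //.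
  by rewrite (le_trans ax xz) (le_trans zy yb).
- by rewrite ax (le_trans xy).
- by rewrite yb (le_trans ax).
Qed.

(** The product rule without almost everywhere derivatives. Over [[x, x + h]] the defect is the
    integral of [f y * (G x - G y) + (F (x + h) - F y) * g y], and continuity makes both brackets at
    most [e]. Hence the comparison function given to [dini_le] is the integral of [|f| + |g|] rather
    than the variable itself. *)
Let prim_mul_le a b F f G g : a <= b -> prim a b F f -> prim a b G g ->
  F b * G b - F a * G a <= RI (Icc a b) (fun x => f x * G x + F x * g x).
Proof.
move=> ab pF pG; have cF := prim_contI pF; have cG := prim_contI pG.
have [hf hF] := pF; have [hg hG] := pG.
have hfG := intg_mul_contI cG hf; have hgF := intg_mul_contI cF hg.
pose k x := f x * G x + F x * g x.
have hk : intg (Icc a b) k.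
  by apply: intgD => //; apply: intg_eq hgF => // x _; exact: mulrC.
pose m x := `|f x| + `|g x|.
have hm : intg (Icc a b) m by apply: intgD => //; exact: intg_abs.
suff : F b * G b - RI (Icc a b) k <= F a * G a - RI (Icc a a) k.
  by rewrite RI_point /k; lra.
apply: (@dini_le R a b (fun x => F x * G x - RI (Icc a x) k) (fun x => RI (Icc a x) m)) => //.
- by apply: contIB; [exact: contIM | exact: contI_RI].
- exact: contI_RI.
move=> x /andP[ax xb] e e0.
have [||d1 d10 hd1] := cF x _ (e / 2); [by rewrite ax ltW | by rewrite divr_gt0 |].
have [||d2 d20 hd2] := cG x _ (e / 2); [by rewrite ax ltW | by rewrite divr_gt0 |].
exists (Num.min d1 d2) => [|h]; first by rewrite lt_min d10.
rewrite lt_min => /andP[h0 /andP[h1 h2]] xhb.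
have xxh : x <= x + h by rewrite lerDl ltW.
have sub u : intg (Icc a b) u -> intg (Icc x (x + h)) u.
  by move=> hu; apply: intg_sub hu => //; exact: Icc_sub.
have suba u : intg (Icc a b) u -> intg (Icc a (x + h)) u.
  by move=> hu; apply: intg_sub hu => //; exact: Icc_sub.
rewrite (RI_chasles ax xxh (suba _ hk)) (RI_chasles ax xxh (suba _ hm)).
rewrite [leRHS](_ : _ = e * RI (Icc x (x + h)) m); last by ring.
have -> : F (x + h) * G (x + h) - (RI (Icc a x) k + RI (Icc x (x + h)) k)
    - (F x * G x - RI (Icc a x) k) =
    (G x * (F (x + h) - F x) + F (x + h) * (G (x + h) - G x)) - RI (Icc x (x + h)) k by ring.
have mI := measurable_Icc x (x + h).
rewrite hF // hG // -(RIZ (G x) mI (sub _ hf)) -(RIZ _ mI (sub _ hg)) -(RIZ e mI (sub _ hm)).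
have i1 := intgZ (G x) mI (sub _ hf).
have i2 := intgZ (F (x + h)) mI (sub _ hg).
rewrite -(RID mI i1 i2) -(RIB mI (intgD mI i1 i2) (sub _ hk)).
apply: RI_le => //; [exact: (intgB mI (intgD mI i1 i2) (sub _ hk))
  | exact: (intgZ e mI (sub _ hm)) |].
move=> y /IccP /andP[xy yxh].
have yab : a <= y <= b by rewrite (le_trans ax xy) (le_trans yxh).
have xhab : a <= x + h <= b by rewrite (le_trans ax xxh).
have yx : `|y - x| <= h by rewrite ger0_norm ?subr_ge0 //; lra.
have hGy := hd2 y yab (le_lt_trans yx h2).
have hFy := hd1 y yab (le_lt_trans yx h1).
have hFh : `|F (x + h) - F x| < e / 2.
  by apply: hd1 => //; rewrite [x + h]addrC addrK gtr0_norm.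
have -> : G x * f y + F (x + h) * g y - k y =
   f y * (G x - G y) + (F (x + h) - F y) * g y by rewrite /k; ring.
apply: (le_trans (ler_norm _)); apply: (le_trans (ler_normD _ _)).
rewrite !normrM /m mulrDr; apply: lerD.
  rewrite mulrC ler_wpM2r // distrC; apply/ltW/(lt_trans hGy); lra.
rewrite ler_wpM2r // (_ : F (x + h) - F y = (F (x + h) - F x) - (F y - F x)); last by ring.
apply: (le_trans (ler_normB _ _)); lra.
Qed.

Lemma prim_mul a b F f G g : prim a b F f -> prim a b G g ->
  prim a b (fun x => F x * G x) (fun x => f x * G x + F x * g x).
Proof.
move=> pF pG; have cF := prim_contI pF; have cG := prim_contI pG.
have hfG := intg_mul_contI cG (prim_intg pF); have hgF := intg_mul_contI cF (prim_intg pG).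
have hk : intg (Icc a b) (fun x => f x * G x + F x * g x).
  by apply: intgD => //; apply: intg_eq hgF => // x _; exact: mulrC.
split=> // x y ax xy yb; apply/le_anti/andP; split.
  by apply: prim_mul_le => //; exact: prim_sub (pF) || exact: prim_sub (pG).
(* The reverse inequality is the same one for [- F]. *)
have pN := primZ (-1) pF.
have := prim_mul_le xy (prim_sub ax yb pN) (prim_sub ax yb pG).
rewrite [X in _ <= X](_ : _ = RI (Icc x y) (fun z => (- 1) * (f z * G z + F z * g z))).
  rewrite RIZ //; first by lra.
  by apply: intg_sub hk => //; exact: Icc_sub.
by apply: RI_eq => z _; ring.
Qed.

Lemma prim_C1 a b F f : (forall x : R, a <= x <= b -> is_derive x (1 : R) F (f x)) ->
  contI a b f -> prim a b F f.
Proof.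
move=> dF cf; split; first exact: intg_contI.
move=> x y ax; rewrite le_eqVlt => /predU1P[<- _|xy yb]; first by rewrite RI_point subrr.
have dF' z : x <= z <= y -> is_derive z (1 : R) F (f z).
  by move=> /andP[xz zy]; apply: dF; rewrite (le_trans ax xz) (le_trans zy yb).
have cF z : x <= z <= y -> F @ z --> F z.
  move=> /dF'[dz _]; apply: differentiable_continuous; exact/derivable1_diffP.
rewrite /RI /Rintegral (@continuous_FTC2 R f F x y) //.
- by apply/contI_within; exact: contI_sub cf.
- split.
  + by move=> z; rewrite in_itv /= => /andP[/ltW xz /ltW zy]; have [|] := dF' z; rewrite ?xz.
  + by apply: cvg_at_right_filter; apply: cF; rewrite lexx ltW.
  + by apply: cvg_at_left_filter; apply: cF; rewrite lexx ltW.
- move=> z; rewrite in_itv /= => /andP[/ltW xz /ltW zy].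
  by rewrite derive1E; have [|_ ->] := dF' z; rewrite ?xz.
Qed.

Lemma RI_near_cst a h c e (B : R -> R) : 0 <= h -> intg (Icc a (a + h)) B ->
  (forall t, a <= t <= a + h -> `|B t - c| <= e) -> `|RI (Icc a (a + h)) B - h * c| <= e * h.
Proof.
move=> h0 iB hB; have aah : a <= a + h by rewrite lerDl.
have -> : h * c = RI (Icc a (a + h)) (fun=> c) by rewrite RI_cst //; ring.
rewrite -RIB; [|exact: measurable_Icc|exact: iB|exact: intg_cst].
have -> : e * h = e * (a + h - a) by ring.
by apply: RI_norm_le => //; apply: intgB => //; exact: intg_cst.
Qed.

Lemma RI_telescope a b h (B : R -> R) : 0 <= h -> a <= b -> intg (Icc (a - h) b) B ->
  RI (Icc a b) (fun t => B t - B (t - h)) = RI (Icc (b - h) b) B - RI (Icc (a - h) a) B.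
Proof.
move=> h0 ab iB.
have sub c d : a - h <= c -> d <= b -> intg (Icc c d) B.
  by move=> ac db; apply: intg_sub iB; [exact: measurable_Icc|exact: measurable_Icc|exact: Icc_sub].
have iBs : intg (Icc a b) (fun t => B (t - h)) by apply: intg_shift; apply: sub; lra.
rewrite RIB; [|exact: measurable_Icc|by apply: sub; lra|exact: iBs].
rewrite RI_shift; last by apply: sub; lra.
have e0 c : a - h <= c <= b -> RI (Icc (a - h) b) B = RI (Icc (a - h) c) B + RI (Icc c b) B.
  by move=> /andP[ac cb]; exact: RI_chasles.
have := e0 a ltac:(lra); have := e0 (b - h) ltac:(lra); lra.
Qed.

End Primitives.

(** * The wave equation in an abstract inner product space *)

Lemma subrACA (V : zmodType) (a b c d : V) : a - b - (c - d) = a - c - (b - d).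
Proof. by rewrite !opprD !opprK addrACA. Qed.

Section SemiInner.
Context {R : realType} (H : lmodType R) (ip : H -> H -> R).

(** Only positive semidefinite: the elements of [L2T] will be functions and not classes, and a
    function that vanishes almost everywhere has norm 0. *)
Record semi_inner : Prop := SemiInner {
  ipC : forall v w, ip v w = ip w v;
  ipDl : forall u v w, ip (u + v) w = ip u w + ip v w;
  ipZl : forall r v w, ip (r *: v) w = r * ip v w;
  ip_ge0 : forall v, 0 <= ip v v }.

Definition nrm v := Num.sqrt (ip v v).

Hypothesis sip : semi_inner.
Implicit Types (u v w : H) (a b e h r s t x y K M : R) (c d : R -> H).

Lemma ipDr u v w : ip u (v + w) = ip u v + ip u w.
Proof. by rewrite ipC // ipDl // !(ipC sip u). Qed.

Lemma ipZr r v w : ip v (r *: w) = r * ip v w.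
Proof. by rewrite ipC // ipZl // (ipC sip v). Qed.

Lemma ipNl v w : ip (- v) w = - ip v w.
Proof. by rewrite -scaleN1r ipZl // mulN1r. Qed.

Lemma ipNr v w : ip v (- w) = - ip v w.
Proof. by rewrite -scaleN1r ipZr mulN1r. Qed.

Lemma ipBl u v w : ip (u - v) w = ip u w - ip v w.
Proof. by rewrite ipDl // ipNl. Qed.

Lemma ipBr u v w : ip u (v - w) = ip u v - ip u w.
Proof. by rewrite ipDr ipNr. Qed.

Lemma nrm_ge0 v : 0 <= nrm v. Proof. exact: sqrtr_ge0. Qed.

Lemma nrm2 v : nrm v ^+ 2 = ip v v. Proof. by rewrite sqr_sqrtr // ip_ge0. Qed.

Lemma cauchy_schwarz v w : `|ip v w| <= nrm v * nrm w.
Proof.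
rewrite -(@ler_pXn2r _ 2) ?nnegrE ?mulr_ge0 ?nrm_ge0 //.
rewrite exprMn !nrm2 real_normK ?num_real //.
have p r : 0 <= ip v v + 2 * r * ip v w + r ^+ 2 * ip w w.
  have := ip_ge0 sip (v + r *: w).
  rewrite ipDl // !ipDr ipZl // ipZr ipZl // ipZr // (ipC sip w v).
  by congr (0 <= _); ring.
have [w0|w0] := eqVneq (ip w w) 0.
  have [->|n0] := eqVneq (ip v w) 0; first by rewrite w0 mulr0 expr0n.
  (* With [ip w w = 0] the quadratic is affine in [r]; this [r] gives it the value - 1. *)
  have := p (- (ip v v + 1) / (2 * ip v w)).
  rewrite w0 mulr0 addr0 (_ : _ + _ = - 1); first by rewrite lerNr oppr0 ler10.
  by field.
have wp : 0 < ip w w by rewrite lt_neqAle eq_sym w0 ip_ge0.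
have := p (- ip v w / ip w w).
rewrite (_ : _ + _ = (ip v v * ip w w - ip v w ^+ 2) / ip w w); last by field.
by rewrite pmulr_lge0 ?invr_gt0 // subr_ge0.
Qed.

Lemma nrmD v w : nrm (v + w) <= nrm v + nrm w.
Proof.
rewrite -(@ler_pXn2r _ 2) ?nnegrE ?addr_ge0 ?nrm_ge0 //.
rewrite sqrrD !nrm2 ipDl // !ipDr (ipC sip w v).
have := le_trans (ler_norm _) (cauchy_schwarz v w); lra.
Qed.

Lemma nrmZ r v : nrm (r *: v) = `|r| * nrm v.
Proof. by rewrite /nrm ipZl // ipZr mulrA -expr2 sqrtrM ?sqr_ge0 // sqrtr_sqr. Qed.

Lemma nrmN v : nrm (- v) = nrm v.
Proof. by rewrite -scaleN1r nrmZ normrN1 mul1r. Qed.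

Lemma nrmB v w : nrm (v - w) = nrm (w - v).
Proof. by rewrite -nrmN opprB. Qed.

Lemma nrm_triangle v w u : nrm (v - u) <= nrm (v - w) + nrm (w - u).
Proof. by have := nrmD (v - w) (w - u); rewrite addrA subrK. Qed.

Lemma ip_close v w u M e : nrm u <= M -> nrm (v - u) <= e -> nrm (w - u) <= e -> e <= 1 ->
  `|ip v w - ip u u| <= e * (2 * M + 1).
Proof.
move=> uM ve we e1; have e0 : 0 <= e := le_trans (nrm_ge0 _) ve.
have -> : ip v w - ip u u = ip (v - u) (w - u) + ip (v - u) u + ip u (w - u).
  by rewrite !ipBl !ipBr; ring.
have M0 : 0 <= M := le_trans (nrm_ge0 _) uM.
have h1 := cauchy_schwarz (v - u) (w - u).
have h2 := cauchy_schwarz (v - u) u.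
have h3 := cauchy_schwarz u (w - u).
apply: (le_trans (ler_normD _ _)).
apply: (le_trans (lerD (ler_normD _ _) (lexx _))).
have h1' : nrm (v - u) * nrm (w - u) <= e * 1.
  by apply: ler_pM; rewrite ?nrm_ge0 // (le_trans we).
have h2' : nrm (v - u) * nrm u <= e * M by apply: ler_pM; rewrite ?nrm_ge0.
have h3' : nrm u * nrm (w - u) <= M * e by apply: ler_pM; rewrite ?nrm_ge0.
lra.
Qed.

Definition contH a b c : Prop := forall x, a <= x <= b -> forall e, 0 < e ->
  exists2 k : R, 0 < k & forall y, a <= y <= b -> `|y - x| < k -> nrm (c y - c x) < e.

(** A right derivative is enough, because [dini_le] only compares [x] with [x + h]. *)
Definition rderivH a b c d : Prop := forall x, a <= x < b -> forall e, 0 < e ->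
  exists2 k : R, 0 < k & forall h, 0 < h < k -> x + h <= b ->
    nrm (c (x + h) - c x - h *: d x) <= e * h.

Lemma contH_sub a b a' b' c : a <= a' -> b' <= b -> contH a b c -> contH a' b' c.
Proof.
move=> ac db cF x /andP[cx xd] e e0.
have [|k k0 hk] := cF x _ e e0; first by rewrite (le_trans ac cx) (le_trans xd db).
exists k => // y /andP[cy yd]; apply: hk.
by rewrite (le_trans ac cy) (le_trans yd db).
Qed.

Lemma rderivH_sub a b a' b' c d : a <= a' -> b' <= b -> rderivH a b c d -> rderivH a' b' c d.
Proof.
move=> ac db cF x /andP[cx xd] e e0.
have [|k k0 hk] := cF x _ e e0; first by rewrite (le_trans ac cx) (lt_le_trans xd db).
by exists k => // h hh xh; apply: hk => //; exact: le_trans db.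
Qed.

Lemma contH_cst a b v : contH a b (fun=> v).
Proof.
by move=> x _ e e0; exists 1 => // y _ _; rewrite subrr /nrm -(scale0r 0) ipZl // mul0r sqrtr0.
Qed.

Lemma contHB a b c d : contH a b c -> contH a b d -> contH a b (fun t => c t - d t).
Proof.
move=> cc cd x xab e e0; have e2 : 0 < e / 2 by rewrite divr_gt0.
have [k1 k10 h1] := cc x xab _ e2; have [k2 k20 h2] := cd x xab _ e2.
exists (Num.min k1 k2) => [|y yab]; first by rewrite lt_min k10.
rewrite lt_min => /andP[y1 y2].
have -> : c y - d y - (c x - d x) = (c y - c x) - (d y - d x) by rewrite subrACA.
apply: (le_lt_trans (nrmD _ _)); rewrite nrmN.
have := h1 y yab y1; have := h2 y yab y2; lra.
Qed.

Lemma contH_shift a b h c : contH (a + h) (b + h) c -> contH a b (fun t => c (t + h)).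
Proof.
move=> cc x /andP[ax xb] e e0; have [|k k0 hk] := cc (x + h) _ e e0; first by rewrite !lerD2r ax.
exists k => // y /andP[ay yb] yx; apply: hk; first by rewrite !lerD2r ay.
by rewrite opprD addrACA subrr addr0.
Qed.

Lemma rderivH_shift a b h c d : rderivH (a + h) (b + h) c d ->
  rderivH a b (fun t => c (t + h)) (fun t => d (t + h)).
Proof.
move=> cc x /andP[ax xb] e e0; have [|k k0 hk] := cc (x + h) _ e e0.
  by rewrite lerD2r ax ltrD2r.
exists k => // s sk xsb; have -> : x + s + h = x + h + s by ring.
by apply: hk => //; lra.
Qed.

Lemma rderivHB a b c d c' d' : rderivH a b c c' -> rderivH a b d d' ->
  rderivH a b (fun t => c t - d t) (fun t => c' t - d' t).
Proof.
move=> cc cd x xab e e0; have e2 : 0 < e / 2 by rewrite divr_gt0.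
have [k1 k10 h1] := cc x xab _ e2; have [k2 k20 h2] := cd x xab _ e2.
exists (Num.min k1 k2) => [|h /andP[h0]]; first by rewrite lt_min k10.
rewrite lt_min => /andP[y1 y2] xh.
have -> : c (x + h) - d (x + h) - (c x - d x) - h *: (c' x - d' x) =
  (c (x + h) - c x - h *: c' x) - (d (x + h) - d x - h *: d' x).
  by rewrite scalerBr (subrACA (c (x + h))) (subrACA (c (x + h) - c x)) .
apply: (le_trans (nrmD _ _)); rewrite nrmN.
have := h1 h; have := h2 h; rewrite h0 y1 y2 => /(_ isT xh) + /(_ isT xh); lra.
Qed.

Lemma nrm0 : nrm 0 = 0.
Proof. by rewrite /nrm -(scale0r 0) ipZl // mul0r sqrtr0. Qed.

Lemma contH_ip a b c d : contH a b c -> contH a b d -> contI a b (fun t => ip (c t) (d t)).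
Proof.
move=> cc cd x xab e e0.
pose M := nrm (c x) + nrm (d x) + 1.
have M1 : 1 <= M by rewrite /M lerDr addr_ge0 ?nrm_ge0.
have M0 : 0 < M by lra.
pose k := Num.min 1 (e / (2 * M)).
have k0 : 0 < k by rewrite lt_min ltr01 divr_gt0 // mulr_gt0.
have k1 : k <= 1 by rewrite /k ge_min lexx.
have kM : 2 * k * M <= e.
  have : k <= e / (2 * M) by rewrite /k ge_min lexx orbT.
  by rewrite ler_pdivlMr ?mulr_gt0 // mulrCA mulrA.
have [k1' k10 h1] := cc x xab _ k0; have [k2 k20 h2] := cd x xab _ k0.
exists (Num.min k1' k2) => [|y yab]; first by rewrite lt_min k10.
rewrite lt_min => /andP[/(h1 y yab) y1 /(h2 y yab) y2].
have -> : ip (c y) (d y) - ip (c x) (d x) =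
   ip (c y - c x) (d y - d x) + ip (c y - c x) (d x) + ip (c x) (d y - d x).
  by rewrite !ipBl !ipBr; ring.
have g1 := cauchy_schwarz (c y - c x) (d y - d x).
have g2 := cauchy_schwarz (c y - c x) (d x).
have g3 := cauchy_schwarz (c x) (d y - d x).
apply: (le_lt_trans (ler_normD _ _)).
apply: (le_lt_trans (lerD (ler_normD _ _) (lexx _))).
have g1' : nrm (c y - c x) * nrm (d y - d x) < k * 1.
  by apply: ltr_pM; rewrite ?nrm_ge0 // (lt_le_trans y2).
have g2' : nrm (c y - c x) * nrm (d x) <= k * nrm (d x).
  by rewrite ler_wpM2r ?nrm_ge0 // ltW.
have g3' : nrm (c x) * nrm (d y - d x) <= nrm (c x) * k.
  by rewrite ler_wpM2l ?nrm_ge0 // ltW.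
move: kM; rewrite /M; nra.
Qed.

Lemma contH_nrm a b c : contH a b c -> contI a b (fun t => nrm (c t)).
Proof.
move=> cc x xab e e0; have [k k0 hk] := cc x xab e e0; exists k => // y yab yx.
have := hk y yab yx; have := nrmD (c y - c x) (c x); have := nrmD (c x - c y) (c y).
by rewrite !subrK (nrmB (c x)) => ? ? ?; rewrite ltr_norml; lra.
Qed.

(** The mean value inequality for curves: since the right derivative of [c] stays within [M] of [v],
    the function [nrm (c t - c a - (t - a) *: v) - M * t] has nonpositive upper right Dini
    derivatives. *)
Lemma rderivH_sub_le a b c d v M : a <= b -> contH a b c -> rderivH a b c d ->
  (forall t, a <= t <= b -> nrm (d t - v) <= M) ->
  nrm (c b - c a - (b - a) *: v) <= M * (b - a).
Proof.
move=> ab cc cd hM.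
pose g t := c t - c a - (t - a) *: v.
have gE x y : g y - g x = c y - c x - (y - x) *: v.
  rewrite /g subrACA -scalerBl; congr (_ - _ *: _); last by ring.
  by rewrite subrACA subrr subr0.
have ga : g a = 0 by rewrite /g !subrr scale0r subrr.
have cg : contH a b g.
  move=> x xab e e0; have e2 : 0 < e / 2 by rewrite divr_gt0.
  have [k k0 hk] := cc x xab _ e2.
  have w0 : 0 < nrm v + 1 by rewrite ltr_wpDl ?nrm_ge0.
  exists (Num.min k (e / 2 / (nrm v + 1))) => [|y yab]; first by rewrite lt_min k0 divr_gt0.
  rewrite lt_min gE ltr_pdivlMr // => /andP[y1 y2].
  apply: (le_lt_trans (nrmD _ _)); rewrite nrmN nrmZ.
  have := hk y yab y1; have := normr_ge0 (y - x); have := nrm_ge0 v; nra.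
suff : nrm (g b) - M * b <= nrm (g a) - M * a by rewrite ga nrm0 /g; lra.
apply: (@dini_le R a b (fun t => nrm (g t) - M * t) (fun t => t)) => //.
- by apply: contIB; [exact: contH_nrm | apply: contIZ; exact: contI_id].
- exact: contI_id.
move=> x xab e e0; have [k k0 hk] := cd x xab e e0; exists k => // h hk' xhb.
have /andP[h0 _] := hk'; have := hk h hk' xhb.
have := nrm_triangle (g (x + h)) (g x) 0; rewrite !subr0 gE.
have -> : c (x + h) - c x - (x + h - x) *: v =
   c (x + h) - c x - h *: d x + h *: (d x - v).
  by rewrite scalerBr addrA subrK [x + h]addrC addrK.
have := nrmD (c (x + h) - c x - h *: d x) (h *: (d x - v)).
rewrite nrmZ gtr0_norm //; have : nrm (d x - v) <= M.
  by apply: hM; case/andP: xab => -> /ltW ->.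
move=> h1 h2 h3 h4.
have : h * nrm (d x - v) <= h * M by rewrite ler_wpM2l // ltW.
nra.
Qed.

Section WaveEquation.
Variables (T : R) (ut du : R -> H) (inV : H -> H -> Prop) (Fp : R -> R).
Hypothesis cut : contH 0 T ut.
Hypothesis cdu : contH 0 T du.
Hypothesis cFp : contI 0 T Fp.
Hypothesis Fp_nd : forall s t, 0 <= s -> s <= t -> t <= T -> Fp s <= Fp t.
(** The wave equation in increment form: [inV v gv] stands for [v] in the energy space with weighted
    gradient [gv], [du] for the weighted gradient of the solution, [Fp] for a primitive of the norm
    of the source. The time [T] is excluded because a cutoff in time that equals 1 up to [t] needs
    room to descend to 0. *)
Hypothesis weq : forall v gv, inV v gv -> forall s t, 0 <= s -> s <= t -> t < T ->
  `|ip (ut t - ut s) v + RI (Icc s t) (fun r => ip (du r) gv)| <= nrm v * (Fp t - Fp s).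

Lemma pairing_increment a b (v dv v' : R -> H) K : 0 <= a -> a <= b -> b < T ->
  (forall t, a <= t <= b -> inV (v t) (dv t)) ->
  contH a b v -> contH a b dv -> contH a b v' -> rderivH a b v v' ->
  (forall t, a <= t <= b -> nrm (v t) <= K) ->
  ip (ut b) (v b) - ip (ut a) (v a) <=
    RI (Icc a b) (fun t => ip (ut t) (v' t) - ip (du t) (dv t)) + K * (Fp b - Fp a).
Proof.
move=> a0 ab bT vV cv cdv cv' vv' hK.
have sub c : contH 0 T c -> contH a b c by apply: contH_sub => //; exact: ltW.
pose k t := ip (ut t) (v' t) - ip (du t) (dv t).
have ck : contI a b k by apply: contIB; apply: contH_ip => //; exact: sub.
have [M M0 hM] := contI_bounded (contH_nrm (sub _ cut)).
suff : ip (ut b) (v b) - RI (Icc a b) k - K * Fp b <=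
       ip (ut a) (v a) - RI (Icc a a) k - K * Fp a by rewrite RI_point /k; lra.
apply: (@dini_le R a b (fun t => ip (ut t) (v t) - RI (Icc a t) k - K * Fp t) (fun t => t)) => //.
- apply: contIB; last by apply: contIZ; apply: contI_sub cFp => //; exact: ltW.
  by apply: contIB; [apply: contH_ip => //; exact: sub | exact/contI_RI/intg_contI].
- exact: contI_id.
(* The error per unit of [h] is [(M + 3) * e']: [M] from the remainder of [v] paired with
   [ut (x + h)], one from replacing [ut (x + h)] by [ut x], and one from each of the two mean
   values. *)
move=> x xab e e0; pose e' := e / (M + 3).
have M3 : 0 < M + 3 by lra.
have e'0 : 0 < e' by rewrite divr_gt0.
have e'E : e = e' * (M + 3) by rewrite divfK // gt_eqF.
have /andP[ax xb] := xab.
have xab' : a <= x <= b by rewrite ax ltW.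
have [k1 k10 h1] := vv' x xab _ e'0.
have cI : contI a b (fun t => ip (ut t) (v' x)).
  by apply: contH_ip; [exact: sub | exact: contH_cst].
have [k2 k20 h2] := cI x xab' _ e'0.
have [k3 k30 h3] := RI_mean ck xab e'0.
have cJ : contI a b (fun t => ip (du t) (dv x)).
  by apply: contH_ip; [exact: sub | exact: contH_cst].
have [k4 k40 h4] := RI_mean cJ xab e'0.
exists (Num.min (Num.min k1 k2) (Num.min k3 k4)) => [|h /andP[hp]]; first by rewrite !lt_min k10 k20 k30.
rewrite !lt_min => /andP[/andP[hk1 hk2] /andP[hk3 hk4]] xhb.
have xxh : x <= x + h by rewrite lerDl ltW.
have xhab : a <= x + h <= b by rewrite xhb (le_trans ax).
have := h1 h; rewrite hp hk1 => /(_ isT xhb) {}h1.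
have := h2 (x + h) xhab; rewrite (_ : x + h - x = h); last by ring.
rewrite gtr0_norm // => /(_ hk2) {}h2.
have := h3 h; rewrite hp hk3 => /(_ isT xhb) {}h3.
have := h4 h; rewrite hp hk4 => /(_ isT xhb) {}h4.
have := @weq _ _ (vV x xab') x (x + h) (le_trans a0 ax) xxh (le_lt_trans xhb bT).
rewrite (RI_chasles ax xxh); last by apply/intg_contI; apply: contI_sub ck.
have Fpx : Fp x <= Fp (x + h).
  by apply: Fp_nd => //; [exact: le_trans ax | apply: (le_trans xhb); exact: ltW].
have hKx : nrm (v x) * (Fp (x + h) - Fp x) <= K * (Fp (x + h) - Fp x).
  by rewrite ler_wpM2r ?subr_ge0 // hK.
have cs := cauchy_schwarz (ut (x + h)) (v (x + h) - v x - h *: v' x).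
have cs' : nrm (ut (x + h)) * nrm (v (x + h) - v x - h *: v' x) <= M * (e' * h).
  by apply: ler_pM; rewrite ?nrm_ge0 // (le_trans (ler_norm _) (hM _ xhab)).
move: cs; rewrite !ipBl !ipBr ipZr => cs w.
move: h2 h3 h4 cs w; rewrite /k !(ltr_norml, ler_norml).
move=> /andP[h2a h2b] /andP[h3a h3b] /andP[h4a h4b] /andP[csa csb] /andP[wa wb].
have h2' : h * ip (ut (x + h)) (v' x) <= h * (ip (ut x) (v' x) + e').
  by rewrite ler_wpM2l ?ltW //; lra.
rewrite e'E; nra.
Qed.

End WaveEquation.

End SemiInner.

(** * The energy bound for the abstract wave equation *)

Section Energy.
Context {R : realType} (H : lmodType R) (ip : H -> H -> R).
Hypothesis sip : semi_inner ip.
Hint Resolve measurable_Icc : core.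
Local Notation nrm := (nrm ip).
Local Notation contH := (contH ip).
Local Notation rderivH := (rderivH ip).
Variables (T : R) (u ut du : R -> H) (inV : H -> H -> Prop) (Fp : R -> R).
Hypothesis T0 : 0 < T.
Hypothesis cu : contH 0 T u.
Hypothesis cut : contH 0 T ut.
Hypothesis cdu : contH 0 T du.
Hypothesis uut : rderivH 0 T u ut.
Hypothesis uV : forall t, 0 <= t <= T -> inV (u t) (du t).
Hypothesis inVB : forall v gv w gw, inV v gv -> inV w gw -> inV (v - w) (gv - gw).
Hypothesis cFp : contI 0 T Fp.
Hypothesis Fp_nd : forall s t, 0 <= s -> s <= t -> t <= T -> Fp s <= Fp t.
Hypothesis weq : forall v gv, inV v gv -> forall s t, 0 <= s -> s <= t -> t < T ->
  `|ip (ut t - ut s) v + RI (Icc s t) (fun r => ip (du r) gv)| <= nrm v * (Fp t - Fp s).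

Definition energy t := (ip (ut t) (ut t) + ip (du t) (du t)) / 2.

Lemma contI_energy : contI 0 T energy.
Proof.
apply: (contI_eq (F := fun t => 2^-1 * (ip (ut t) (ut t) + ip (du t) (du t)))).
  by move=> t _; rewrite /energy mulrC.
by apply: contIZ; apply: contID; exact: (contH_ip sip).
Qed.

(** The bookkeeping of [energy_step] at the times [t1] and [t2]: the [N] are the pairings of [ut]
    with the symmetric difference of [u], the [A] and [D] the squared norms of [ut] and [du], the
    [B] the integrals of [shifted h] over the preceding interval of length [h]. Divided by [2 * h],
    the pairings cost [2 * M' * n] and the integrals [2 * n * (2 * M' + 1)], in sum
    [n * (6 * M' + 2)]. *)
Let energy_step_arith (h e n M' N1 N2 A1 A2 D1 D2 B1 B2 F : R) :
  - (M' * (n * (2 * h))) <= N1 - 2 * h * A1 -> N1 - 2 * h * A1 <= M' * (n * (2 * h)) ->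
  - (M' * (n * (2 * h))) <= N2 - 2 * h * A2 -> N2 - 2 * h * A2 <= M' * (n * (2 * h)) ->
  - (2 * (n * (2 * M' + 1)) * h) <= B1 - h * (A1 - D1) ->
  B1 - h * (A1 - D1) <= 2 * (n * (2 * M' + 1)) * h ->
  - (2 * (n * (2 * M' + 1)) * h) <= B2 - h * (A2 - D2) ->
  B2 - h * (A2 - D2) <= 2 * (n * (2 * M' + 1)) * h ->
  N2 - N1 <= B2 - B1 + 2 * h * F ->
  h * (n * (6 * M' + 2)) <= h * e ->
  2 * h * ((A2 + D2) / 2) <= 2 * h * ((A1 + D1) / 2 + F + e).
Proof. lra. Qed.

Let symdiff_close (h p M1 : R) v : 0 < h -> h <= p -> p + h <= T ->
  (forall t, p - h <= t <= p + h -> nrm (ut t - v) <= M1) ->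
  nrm (u (p + h) - u (p - h) - (2 * h) *: v) <= M1 * (2 * h).
Proof.
move=> h0 hp hpT hv; have <- : p + h - (p - h) = 2 * h by ring.
apply: (rderivH_sub_le (d := ut) sip _ _ _ hv); first by lra.
  by apply: contH_sub cu; lra.
by apply: rderivH_sub uut; lra.
Qed.

Let pair_close (h p n M' : R) : 0 < h -> h <= p -> p + h <= T -> nrm (ut p) <= M' ->
  (forall t, p - h <= t <= p + h -> nrm (ut t - ut p) <= n) ->
  `|ip (ut p) (u (p + h) - u (p - h)) - 2 * h * ip (ut p) (ut p)| <= M' * (n * (2 * h)).
Proof.
move=> h0 hp hpT hM hn; have := symdiff_close h0 hp hpT hn.
rewrite -(ipZr sip) -(ipBr sip) => hd.
exact: le_trans (cauchy_schwarz sip _ _) (ler_pM (nrm_ge0 _ _) (nrm_ge0 _ _) hM hd).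
Qed.

(** By symmetry of [ip], the integrand of [pairing_increment] for the curve [u (t + h) - u (t - h)]
    is [shifted h t - shifted h (t - h)]. *)
Let shifted h t := ip (ut t) (ut (t + h)) - ip (du t) (du (t + h)).

Let contI_shifted h : 0 <= h -> contI 0 (T - h) (shifted h).
Proof.
move=> h0; have sub c : contH 0 T c -> contH 0 (T - h) c by apply: contH_sub; lra.
have shf c : contH 0 T c -> contH 0 (T - h) (fun t => c (t + h)).
  by move=> cc; apply: contH_shift; apply: contH_sub cc; lra.
exact: contIB (contH_ip sip (sub _ cut) (shf _ cut)) (contH_ip sip (sub _ cdu) (shf _ cdu)).
Qed.

Let intg_shifted h a b : 0 <= h -> 0 <= a -> b <= T - h -> intg (Icc a b) (shifted h).
Proof. by move=> h0 a0 bT; exact: intg_contI (contI_sub a0 bT (contI_shifted h0)). Qed.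

Let RI_shifted_close (h p n M' : R) : 0 < h -> h <= p -> p + h <= T -> n <= 1 ->
  nrm (ut p) <= M' -> nrm (du p) <= M' ->
  (forall t, p - h <= t <= p + h -> nrm (ut t - ut p) <= n) ->
  (forall t, p - h <= t <= p + h -> nrm (du t - du p) <= n) ->
  `|RI (Icc (p - h) p) (shifted h) - h * (ip (ut p) (ut p) - ip (du p) (du p))|
    <= (2 * (n * (2 * M' + 1))) * h.
Proof.
move=> h0 hp hpT n1 hM hM' hnu hnd.
have := RI_near_cst (a := p - h) (h := h) (c := ip (ut p) (ut p) - ip (du p) (du p))
  (e := 2 * (n * (2 * M' + 1))) (B := shifted h).
rewrite subrK; apply; [exact: ltW | by apply: intg_shifted; lra |].
move=> t tI; rewrite /shifted subrACA; apply: (le_trans (ler_normB _ _)).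
have i1 : p - h <= t <= p + h by lra.
have i2 : p - h <= t + h <= p + h by lra.
have a1 := ip_close sip hM (hnu t i1) (hnu (t + h) i2) n1.
have a2 := ip_close sip hM' (hnd t i1) (hnd (t + h) i2) n1.
by apply: (le_trans (lerD a1 a2)); rewrite le_eqVlt; apply/orP; left; apply/eqP; ring.
Qed.

Let contH_symdiff h a b c : 0 <= h -> h <= a -> b + h <= T -> contH 0 T c ->
  contH a b (fun t => c (t + h) - c (t - h)).
Proof. by move=> h0 ha bT cc; apply: (contHB sip); apply: contH_shift; apply: contH_sub cc; lra. Qed.

Let rderivH_symdiff h a b : 0 <= h -> h <= a -> b + h <= T ->
  rderivH a b (fun t => u (t + h) - u (t - h)) (fun t => ut (t + h) - ut (t - h)).
Proof.
by move=> h0 ha bT; apply: (rderivHB sip); apply: rderivH_shift; apply: rderivH_sub uut; lra.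
Qed.

Let nrm_symdiff (h t M : R) : 0 < h -> h <= t -> t + h <= T ->
  (forall t, 0 <= t <= T -> nrm (ut t) <= M) -> nrm (u (t + h) - u (t - h)) <= M * (2 * h).
Proof.
move=> h0 ht tT hM; have := @symdiff_close h t M 0; rewrite scaler0 subr0; apply => // s sI.
by rewrite subr0; apply: hM; lra.
Qed.

Let near_window (c : R -> H) (h k n p : R) : 0 <= p <= T -> h < k ->
  (forall y, 0 <= y <= T -> `|y - p| < k -> nrm (c y - c p) < n) ->
  h <= p -> p + h <= T -> forall y, p - h <= y <= p + h -> nrm (c y - c p) <= n.
Proof.
move=> pI hk hc hp hpT y yI; apply/ltW/hc; first by lra.
by apply: le_lt_trans hk; rewrite ler_norml; lra.
Qed.

(* Testing with the symmetric difference [u (t + h) - u (t - h)] makes the time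
   integral telescope; dividing by [2 h] and letting [h] tend to 0 gives the energy. *)
Lemma energy_step t1 t2 M : 0 < t1 -> t1 < t2 -> t2 < T ->
  (forall t, 0 <= t <= T -> nrm (ut t) <= M) ->
  energy t2 <= energy t1 + M * (Fp t2 - Fp t1).
Proof.
move=> t10 t12 t2T hM; apply/ler_addgt0Pr => e e0.
have [Md Md0 hMd] := contI_bounded (contH_nrm sip cdu).
have M0 : 0 <= M by apply: le_trans (hM 0 _); rewrite ?nrm_ge0 // lexx ltW.
pose M' := M + Md.
have hutM' t : 0 <= t <= T -> nrm (ut t) <= M'.
  by move=> /hM; rewrite /M'; lra.
have hduM' t : 0 <= t <= T -> nrm (du t) <= M'.
  by move=> /hMd /(le_trans (ler_norm _)); rewrite /M'; lra.
have M'0 : 0 < M' by rewrite /M'; lra.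
pose n := Num.min 1 (e / (6 * M' + 2)).
have den0 : 0 < 6 * M' + 2 by lra.
have n0 : 0 < n by rewrite lt_min ltr01 divr_gt0.
have n1 : n <= 1 by rewrite /n ge_min lexx.
have ne : n * (6 * M' + 2) <= e by rewrite -ler_pdivlMr // /n ge_min lexx orbT.
have t1I : 0 <= t1 <= T by lra.
have t2I : 0 <= t2 <= T by lra.
have [k1 k10 h1] := cut t1I n0; have [k2 k20 h2] := cut t2I n0.
have [k3 k30 h3] := cdu t1I n0; have [k4 k40 h4] := cdu t2I n0.
have mid (k : R) : 0 < k -> exists2 h : R, 0 < h & h < k.
  by move=> k0; exists (k / 2); lra.
have [|h h0] := mid (Num.min (Num.min (Num.min k1 k2) (Num.min k3 k4)) (Num.min t1 (T - t2))).
  by rewrite !lt_min k10 k20 k30 k40 t10 subr_gt0.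
rewrite !lt_min => /andP[/andP[/andP[hk1 hk2] /andP[hk3 hk4]] /andP[ht1 ht2]].
have ha1 := ltW ht1; have ha2 := le_trans ha1 (ltW t12).
have hb2 : t2 + h <= T by lra.
have hb1 : t1 + h <= T by lra.
have nu1 := near_window t1I hk1 h1 ha1 hb1; have nu2 := near_window t2I hk2 h2 ha2 hb2.
have nd1 := near_window t1I hk3 h3 ha1 hb1; have nd2 := near_window t2I hk4 h4 ha2 hb2.
have P1 := pair_close h0 ha1 hb1 (hutM' _ t1I) nu1.
have P2 := pair_close h0 ha2 hb2 (hutM' _ t2I) nu2.
have B1 := RI_shifted_close h0 ha1 hb1 n1 (hutM' _ t1I) (hduM' _ t1I) nu1 nd1.
have B2 := RI_shifted_close h0 ha2 hb2 n1 (hutM' _ t2I) (hduM' _ t2I) nu2 nd2.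
pose v t := u (t + h) - u (t - h).
pose dv t := du (t + h) - du (t - h).
pose v' t := ut (t + h) - ut (t - h).
pose B := shifted h.
have hK t : t1 <= t <= t2 -> nrm (v t) <= M * (2 * h).
  move=> /andP[tt1 tt2]; apply: nrm_symdiff => //; first exact: le_trans tt1.
  by apply: le_trans hb2; rewrite lerD2r.
have cdiff c : contH 0 T c -> contH t1 t2 (fun t => c (t + h) - c (t - h)).
  exact: (contH_symdiff (ltW h0) ha1 hb2).
have rdiff : rderivH t1 t2 v v' := rderivH_symdiff (ltW h0) ha1 hb2.
have := pairing_increment sip cut cdu cFp Fp_nd weq (ltW t10) (ltW t12) t2T _
  (cdiff _ cu) (cdiff _ cdu) (cdiff _ cut) rdiff hK.
have vV t : t1 <= t <= t2 -> inV (v t) (dv t).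
  move=> /andP[tt1 tt2]; have ht := le_trans ha1 tt1; have t0 := le_trans (ltW h0) ht.
  have tT : t + h <= T by apply: le_trans hb2; rewrite lerD2r.
  apply: inVB; apply: uV; first by rewrite tT addr_ge0 // ltW.
  by rewrite subr_ge0 ht lerBlDr (le_trans tt2) // (le_trans (ltW t2T)) // lerDl ltW.
move=> /(_ vV).
have -> : RI (Icc t1 t2) (fun t => ip (ut t) (v' t) - ip (du t) (dv t)) =
    RI (Icc (t2 - h) t2) B - RI (Icc (t1 - h) t1) B.
  rewrite (@RI_eq _ _ _ (fun t => B t - B (t - h))); last first.
    by move=> t _; rewrite /v' /dv /B /shifted !(ipBr sip) subrK !(ipC sip _ (_ (t - h))); ring.
  apply: RI_telescope; [exact: ltW|exact: ltW|apply: intg_shifted; first exact: ltW].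
    by rewrite subr_ge0.
  by rewrite lerBrDr.
rewrite -/(v t1) -/(v t2).
move: P1 P2 B1 B2; rewrite -/(v t1) -/(v t2) /energy !ler_norml.
move=> /andP[p1 p2] /andP[p3 p4] /andP[b1 b2] /andP[b3 b4] hN.
rewrite -(ler_pM2l (x := 2 * h)); last by rewrite mulr_gt0.
have hne : h * (n * (6 * M' + 2)) <= h * e by rewrite ler_wpM2l // ltW.
apply: (energy_step_arith p1 p2 p3 p4 b1 b2 b3 b4 _ hne); apply: (le_trans hN); rewrite le_eqVlt; apply/orP; left; apply/eqP; ring.
Qed.

(** [energy_step] needs room for the step [h] on both sides; continuity of the energy carries its
    bound to the closed interval. *)
Lemma energy_growth M : (forall t, 0 <= t <= T -> nrm (ut t) <= M) ->
  forall t, 0 <= t <= T -> energy t <= energy 0 + M * (Fp T - Fp 0).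
Proof.
move=> hM t tI; apply/ler_addgt0Pr => e e0.
have M0 : 0 <= M by apply: le_trans (hM 0 _); rewrite ?nrm_ge0 // lexx ltW.
have e2 : 0 < e / 2 by lra.
have I0 : 0 <= (0 : R) <= T by rewrite lexx ltW.
have [k1 k10 h1] := contI_energy I0 e2; have [k2 k20 h2] := contI_energy tI e2.
have F0 : 0 <= M * (Fp T - Fp 0) by rewrite mulr_ge0 // subr_ge0 Fp_nd // ltW.
have [tk|tk] := ltP t k1.
  have := h1 t tI; rewrite subr0 ger0_norm; last by case/andP: tI.
  by move=> /(_ tk); rewrite ltr_norml; lra.
(* The inner times [k / 2] and [t - k / 4] lie within the continuity radii at 0 and at [t], and
   [k1 <= t] keeps them in order. *)
pose k := Num.min (k1 / 2) (k2 / 2).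
have k0 : 0 < k by rewrite lt_min; lra.
have kk1 : k <= k1 / 2 by rewrite /k ge_min lexx.
have kk2 : k <= k2 / 2 by rewrite /k ge_min lexx orbT.
have := @energy_step (k / 2) (t - k / 4) M ltac:(lra) ltac:(lra) ltac:(lra) hM.
have : M * (Fp (t - k / 4) - Fp (k / 2)) <= M * (Fp T - Fp 0).
  by rewrite ler_wpM2l // lerB // Fp_nd //; lra.
have := h1 (k / 2) ltac:(lra); rewrite subr0 ger0_norm; last by lra.
move=> /(_ ltac:(lra)); rewrite ltr_norml => /andP[? ?].
have := h2 (t - k / 4) ltac:(lra); rewrite (_ : t - k / 4 - t = - (k / 4)); last by ring.
rewrite normrN ger0_norm; last by lra.
move=> /(_ ltac:(lra)); rewrite ltr_norml => /andP[? ?]; lra.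
Qed.

(** The growth bound involves the maximum [M] of the norm of [ut], which the energy itself controls.
    With [F] the increment of [Fp], growth at the maximum point gives [M^2 / 2 <= energy 0 + M F];
    as [M F <= M^2 / 4 + F^2], it follows that [M F <= energy 0 + 2 F^2]. *)
Lemma energy_bound t : 0 <= t <= T -> energy t <= 2 * (energy 0 + (Fp T - Fp 0) ^+ 2).
Proof.
move=> tI; have /contI_within cn := contH_nrm sip cut.
have [s] := EVT_max (ltW T0) cn; rewrite in_itv /= => sI hs.
pose M := nrm (ut s).
have hM r : 0 <= r <= T -> nrm (ut r) <= M by move=> rI; apply: hs; rewrite in_itv.
have hE := energy_growth hM.
have : M ^+ 2 / 2 <= energy s.
  by rewrite /M nrm2 // /energy; have := ip_ge0 sip (du s); lra.
have := hE s sI; have := hE t tI.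
have := sqr_ge0 (M / 2 - (Fp T - Fp 0)).
rewrite sqrrB; nra.
Qed.

End Energy.

(** * The space L2(0,1) *)

Section L2.
Context {R : realType}.
Local Notation mu := (@lebesgue_measure R).
Local Notation mset := (@measurable _ (measurableTypeR R)).
Implicit Types (v w : R -> R).

Lemma mI01 : mset (@I01 R). Proof. exact: measurable_itv. Qed.
Hint Resolve mI01 : core.

Lemma I01P (x : R) : I01 x <-> 0 < x < 1.
Proof. by rewrite /I01 /= in_itv. Qed.

Lemma sqr_intgP D v : mset D -> measurable_fun D v ->
  (\int[mu]_(x in D) ((v x) ^+ 2)%:E < +oo)%E <-> intg D (fun x => v x ^+ 2).
Proof.
move=> mD mv; have mv2 : measurable_fun D (fun x => v x ^+ 2) by exact: measurable_funX.
split=> [h|/integrableP[_]].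
  apply/integrableP; split; first exact/measurable_EFinP.
  by under eq_integral do rewrite /= ger0_norm ?sqr_ge0 //.
by under eq_integral do rewrite /= ger0_norm ?sqr_ge0 //.
Qed.

Lemma inL2P v : inL2 v <-> measurable_fun I01 v /\ intg I01 (fun x => v x ^+ 2).
Proof. by split=> -[mv]; move/(sqr_intgP mI01 mv) => h. Qed.

Lemma mul_intg D v w : mset D -> measurable_fun D v -> measurable_fun D w ->
  intg D (fun x => v x ^+ 2) -> intg D (fun x => w x ^+ 2) -> intg D (fun x => v x * w x).
Proof.
move=> mD mv mw iv iw; apply: (intg_le mD _ _ (intgD mD iv iw)).
  exact: measurable_funM.
move=> x _; have := sqr_ge0 (v x - w x); have := sqr_ge0 (v x + w x).
rewrite sqrrD sqrrB ler_norml => ? ?; apply/andP; split; nra.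
Qed.

Lemma inL2_mul v w : inL2 v -> inL2 w -> intg I01 (fun x => v x * w x).
Proof. by move=> /inL2P[mv iv] /inL2P[mw iw]; exact: mul_intg. Qed.

Lemma inL2D v w : inL2 v -> inL2 w -> inL2 (fun x => v x + w x).
Proof.
move=> hv hw; have [mv iv] := (inL2P v).1 hv; have [mw iw] := (inL2P w).1 hw.
apply/inL2P; split; first exact: measurable_funD.
apply: (intg_eq (f := fun x => (v x ^+ 2 + w x ^+ 2) + 2 * (v x * w x))) => //.
  by move=> x _; ring.
apply: intgD => //; first exact: intgD.
by apply: intgZ => //; exact: inL2_mul.
Qed.

Lemma inL2Z r v : inL2 v -> inL2 (fun x => r * v x).
Proof.
move=> /inL2P[mv iv]; apply/inL2P; split; first exact: measurable_funM.
apply: (intg_eq (f := fun x => r ^+ 2 * v x ^+ 2)) => //; last exact: intgZ.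
by move=> x _; rewrite exprMn.
Qed.

Lemma inL20 : inL2 (fun=> 0 : R).
Proof.
apply/inL2P; split; first exact: measurable_cst.
apply: (intg_sub (D := Icc 0 1)) => //; first exact: measurable_Icc.
  by move=> x /I01P /andP[/ltW x0 /ltW x1]; apply/IccP; rewrite x0.
by rewrite expr0n /=; exact: intg_cst.
Qed.

Lemma inL2B v w : inL2 v -> inL2 w -> inL2 (fun x => v x - w x).
Proof.
move=> hv /(inL2Z (-1)) hw; have := inL2D hv hw.
by congr inL2; apply/funext => x; rewrite mulN1r.
Qed.

Definition inL2b : {pred R -> R} := fun v => `[< inL2 v >].

Lemma inL2bP v : reflect (inL2 v) (v \in inL2b).
Proof. exact: asboolP. Qed.

Lemma inL2_submod : submod_closed inL2b.
Proof.
split; first by apply/inL2bP; exact: inL20.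
by move=> r v w /inL2bP hv /inL2bP hw; apply/inL2bP; exact: inL2D (inL2Z r hv) hw.
Qed.

HB.instance Definition _ := GRing.isSubmodClosed.Build R (R -> R) inL2b inL2_submod.

(** No quotient by almost everywhere equality is taken, so pointwise values remain available; the
    module structure comes from [inL2_submod]. *)
Record L2T : Type := MkL2T { L2v :> R -> R; _ : L2v \in inL2b }.
HB.instance Definition _ := [isSub for L2v].
HB.instance Definition _ := [Choice of L2T by <:].
HB.instance Definition _ := [SubChoice_isSubLmodule of L2T by <:].

Lemma L2T_inL2 (v : L2T) : inL2 v. Proof. by case: v => v /= /inL2bP. Qed.

(** The default [0] makes the map total, so that a curve such as [fun t => mkL2 (ut t)] can be
    written although membership is known only for [t] in [[0, T]]. *)
Definition mkL2 (v : R -> R) : L2T := insubd (0 : L2T) v.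

Lemma mkL2K v : inL2 v -> mkL2 v = v :> (R -> R).
Proof. by move=> /inL2bP hv; exact: (insubdK (0 : L2T) hv). Qed.

Definition ip2 (v w : L2T) : R := RI I01 (fun x => v x * w x).

Lemma semi_inner_ip2 : semi_inner ip2.
Proof.
split.
- by move=> v w; apply: RI_eq => x _; exact: mulrC.
- move=> u v w; rewrite /ip2 -RID //; try (by apply: inL2_mul; exact: L2T_inL2).
  by apply: RI_eq => x _; exact: mulrDl.
- move=> r v w; rewrite /ip2 -RIZ //; try (by apply: inL2_mul; exact: L2T_inL2).
  by apply: RI_eq => x _; rewrite mulrA.
- by move=> v; apply: RI_ge0 => x _; rewrite -expr2 sqr_ge0.
Qed.

Lemma ip2E v w : inL2 v -> inL2 w -> ip2 (mkL2 v) (mkL2 w) = RI I01 (fun x => v x * w x).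
Proof. by move=> hv hw; rewrite /ip2 !mkL2K. Qed.

Lemma mkL2D v w : inL2 v -> inL2 w -> mkL2 (fun x => v x + w x) = mkL2 v + mkL2 w.
Proof.
move=> hv hw; apply: val_inj; apply/funext => x /=.
by rewrite -[LHS]/(mkL2 _ x) mkL2K; [rewrite -{1}(mkL2K hv) -{1}(mkL2K hw) | exact: inL2D].
Qed.

Lemma mkL2Z r v : inL2 v -> mkL2 (fun x => r * v x) = r *: mkL2 v.
Proof.
move=> hv; apply: val_inj; apply/funext => x /=.
by rewrite -[LHS]/(mkL2 _ x) mkL2K; [rewrite -{1}(mkL2K hv) | exact: inL2Z].
Qed.

Lemma mkL2B v w : inL2 v -> inL2 w -> mkL2 (fun x => v x - w x) = mkL2 v - mkL2 w.
Proof.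
move=> hv hw; rewrite -scaleN1r -mkL2Z // -mkL2D //; last exact: inL2Z.
by congr mkL2; apply/funext => x; rewrite mulN1r.
Qed.

End L2.

(** * Measurability in time and comparison almost everywhere *)

Section Source.
Context {R : realType}.
Local Notation mu := (@lebesgue_measure R).
Local Notation mset := (@measurable _ (measurableTypeR R)).
Implicit Types (v w : R -> R) (T t : R).
Hint Resolve mI01 measurable_Icc : core.

Let mD T : measurable ((Icc 0 T `*` I01) : set (measurableTypeR R * measurableTypeR R)).
Proof. by apply: measurableX; [exact: measurable_Icc | exact: mI01]. Qed.

(** Tonelli applies to the positive and to the negative part of the extension of [g] by zero, whose
    integrals have the inner integral as difference. *)
Lemma measurable_inner T (g : R -> R -> R) :
  measurable_fun (Icc 0 T `*` I01) (fun p : R * R => g p.1 p.2) ->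
  measurable_fun (Icc 0 T) (fun t => \int[mu]_(x in I01) (g t x)%:E)%E.
Proof.
move=> mg.
pose h : measurableTypeR R * measurableTypeR R -> R :=
  (fun p => g p.1 p.2) \_ (Icc 0 T `*` I01).
have mh : measurable_fun setT (EFin \o h).
  apply/measurable_EFinP.
  by have [+ _] := @measurable_restrictT _ _ _ _ _ (fun p : R * R => g p.1 p.2) (mD T); exact.
have mF : measurable_fun setT (fun t : measurableTypeR R => \int[mu]_x (h (t, x))%:E)%E.
  have mp := @measurable_fun_fubini_tonelli_F _ _ (measurableTypeR R) (measurableTypeR R) R
    mu _ (measurable_funepos mh) (fun x => funepos_ge0 _ x).
  have mn := @measurable_fun_fubini_tonelli_F _ _ (measurableTypeR R) (measurableTypeR R) R
    mu _ (measurable_funeneg mh) (fun x => funeneg_ge0 _ x).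
  have := emeasurable_funB mp mn; apply: eq_measurable_fun => t _.
  rewrite [RHS]integralE /fubini_F /=; congr (_ - _)%E;
    by apply: eq_integral => x _; rewrite ?funeposE ?funenegE.
have := @measurable_funTS _ _ _ _ (Icc 0 T) _ mF.
apply: eq_measurable_fun => t /set_mem tI; rewrite [RHS]integral_mkcond.
apply: eq_integral => x _; rewrite /h !patchE.
case: (boolP (x \in I01)) => xI.
  by rewrite mem_set //=; split => //; exact: set_mem.
by rewrite memNset // => -[_ /= /mem_set]; rewrite (negbTE xI).
Qed.

Lemma measurable_section T (g : R -> R -> R) t : Icc 0 T t ->
  measurable_fun (Icc 0 T `*` I01) (fun p : R * R => g p.1 p.2) ->
  measurable_fun I01 (g t).
Proof.
move=> tI mg; pose phi : measurableTypeR R -> measurableTypeR R * measurableTypeR R := pair t.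
apply: (@measurable_comp _ _ _ _ _ _ (Icc 0 T `*` I01) (fun p : R * R => g p.1 p.2) I01 phi).
- exact: mD.
- by move=> p [x xI <-]; split.
- exact: mg.
by apply: measurable_funTS; exact: (@pair1_measurable _ _ (measurableTypeR R) (measurableTypeR R)).
Qed.

(** Replacing [g] by the maximum of [f] and [g], which agrees with [g] almost everywhere, turns the
    comparison into one that holds everywhere. *)
Lemma RI_ae_le D (f g : R -> R) : mset D -> intg D f -> intg D g ->
  {ae mu, forall x, D x -> f x <= g x} -> RI D f <= RI D g.
Proof.
move=> mD' hf hg fg; pose h x := Num.max (f x) (g x).
have mh : measurable_fun D h by apply: measurable_maxr; exact: intg_measurable.
have hh : intg D h.
  apply: (intg_le mD' mh _ (intgD mD' (intg_abs mD' hf) (intg_abs mD' hg))) => x _.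
  by rewrite /h /Order.max; case: ifP => _; rewrite ?lerDl ?lerDr.
have -> : RI D g = RI D h.
  apply: (congr1 fine); apply: ae_eq_integral => //.
  - by apply/measurable_EFinP; exact: intg_measurable.
  - exact/measurable_EFinP.
  - by apply: filterS fg => x fg Dx; rewrite /h max_r // fg.
by apply: RI_le => // x _; rewrite /h le_max lexx.
Qed.

Lemma RI_ae_eq D (f g : R -> R) : mset D -> measurable_fun D f -> measurable_fun D g ->
  {ae mu, forall x, D x -> f x = g x} -> RI D f = RI D g.
Proof.
move=> mD' mf mg fg; apply: (congr1 fine); apply: ae_eq_integral => //.
- exact/measurable_EFinP.
- exact/measurable_EFinP.
- by apply: filterS fg => x fg Dx; rewrite fg.
Qed.

Lemma RI_eq_oo (a b : R) f g : intg (Icc a b) f -> intg (Icc a b) g ->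
  (forall x, a < x < b -> f x = g x) -> RI (Icc a b) f = RI (Icc a b) g.
Proof.
move=> hf hg fg.
have sub h : intg (Icc a b) h -> RI (Icc a b) h = RI `]a, b[ h.
  move=> ih; rewrite /RI.
  have i1 : mu.-integrable `[a, b[ (EFin \o h).
    by apply: intg_sub ih => // x; rewrite /Icc /= !in_itv /= => /andP[-> /ltW ->].
  have i2 : mu.-integrable `]a, b[ (EFin \o h).
    by apply: intg_sub ih => // x; rewrite /Icc /= !in_itv /= => /andP[/ltW -> /ltW ->].
  by rewrite -(Rintegral_itv_bndo_bndc i1) (Rintegral_itv_obnd_cbnd i2).
rewrite !sub //; apply: RI_eq => x; rewrite /= in_itv /=; exact: fg.
Qed.

End Source.

(** * The weighted energy space *)

Section H1.
Context {R : realType}.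
Local Notation mu := (@lebesgue_measure R).
Local Notation mset := (@measurable _ (measurableTypeR R)).
Implicit Types (v w g h : R -> R) (alpha r x : R).
Hint Resolve mI01 measurable_Icc : core.

(** The weight is split evenly over the two factors: the form [int x^alpha g h] becomes an L^2
    product of [wgt alpha g] and [wgt alpha h], which is the shape the abstract part expects. *)
Definition wgt alpha g : R -> R := fun x => x `^ (alpha / 2) * g x.

Lemma powR_half_sqr alpha x : (x `^ (alpha / 2)) ^+ 2 = x `^ alpha.
Proof.
rewrite -powR_mulrn ?powR_ge0 // -powRrM.
by rewrite (_ : alpha / 2 * 2%:R = alpha) //; field.
Qed.

Lemma wgt_sqr alpha g x : wgt alpha g x ^+ 2 = x `^ alpha * g x ^+ 2.
Proof. by rewrite /wgt exprMn powR_half_sqr. Qed.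

Lemma wgt_mul alpha g h x : wgt alpha g x * wgt alpha h x = x `^ alpha * g x * h x.
Proof. by rewrite /wgt mulrACA -expr2 powR_half_sqr mulrA. Qed.

Lemma measurable_wgt alpha g : measurable_fun I01 g -> measurable_fun I01 (wgt alpha g).
Proof.
by move=> mg; apply: measurable_funM => //; apply: measurable_funTS; exact: measurable_powR.
Qed.

Lemma wintE alpha g : wint alpha g = (\int[mu]_(x in I01) ((wgt alpha g x) ^+ 2)%:E)%E.
Proof. by apply: eq_integral => x _; rewrite wgt_sqr. Qed.

Lemma wint_inL2 alpha g : measurable_fun I01 g ->
  (wint alpha g < +oo)%E <-> inL2 (wgt alpha g).
Proof.
move=> mg; rewrite wintE; split=> [h|[]//].
by split=> //; exact: measurable_wgt.
Qed.

Lemma wgtD alpha g h : wgt alpha (fun x => g x + h x) = fun x => wgt alpha g x + wgt alpha h x.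
Proof. by apply/funext => x; rewrite /wgt mulrDr. Qed.

Lemma wgtZ alpha r g : wgt alpha (fun x => r * g x) = fun x => r * wgt alpha g x.
Proof. by apply/funext => x; rewrite /wgt mulrCA. Qed.

Lemma H1repD alpha v g w h : H1rep alpha v g -> H1rep alpha w h ->
  H1rep alpha (fun x => v x + w x) (fun x => g x + h x).
Proof.
move=> [mg [/(wint_inL2 alpha mg) ig [v1 [vx v0]]]] [mh [/(wint_inL2 alpha mh) ih [w1 [wx w0]]]].
have mgh : measurable_fun I01 (fun x => g x + h x) by exact: measurable_funD.
split; [by []|split; [|split; [|split]]].
- by apply/wint_inL2 => //; rewrite wgtD; exact: inL2D.
- by rewrite v1 w1 addr0.
- move=> x xI; have [i1 e1] := vx x xI; have [i2 e2] := wx x xI.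
  split; first exact: (intgD _ i1 i2).
  by rewrite (RID _ i1 i2) // e1 e2 v1 w1; ring.
- move=> a1; have [i1 [e1 z1]] := v0 a1; have [i2 [e2 z2]] := w0 a1.
  split; first exact: (intgD _ i1 i2).
  by rewrite (RID _ i1 i2) // z1 z2 v1 w1; move: e1 e2; rewrite z1 z2 v1 w1; lra.
Qed.

Lemma H1repZ alpha r v g : H1rep alpha v g ->
  H1rep alpha (fun x => r * v x) (fun x => r * g x).
Proof.
move=> [mg [/(wint_inL2 alpha mg) ig [v1 [vx v0]]]].
have mgh : measurable_fun I01 (fun x => r * g x) by exact: measurable_funM.
split; [by []|split; [|split; [|split]]].
- by apply/wint_inL2 => //; rewrite wgtZ; exact: inL2Z.
- by rewrite v1 mulr0.
- move=> x xI; have [i1 e1] := vx x xI.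
  split; first exact: (intgZ _ _ i1).
  by rewrite (RIZ _ _ i1) // e1 v1; ring.
- move=> a1; have [i1 [e1 z1]] := v0 a1.
  split; first exact: (intgZ _ _ i1).
  by rewrite (RIZ _ _ i1) // z1 v1; move: e1; rewrite z1 v1 !mulr0 sub0r => /esym/eqP;
    rewrite oppr_eq0 => /eqP ->; rewrite mulr0 subr0.
Qed.

Lemma H1aD alpha v g w h : H1a alpha v g -> H1a alpha w h ->
  H1a alpha (fun x => v x + w x) (fun x => g x + h x).
Proof.
move=> [iv [v' [vv' rv]]] [iw [w' [ww' rw]]]; split; first exact: inL2D.
exists (fun x => v' x + w' x); split; last exact: H1repD.
apply: (@filterS2 _ _ (ae_filter_ringOfSetsType mu)) vv' ww' => x h1 h2 xI.
by rewrite h1 // h2.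
Qed.

Lemma H1aZ alpha r v g : H1a alpha v g -> H1a alpha (fun x => r * v x) (fun x => r * g x).
Proof.
move=> [iv [v' [vv' rv]]]; split; first exact: inL2Z.
exists (fun x => r * v' x); split; last exact: H1repZ.
by apply: (@filterS _ _ (ae_filter_ringOfSetsType mu)) vv' => x h1 xI; rewrite h1.
Qed.

Lemma H1aB alpha v g w h : H1a alpha v g -> H1a alpha w h ->
  H1a alpha (fun x => v x - w x) (fun x => g x - h x).
Proof.
move=> hv /(H1aZ (-1)) hw; have := H1aD hv hw.
by congr H1a; apply/funext => x; rewrite mulN1r.
Qed.

Lemma H1a_inL2 alpha v g : H1a alpha v g -> inL2 v. Proof. by case. Qed.

Lemma H1a_measurable alpha v g : H1a alpha v g -> measurable_fun I01 g.
Proof. by move=> [_ [w [_ []]]]. Qed.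

Lemma H1a_wgt alpha v g : H1a alpha v g -> inL2 (wgt alpha g).
Proof. by move=> [_ [w [_ [mg [ig _]]]]]; exact/(wint_inL2 alpha mg). Qed.

Definition sqL2 v := RI I01 (fun x => v x ^+ 2).

Lemma sqL2_ge0 v : 0 <= sqL2 v.
Proof. by apply: RI_ge0 => x _; exact: sqr_ge0. Qed.

Lemma sqL2E v : inL2 v -> (\int[mu]_(x in I01) ((v x) ^+ 2)%:E = (sqL2 v)%:E)%E.
Proof.
move=> /inL2P[_ iv]; rewrite /sqL2 /RI /Rintegral fineK //.
exact: integrable_fin_num.
Qed.

Lemma H1norm2E alpha v g : H1a alpha v g ->
  H1norm2 alpha v g = (sqL2 v + sqL2 (wgt alpha g))%:E.
Proof.
by move=> h; rewrite /H1norm2 wintE (sqL2E (H1a_inL2 h)) (sqL2E (H1a_wgt h)).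
Qed.

Lemma sqL2Z r v : inL2 v -> sqL2 (fun x => r * v x) = r ^+ 2 * sqL2 v.
Proof.
move=> /inL2P[_ iv]; rewrite /sqL2 -RIZ //.
by apply: RI_eq => x _; rewrite exprMn.
Qed.

End H1.

(** * Cutoffs in time *)

Section Theta.
Context {R : realType}.
Local Notation mu := (@lebesgue_measure R).
Local Notation mset := (@measurable _ (measurableTypeR R)).
Implicit Types (v w g h : R -> R) (alpha r x : R).
Hint Resolve mI01 measurable_Icc : core.
Variables (T a d : R).
Hypotheses (a0 : 0 <= a) (d0 : 0 < d) (adT : a + d <= T).

(** The almost everywhere derivative of [theta]. Testing with [theta t * v x] produces the mean of
    [(u_t, v)] over [[a, a + d]], and [a + d <= T] gives the vanishing at [T] that test functions
    must have. *)
Definition dtheta : R -> R := fun t => - d^-1 * \1_(`]a, a + d[%classic : set R) t.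
Definition theta : R -> R := fun t =>
  if t <= a then 1 else if t <= a + d then (a + d - t) / d else 0.

Lemma measurable_dtheta D : measurable_fun D dtheta.
Proof.
by apply: measurable_funM => //; exact: measurable_indic.
Qed.

Lemma dtheta_bound t : `|dtheta t| <= d^-1.
Proof.
have d1 : 0 <= d^-1 by rewrite invr_ge0 ltW.
rewrite /dtheta normrM normrN (ger0_norm d1) -[X in _ <= X]mulr1.
by rewrite ler_wpM2l // indicE; case: (_ \in _); rewrite ?normr1 ?normr0.
Qed.

Lemma dtheta_in t : a < t < a + d -> dtheta t = - d^-1.
Proof. by move=> ht; rewrite /dtheta indicE mem_set ?mulr1 //= in_itv. Qed.

Lemma dtheta_out t : ~~ (a < t < a + d) -> dtheta t = 0.
Proof.
by move=> ht; rewrite /dtheta indicE memNset ?mulr0 //= in_itv /=; exact/negP.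
Qed.

Lemma intg_dtheta_mul b c m : intg (Icc b c) m -> intg (Icc b c) (fun t => dtheta t * m t).
Proof.
move=> im; apply: (intg_le _ _ (g := fun t => d^-1 * `|m t|)) => //.
- by apply: measurable_funM; [exact: measurable_dtheta | exact: intg_measurable].
- by move=> x _; rewrite normrM ler_wpM2r // dtheta_bound.
- by apply: intgZ => //; exact: intg_abs.
Qed.

Lemma RI_dtheta_in b c m : a <= b -> c <= a + d -> intg (Icc b c) m ->
  RI (Icc b c) (fun t => dtheta t * m t) = - d^-1 * RI (Icc b c) m.
Proof.
move: (d0) (a0) (adT) => d0' a0' adT'.
move=> ab cd im; rewrite -RIZ //; apply: RI_eq_oo.
- exact: intg_dtheta_mul.
- exact: intgZ.
- by move=> x /andP[bx xc]; rewrite dtheta_in //; apply/andP; split; lra.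
Qed.

Lemma RI_dtheta_out b c m : c <= a \/ a + d <= b -> intg (Icc b c) m ->
  RI (Icc b c) (fun t => dtheta t * m t) = 0.
Proof.
move: (d0) (a0) (adT) => d0' a0' adT'.
move=> H im; have -> : 0 = RI (Icc b c) (fun t => 0 * m t) by rewrite RIZ // mul0r.
apply: RI_eq_oo; [exact: intg_dtheta_mul|exact: intgZ|].
move=> x /andP[bx xc]; rewrite dtheta_out //; apply/negP => /andP[ax xad].
by case: H; lra.
Qed.

Lemma RI_dtheta m : intg (Icc 0 T) m ->
  RI (Icc 0 T) (fun t => dtheta t * m t) = - d^-1 * RI (Icc a (a + d)) m.
Proof.
move: (d0) (a0) (adT) => d0' a0' adT'.
move=> im; have sub b c : 0 <= b -> c <= T -> intg (Icc b c) m.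
  by move=> b0 cT; apply: intg_sub im => //; exact: Icc_sub.
have aad : a <= a + d by lra.
have aT : a <= T by lra.
have ad0 : 0 <= a + d by lra.
rewrite (RI_chasles a0 aT (intg_dtheta_mul im)).
rewrite (RI_chasles aad adT (intg_dtheta_mul (sub _ _ a0 (lexx T)))).
rewrite (RI_dtheta_out (or_introl (lexx a)) (sub _ _ (lexx 0) aT)).
rewrite (RI_dtheta_in (lexx a) (lexx _) (sub _ _ a0 adT)).
rewrite (RI_dtheta_out (or_intror (lexx _)) (sub _ _ ad0 (lexx T))); ring.
Qed.

Lemma thetaE t : 0 <= t <= T -> theta t = - RI (Icc t T) dtheta.
Proof.
move: (d0) (a0) (adT) => d0' a0' adT'.
move=> /andP[t0 tT]; have i1 b c : intg (Icc b c) (fun=> 1 : R) by exact: intg_cst.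
have -> : dtheta = fun t => dtheta t * 1 by apply/funext => x; rewrite mulr1.
have im b c := intg_dtheta_mul (i1 b c).
have aad : a <= a + d by lra.
have aT : a <= T by lra.
have dn0 : d != 0 by rewrite gt_eqF.
rewrite /theta; case: leP => ta.
  rewrite (RI_chasles ta aT (im _ _)) (RI_chasles aad adT (im _ _)).
  rewrite (RI_dtheta_out (or_introl (lexx a)) (i1 _ _)).
  rewrite (RI_dtheta_in (lexx a) (lexx _) (i1 _ _)) RI_cst //.
  by rewrite (RI_dtheta_out (or_intror (lexx _)) (i1 _ _)); field.
case: leP => tad.
  rewrite (RI_chasles tad adT (im _ _)).
  rewrite (RI_dtheta_in (ltW ta) (lexx _) (i1 _ _)) RI_cst //.
  by rewrite (RI_dtheta_out (or_intror (lexx _)) (i1 _ _)); field.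
by rewrite (RI_dtheta_out (or_intror (ltW tad)) (i1 _ _)) oppr0.
Qed.

Lemma theta_bound t : 0 <= theta t <= 1.
Proof.
move: (d0) (a0) (adT) => d0' a0' adT'.
rewrite /theta; case: (leP t a) => ta; first by rewrite ler01 lexx.
case: (leP t (a + d)) => tad; last by rewrite lexx ler01.
rewrite divr_ge0 ?(ltW d0) ?subr_ge0 //= ler_pdivrMr // mul1r; lra.
Qed.

Lemma contI_theta : contI 0 T theta.
Proof.
have iT : intg (Icc 0 T) dtheta.
  have := @intg_dtheta_mul 0 T (fun=> 1) (intg_cst _ _ _).
  by apply: intg_eq => // x _; rewrite mulr1.
apply: (contI_eq (F := fun t => RI (Icc 0 t) dtheta - RI (Icc 0 T) dtheta)).
  move=> t /andP[t0 tT]; rewrite thetaE ?t0 // (RI_chasles t0 tT iT); ring.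
by apply: contIB; [exact: contI_RI | exact: contI_cst].
Qed.

Lemma measurable_theta : measurable_fun (Icc 0 T) theta.
Proof. exact: intg_measurable (intg_contI contI_theta). Qed.

Lemma measurable_tensor (c v : R -> R) : measurable_fun (Icc 0 T) c -> measurable_fun I01 v ->
  measurable_fun (Icc 0 T `*` I01) (fun p : R * R => c p.1 * v p.2).
Proof.
move=> mc mv; pose MR := measurableTypeR R.
have mD : measurable ((Icc 0 T `*` I01) : set (MR * MR)).
  by apply: measurableX; [exact: measurable_Icc | exact: mI01].
have m1 : measurable_fun ((Icc 0 T `*` I01) : set (MR * MR)) (fun p => c p.1).
  apply: (@measurable_comp _ _ _ (MR * MR)%type MR R (Icc 0 T) c _ fst) => //.
    by move=> y [p [h _] <-].
  by apply: measurable_funTS; exact: (@measurable_fst _ _ MR MR).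
have m2 : measurable_fun ((Icc 0 T `*` I01) : set (MR * MR)) (fun p => v p.2).
  apply: (@measurable_comp _ _ _ (MR * MR)%type MR R I01 v _ snd) => //.
    by move=> y [p [_ h] <-].
  by apply: measurable_funTS; exact: (@measurable_snd _ _ MR MR).
exact: (measurable_funM m1 m2).
Qed.

Lemma cst_bound_lty (F : R -> \bar R) (c : R) :
  (forall t, 0 <= t <= T -> (0 <= F t <= c%:E)%E) -> measurable_fun (Icc 0 T) F ->
  (\int[mu]_(t in Icc 0 T) F t < +oo)%E.
Proof.
move=> hF mF; apply: (@le_lt_trans _ _ (\int[mu]_(t in Icc 0 T) c%:E)%E).
  apply: ge0_le_integral => //; try (by move=> t /IccP /hF /andP[]).
exact: (integrable_lty (measurable_Icc 0 T) (intg_cst 0 T c)).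
Qed.

Lemma testfun_theta alpha v g : H1a alpha v g ->
  testfun T alpha (fun t x => theta t * v x) (fun t x => theta t * g x)
    (fun t x => dtheta t * v x).
Proof.
move: (d0) (a0) (adT) => d0' a0' adT'.
move=> hv; have iv := H1a_inL2 hv; have [mv _] := iv.
have T0 : 0 <= T by lra.
have mth := measurable_theta.
have mdth : measurable_fun (Icc 0 T) dtheta by exact: measurable_dtheta.
have sq1 t : theta t ^+ 2 <= 1 by have := theta_bound t; rewrite expr2; nra.
have sq2 t : dtheta t ^+ 2 <= d^-1 ^+ 2.
  rewrite -(real_normK (num_real (dtheta t))) ler_pXn2r ?nnegrE ?invr_ge0 ?(ltW d0) //.
  exact: dtheta_bound.
have sqv0 w : 0 <= sqL2 w by apply: RI_ge0 => x _; rewrite sqr_ge0.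
split; [exact: measurable_tensor | split; [|split; [|split; [|split; [|split]]]]].
- apply: (@cst_bound_lty _ (d^-1 ^+ 2 * sqL2 v)).
    move=> t _; rewrite sqL2E; last exact: inL2Z.
    rewrite sqL2Z // !lee_fin mulr_ge0 ?sqr_ge0 //=.
    by rewrite ler_wpM2r.
  apply: (@eq_measurable_fun _ _ _ _ _ (fun t => (dtheta t ^+ 2 * sqL2 v)%:E)).
    by move=> t _; rewrite sqL2E ?sqL2Z //; exact: inL2Z.
  by apply/measurable_EFinP; apply: measurable_funM => //; exact: measurable_funX.
- apply: aeW => x _ t tI.
  have it : intg (Icc t T) (fun s => dtheta s * v x) by apply: intg_dtheta_mul; exact: intg_cst.
  split; first exact: it.
  have it1 : intg (Icc t T) dtheta.
    have := @intg_dtheta_mul t T (fun=> 1) (intg_cst _ _ _).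
    by apply: intg_eq => // y _; rewrite mulr1.
  rewrite thetaE // mulNr mulrC -RIZ //; congr (- _).
  by apply: RI_eq => y _; rewrite mulrC.
- exact: measurable_tensor.
- by apply: measurable_tensor => //; exact: H1a_measurable hv.
- by apply: aeW => t _; exact: H1aZ.
- apply: (@cst_bound_lty _ (sqL2 v + sqL2 (wgt alpha g))).
    move=> t _; rewrite (H1norm2E (H1aZ (theta t) hv)) wgtZ !sqL2Z //; last exact: H1a_wgt hv.
    rewrite -mulrDr !lee_fin mulr_ge0 ?sqr_ge0 ?addr_ge0 //=.
    by rewrite -[leRHS]mul1r ler_wpM2r ?addr_ge0.
  apply: (@eq_measurable_fun _ _ _ _ _
      (fun t => (theta t ^+ 2 * (sqL2 v + sqL2 (wgt alpha g)))%:E)).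
    move=> t _; rewrite (H1norm2E (H1aZ (theta t) hv)) wgtZ !sqL2Z //; last exact: H1a_wgt hv.
    by rewrite mulrDr.
  by apply/measurable_EFinP; apply: measurable_funM => //; exact: measurable_funX.
Qed.

End Theta.

(** * From the weak formulation to time increments *)

Section WeakIncrement.
Context {R : realType}.
Local Notation mu := (@lebesgue_measure R).
Local Notation mset := (@measurable _ (measurableTypeR R)).
Hint Resolve mI01 measurable_Icc : core.
Implicit Types (s t a b c d e k : R) (h th : R -> R).
Variables (T : R) (f : R -> R -> R).
Hypotheses (T0 : 0 < T) (hf : inL1L2 T f).

Definition nf : R -> R := fun t => Num.sqrt (fine (\int[mu]_(x in I01) ((f t x) ^+ 2)%:E)%E).
(** At [T] this is by definition the real value of [L1L2norm T f]. *)
Definition Fp : R -> R := fun t => RI (Icc 0 t) nf.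

Lemma nf_ge0 t : 0 <= nf t. Proof. exact: sqrtr_ge0. Qed.

Lemma measurable_nf : measurable_fun (Icc 0 T) nf.
Proof.
have [mf _] := hf.
have mf2 : measurable_fun (Icc 0 T `*` I01) (fun p : R * R => f p.1 p.2 ^+ 2).
  exact: measurable_funX.
have := @measurable_inner R T (fun t x => f t x ^+ 2) mf2 => mi.
have ms : measurable_fun [set: R] (@Num.sqrt R).
  by apply: continuous_measurable_fun; exact: sqrt_continuous.
apply: (measurableT_comp ms).
by apply: (@measurable_comp _ _ _ _ _ _ setT) => //; exact: fine_measurable.
Qed.

Lemma intg_nf : intg (Icc 0 T) nf.
Proof.
have [_ [_ hT]] := hf; apply/integrableP; split; first by apply/measurable_EFinP; exact: measurable_nf.
apply: le_lt_trans hT; rewrite le_eqVlt; apply/orP; left; apply/eqP.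
by apply: eq_integral => t _ /=; rewrite ger0_norm ?nf_ge0.
Qed.

Lemma contI_Fp : contI 0 T Fp. Proof. exact: contI_RI intg_nf. Qed.

Lemma Fp_diff s t : 0 <= s -> s <= t -> t <= T -> Fp t - Fp s = RI (Icc s t) nf.
Proof. by move=> s0 st tT; have [_] := prim_RI intg_nf; exact. Qed.

Lemma Fp_nd s t : 0 <= s -> s <= t -> t <= T -> Fp s <= Fp t.
Proof.
move=> s0 st tT; rewrite -subr_ge0 Fp_diff //.
by apply: RI_ge0 => x _; exact: nf_ge0.
Qed.

Lemma RI_nf_supp h b c : 0 <= b -> b <= c -> c <= T -> measurable_fun (Icc 0 T) h ->
  (forall t, 0 <= t <= T -> 0 <= h t <= 1) ->
  (forall t, 0 <= t <= T -> ~~ (b <= t <= c) -> h t = 0) ->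
  intg (Icc 0 T) (fun t => h t * nf t) /\ RI (Icc 0 T) (fun t => h t * nf t) <= Fp c - Fp b.
Proof.
move=> b0 bc cT mh h1 h0; have inf := intg_nf.
have bT : b <= T := le_trans bc cT.
have c0 : 0 <= c := le_trans b0 bc.
have ih : intg (Icc 0 T) (fun t => h t * nf t).
  apply: (intg_le _ _ (g := nf)) => //.
    by apply: measurable_funM => //; exact: measurable_nf.
  move=> t /IccP /h1 /andP[ht0 ht1]; rewrite ger0_norm ?mulr_ge0 ?nf_ge0 //.
  by rewrite -[leRHS]mul1r ler_wpM2r ?nf_ge0.
split=> //.
have sub b' c' g : 0 <= b' -> c' <= T -> intg (Icc 0 T) g -> intg (Icc b' c') g.
  by move=> b0' cT' ig; apply: intg_sub ig => //; exact: Icc_sub.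
have zero b' c' : 0 <= b' -> c' <= T -> (forall t, b' < t < c' -> ~~ (b <= t <= c)) ->
    RI (Icc b' c') (fun t => h t * nf t) = 0.
  move=> b0' cT' hh.
  have -> : 0 = RI (Icc b' c') (fun t => 0 * nf t) by rewrite RIZ ?mul0r //; exact: sub.
  apply: RI_eq_oo; [exact: sub | by apply: intgZ => //; exact: sub |].
  move=> t tI; rewrite h0 ?hh //.
  by case/andP: tI => /ltW t1 /ltW t2; rewrite (le_trans b0' t1) (le_trans t2 cT').
rewrite (RI_chasles b0 bT ih) (zero 0 b) //; last first.
  by move=> t /andP[_ tb]; rewrite negb_and -ltNge tb.
rewrite (RI_chasles bc cT (sub _ _ _ b0 (lexx T) ih)) (zero c T) //; last first.
  by move=> t /andP[tb _]; rewrite negb_and -!ltNge tb orbT.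
rewrite addr0 add0r Fp_diff //.
apply: RI_le => //; [exact: sub | exact: sub |].
move=> t /IccP /andP[t1 t2]; have /h1 /andP[ht0 ht1] : 0 <= t <= T.
  by rewrite (le_trans b0 t1) (le_trans t2).
by rewrite -[leRHS]mul1r ler_wpM2r ?nf_ge0.
Qed.

Variable v : R -> R.
Hypothesis iv : inL2 v.
Let nv : R := nrm (@ip2 R) (mkL2 v).

Definition source th : R := RI (Icc 0 T) (fun t => RI I01 (fun x => f t x * (th t * v x))).

(** The slice [f t] lies in L^2 only for almost every [t], so the factorisation and the
    Cauchy-Schwarz bound hold almost everywhere; together they dominate the integrand by
    [nv * nf t]. *)
Lemma source_inner th : measurable_fun (Icc 0 T) th ->
  (forall t, 0 <= t <= T -> 0 <= th t <= 1) ->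
  intg (Icc 0 T) (fun t => RI I01 (fun x => f t x * (th t * v x))) /\
  {ae mu, forall t, Icc 0 T t -> RI I01 (fun x => f t x * (th t * v x)) =
     th t * RI I01 (fun x => f t x * v x) /\ `|RI I01 (fun x => f t x * v x)| <= nv * nf t}.
Proof.
move=> mth hth; have [mf [aef hT]] := hf.
have ae1 : {ae mu, forall t, Icc 0 T t -> RI I01 (fun x => f t x * (th t * v x)) =
     th t * RI I01 (fun x => f t x * v x) /\ `|RI I01 (fun x => f t x * v x)| <= nv * nf t}.
  apply: (@filterS _ _ (ae_filter_ringOfSetsType mu)) aef => t ft tI.
  have /IccP tI' := tI.
  have ift : inL2 (f t) by split; [exact: measurable_section mf | exact: ft].
  split.
    rewrite -RIZ //; last exact: inL2_mul.
    by apply: RI_eq => x _; ring.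
  rewrite -(ip2E ift iv) mulrC.
  have -> : nf t = nrm (@ip2 R) (mkL2 (f t)); last exact: cauchy_schwarz semi_inner_ip2 _ _.
  by rewrite /nrm ip2E // /nf.
split=> //.
have mF : measurable_fun (Icc 0 T) (fun t => RI I01 (fun x => f t x * (th t * v x))).
  apply: (@measurable_comp _ _ _ _ _ _ setT (@fine R)) => //.
  apply: measurable_inner.
  have [mv _] := iv.
  by apply: measurable_funM => //; exact: measurable_tensor.
apply/integrableP; split; first by apply/measurable_EFinP; exact: mF.
have inf : intg (Icc 0 T) (fun t => nv * nf t) by apply: intgZ => //; exact: intg_nf.
apply: (@le_lt_trans _ _ (\int[mu]_(t in Icc 0 T) (nv * nf t)%:E)%E); last first.
  exact: (integrable_lty (measurable_Icc 0 T) inf).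
have nv0 : 0 <= nv by exact: nrm_ge0.
apply: ae_ge0_le_integral => //.
- by do 2 apply: measurableT_comp => //.
- by move=> t _; rewrite lee_fin mulr_ge0 ?nf_ge0.
- by apply/measurable_EFinP; exact: intg_measurable.
apply: (@filterS _ _ (ae_filter_ringOfSetsType mu)) ae1 => t h tI.
have /IccP /hth /andP[th0 th1] := tI; have [h1 h2] := h tI.
rewrite /= lee_fin h1 normrM (ger0_norm th0) -[leRHS]mul1r; exact: ler_pM.
Qed.

Lemma source_diff th1 th2 : measurable_fun (Icc 0 T) th1 -> measurable_fun (Icc 0 T) th2 ->
  (forall t, 0 <= t <= T -> 0 <= th1 t <= 1) -> (forall t, 0 <= t <= T -> 0 <= th2 t <= 1) ->
  intg (Icc 0 T) (fun t => `|th1 t - th2 t| * nf t) ->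
  `|source th1 - source th2| <= nv * RI (Icc 0 T) (fun t => `|th1 t - th2 t| * nf t).
Proof.
move=> m1 m2 h1 h2 ih; have [i1 a1] := source_inner m1 h1; have [i2 a2] := source_inner m2 h2.
rewrite /source -RIB // -RIZ //.
have iB := intgB (measurable_Icc 0 T) i1 i2.
apply: (le_trans (RI_abs (measurable_Icc _ _) iB)).
apply: RI_ae_le => //; [exact: intg_abs|exact: intgZ|].
apply: (@filterS2 _ _ (ae_filter_ringOfSetsType mu)) a1 a2 => t a1 a2 tI.
have [-> b] := a1 tI; have [-> _] := a2 tI.
by rewrite -mulrBl normrM mulrCA ler_wpM2l.
Qed.

Variables (alpha : R) (g u1 : R -> R) (ux ut : R -> R -> R).
Hypothesis hv : H1a alpha v g.
Hypothesis iut : forall t, 0 <= t <= T -> inL2 (ut t).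
Hypothesis iux : forall t, 0 <= t <= T -> inL2 (wgt alpha (ux t)).
Let m t := RI I01 (fun x => ut t x * v x).
Let A t := RI I01 (fun x => wgt alpha (ux t) x * wgt alpha g x).
Hypothesis cm : contI 0 T m.
Hypothesis cA : contI 0 T A.
Hypothesis iu1 : inL2 u1.
Hypothesis weak : forall phi phix psi, testfun T alpha phi phix psi ->
    RI (Icc 0 T) (fun t => RI I01 (fun x =>
          - ut t x * psi t x + x `^ alpha * ux t x * phix t x))
    - RI I01 (fun x => u1 x * phi 0 x)
    = RI (Icc 0 T) (fun t => RI I01 (fun x => f t x * phi t x)).

Lemma weak_theta a d : 0 <= a -> 0 < d -> a + d <= T ->
  d^-1 * RI (Icc a (a + d)) m + RI (Icc 0 T) (fun t => theta a d t * A t)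
    - RI I01 (fun x => u1 x * v x) = source (theta a d).
Proof.
move=> a0 d0 adT; rewrite /source; have /= <- := weak (testfun_theta a0 d0 adT hv).
have cth := contI_theta a0 d0 adT.
have im : intg (Icc 0 T) m by exact: intg_contI.
congr (_ - _); last first.
  by apply: RI_eq => x _; rewrite /theta a0 mul1r.
have -> : d^-1 * RI (Icc a (a + d)) m = - RI (Icc 0 T) (fun t => dtheta a d t * m t).
  by rewrite (RI_dtheta a0 d0 adT im) mulNr opprK.
have i1 := intg_dtheta_mul a d0 im.
have i2 : intg (Icc 0 T) (fun t => theta a d t * A t) by apply/intg_contI/contIM.
rewrite -RIN // -RID //; last exact: intgN.
apply: RI_eq => t /IccP tI; have iw := H1a_wgt hv.
have j1 : intg I01 (fun x => ut t x * v x) by apply: inL2_mul => //; exact: iut.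
have j2 : intg I01 (fun x => wgt alpha (ux t) x * wgt alpha g x).
  by apply: inL2_mul => //; exact: iux.
have k1 := intgZ (dtheta a d t) mI01 j1.
rewrite /m /A -(RIZ _ mI01 j1) -(RIZ _ mI01 j2) -(RIN mI01 k1).
rewrite -(RID mI01 (intgN mI01 k1) (intgZ _ mI01 j2)).
by apply: RI_eq => x _; rewrite wgt_mul; ring.
Qed.

(** The limit of the left side of [weak_theta] as [d] tends to 0, when the cutoff becomes the
    indicator of [[0, a]]. *)
Let D a := m a + RI (Icc 0 a) A - RI I01 (fun x => u1 x * v x).

Lemma theta_close (e M d a p q x y z : R) : d * M < e / 2 -> `|p - q| <= e / 2 ->
  `|x| <= M * (a + d - a) -> `|p + (y + (x + 0)) - z - (q + y - z)| <= e.
Proof. rewrite !ler_norml; lra. Qed.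

(** The mean of [m] over [[a, a + d]] tends to [m a] by continuity, and the descending part of the
    cutoff contributes at most [d] times a bound for [A]. *)
Lemma weak_theta_lim a e : 0 <= a < T -> 0 < e -> exists2 k, 0 < k & forall d, 0 < d < k ->
  a + d <= T -> `|source (theta a d) - D a| <= e.
Proof.
move=> /andP[a0 aT] e0; have e2 : 0 < e / 2 by lra.
have [MA MA0 hMA] := contI_bounded cA.
have [|k k0 hk] := RI_mean (x := a) cm _ e2; first by rewrite a0.
exists (Num.min k (e / 2 / MA)) => [|d /andP[d0]]; first by rewrite lt_min k0 !divr_gt0.
rewrite lt_min ltr_pdivlMr // => /andP[dk dM] adT.
have := hk d; rewrite d0 dk => /(_ isT adT) hm.
have cth := contI_theta a0 d0 adT.
have cthA : contI 0 T (fun t => theta a d t * A t) by exact: contIM.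
have ii b c : 0 <= b -> c <= T -> intg (Icc b c) (fun t => theta a d t * A t).
  by move=> b0 cT; apply: intg_contI; apply: contI_sub cthA.
rewrite -weak_theta //.
have aad : a <= a + d by rewrite lerDl ltW.
have ad0 : 0 <= a + d := le_trans a0 aad.
rewrite (RI_chasles a0 (ltW aT) (ii _ _ (lexx 0) (lexx T))).
rewrite (RI_chasles aad adT (ii _ _ a0 (lexx T))).
have -> : RI (Icc 0 a) (fun t => theta a d t * A t) = RI (Icc 0 a) A.
  by apply: RI_eq => t /IccP /andP[_ ta]; rewrite /theta ta mul1r.
have -> : RI (Icc (a + d) T) (fun t => theta a d t * A t) = 0.
  have -> : 0 = RI (Icc (a + d) T) (fun t => 0 * A t).
    by rewrite RIZ ?mul0r //; apply: intg_contI; apply: contI_sub cA.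
  apply: RI_eq_oo; [exact: ii | by apply: intgZ => //; apply: intg_contI; apply: contI_sub cA |].
  move=> t /andP[adt _]; rewrite /theta [t <= a]leNgt (le_lt_trans aad adt) /=.
  by rewrite leNgt adt.
have : `|RI (Icc a (a + d)) (fun t => theta a d t * A t)| <= MA * (a + d - a).
  apply: RI_norm_le => //; first exact: ii.
  move=> t /andP[ta tad]; rewrite normrM -[leRHS]mul1r.
  have /andP[th0 th1] := theta_bound a0 d0 adT t.
  apply: ler_pM => //; first by rewrite ger0_norm.
  by apply: hMA; rewrite (le_trans a0 ta) (le_trans tad).
have hm' : `|d^-1 * RI (Icc a (a + d)) m - m a| <= e / 2.
  have -> : d^-1 * RI (Icc a (a + d)) m - m a = d^-1 * (RI (Icc a (a + d)) m - d * m a).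
    by rewrite mulrBr mulrA mulVf ?mul1r // gt_eqF.
  by rewrite normrM ger0_norm ?invr_ge0 ?(ltW d0) // mulrC ler_pdivrMr.
move: hm'; rewrite /D => hm2 hA; exact (theta_close _ _ dM hm2 hA).
Qed.

(** Cutoffs of equal width [d] at [t] and at [s] differ only on [[s, t + d]], so their sources
    differ by at most [nv * (Fp (t + d) - Fp s)]; then [d] tends to 0. *)
Lemma weak_increment s t : 0 <= s -> s <= t -> t < T ->
  `|m t - m s + RI (Icc s t) A| <= nv * (Fp t - Fp s).
Proof.
move=> s0 st tT; have t0 : 0 <= t := le_trans s0 st.
have nv0 : 0 <= nv by exact: nrm_ge0.
have -> : m t - m s + RI (Icc s t) A = D t - D s.
  rewrite /D (RI_chasles s0 st); first by ring.
  by apply: intg_contI; apply: contI_sub cA => //; exact: ltW.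
apply/ler_addgt0Pr => e e0; have e4 : 0 < e / 4 by lra.
have en : 0 < e / 4 / (nv + 1) by rewrite divr_gt0 // ltr_wpDl.
have [|k1 k10 h1] := weak_theta_lim (a := s) _ e4; first by rewrite s0 (le_lt_trans st).
have [|k2 k20 h2] := weak_theta_lim (a := t) _ e4; first by rewrite t0.
have [|k3 k30 h3] := contI_Fp (x := t) _ en; first by rewrite t0 ltW.
pose k := Num.min (Num.min k1 k2) (Num.min k3 (T - t)).
have k0 : 0 < k by rewrite !lt_min k10 k20 k30 subr_gt0.
have [d d0 dk] : exists2 d, 0 < d & d < k by exists (k / 2); lra.
move: dk; rewrite !lt_min => /andP[/andP[dk1 dk2] /andP[dk3 dk4]].
have tdT : t + d <= T by lra.
have sdT : s + d <= T by lra.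
have ttd : t <= t + d by rewrite lerDl ltW.
have := h1 d; rewrite d0 dk1 => /(_ isT sdT) {}h1.
have := h2 d; rewrite d0 dk2 => /(_ isT tdT) {}h2.
have := h3 (t + d); rewrite tdT (le_trans t0 ttd) (_ : t + d - t = d); last by ring.
rewrite gtr0_norm // => /(_ isT dk3) {}h3.
have m1 := measurable_theta t0 d0 tdT; have m2 := measurable_theta s0 d0 sdT.
have b1 r := theta_bound t0 d0 tdT r; have b2 r := theta_bound s0 d0 sdT r.
have [||||i1 i2] := @RI_nf_supp (fun r => `|theta t d r - theta s d r|) s (t + d) s0 _ tdT _ _ _.
- exact: le_trans ttd.
- by apply: measurableT_comp => //; exact: measurable_funB.
- by move=> r _; rewrite normr_ge0 /= ler_norml; have := b1 r; have := b2 r; lra.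
- move=> r _; rewrite negb_and -!ltNge => /orP[rs|tr].
    by rewrite /theta (ltW (lt_le_trans rs st)) (ltW rs) subrr normr0.
  have tr' : t < r := le_lt_trans ttd tr.
  rewrite /theta !leNgt tr' tr /= (le_lt_trans st tr') /= (le_lt_trans _ tr) ?subrr ?normr0 //.
  by rewrite lerD2r.
have := source_diff m1 m2 (fun r _ => b1 r) (fun r _ => b2 r) i1.
have : nv * RI (Icc 0 T) (fun r => `|theta t d r - theta s d r| * nf r) <= nv * (Fp (t + d) - Fp s).
  by rewrite ler_wpM2l.
have : nv * (Fp (t + d) - Fp t) <= e / 4.
  apply: (@le_trans _ _ (nv * (e / 4 / (nv + 1)))).
    by rewrite ler_wpM2l // (le_trans (ler_norm _)) // ltW.
  rewrite mulrA ler_pdivrMr ?ltr_wpDl //; nra.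
have split3 (p q y z : R) : p - q = y - z - (y - p) + (z - q) by ring.
rewrite (split3 (D t) (D s) (source (theta t d)) (source (theta s d))).
move=> g1 g2 g3; apply: (le_trans (ler_normD _ _)).
apply: (le_trans (lerD (ler_normB _ _) (lexx _))); nra.
Qed.

(** The cutoff at 0 sees the source only on [[0, d]], so letting [d] tend to 0 leaves [D 0 = 0].
    This recovers the initial velocity, which [weak_solution] contains only inside the integral
    identity. *)
Lemma weak_initial : m 0 = RI I01 (fun x => u1 x * v x).
Proof.
have nv0 : 0 <= nv by exact: nrm_ge0.
suff : `|D 0| <= 0.
  rewrite normr_le0 /D RI_point addr0 subr_eq0 => /eqP ->//.
apply/ler_addgt0Pr => e e0; have e4 : 0 < e / 4 by lra.
have en : 0 < e / 4 / (nv + 1) by rewrite divr_gt0 // ltr_wpDl.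
have [|k2 k20 h2] := weak_theta_lim (a := 0) _ e4; first by rewrite lexx.
have [|k3 k30 h3] := contI_Fp (x := 0) _ en; first by rewrite lexx ltW.
pose k := Num.min k2 (Num.min k3 T).
have k0 : 0 < k by rewrite !lt_min k20 k30 T0.
have [d d0 dk] : exists2 d, 0 < d & d < k by exists (k / 2); lra.
move: dk; rewrite !lt_min => /andP[dk2 /andP[dk3 dk4]].
have tdT : 0 + d <= T by lra.
have := h2 d; rewrite d0 dk2 => /(_ isT tdT) {}h2.
have := h3 d; rewrite subr0 gtr0_norm // (ltW d0) (ltW dk4) => /(_ isT dk3) {}h3.
have m1 := measurable_theta (lexx 0) d0 tdT.
have b1 r := theta_bound (lexx 0) d0 tdT r.
have z01 r : 0 <= r <= T -> 0 <= (0 : R) <= 1 by rewrite lexx ler01.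
have m0 : measurable_fun (Icc 0 T) (fun=> 0 : R) by exact: measurable_cst.
have [||||i1 i2] := @RI_nf_supp (fun r => `|theta 0 d r - 0|) 0 d (lexx 0) _ (ltW dk4) _ _ _.
- exact: ltW.
- by apply: measurableT_comp => //; exact: measurable_funB.
- by move=> r _; rewrite subr0 ger0_norm; have /andP[] := b1 r => // -> ->.
- move=> r /andP[r0 _]; rewrite r0 /= -ltNge => tr.
  by rewrite /theta !leNgt (lt_trans d0 tr) add0r tr /= subr0 normr0.
have := source_diff m1 m0 (fun r _ => b1 r) z01 i1.
have -> : source (fun=> 0) = 0.
  rewrite /source (@RI_eq _ _ _ (fun=> 0)) ?RI_cst ?mul0r ?ltW // => t _.
  rewrite (@RI_eq _ _ _ (fun x => 0 * v x ^+ 2)) => [|x _]; last by rewrite !mul0r mulr0.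
  by rewrite RIZ ?mul0r //; have [_] := (inL2P v).1 iv.
have : nv * RI (Icc 0 T) (fun r => `|theta 0 d r - 0| * nf r) <= nv * (Fp d - Fp 0).
  by rewrite ler_wpM2l.
have : nv * (Fp d - Fp 0) <= e / 4.
  apply: (@le_trans _ _ (nv * (e / 4 / (nv + 1)))).
    by rewrite ler_wpM2l // (le_trans (ler_norm _)) // ltW.
  rewrite mulrA ler_pdivrMr ?ltr_wpDl //; nra.
rewrite subr0 add0r => g1 g2 g3.
have -> : D 0 = source (theta 0 d) - (source (theta 0 d) - D 0) by ring.
apply: (le_trans (ler_normB _ _)); lra.
Qed.

End WeakIncrement.

(** * The averaged multiplier *)

Section SpatialCalculus.
Context {R : realType}.
Local Notation mu := (@lebesgue_measure R).
Local Notation mset := (@measurable _ (measurableTypeR R)).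
Implicit Types (f g F G K : R -> R) (a b c d h k x y r : R).
Hint Resolve mI01 measurable_Icc : core.

Lemma intg_Icc_sub a b c d f : c <= a -> b <= d -> intg (Icc c d) f -> intg (Icc a b) f.
Proof. by move=> ca bd hf; apply: intg_sub hf => //; exact: Icc_sub. Qed.

Lemma RI_zero_oo a b f : intg (Icc a b) f -> (forall x, a < x < b -> f x = 0) ->
  RI (Icc a b) f = 0.
Proof.
move=> hf h0; have -> : 0 = RI (Icc a b) (fun x => 0 * f x) by rewrite RIZ // mul0r.
by apply: RI_eq_oo => //; [exact: intgZ | move=> x xab; rewrite mul0r h0].
Qed.

Lemma RI_supp a b c d f : c <= a -> a <= b -> b <= d -> intg (Icc c d) f ->
  (forall x, x < a \/ b < x -> f x = 0) -> RI (Icc c d) f = RI (Icc a b) f.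
Proof.
move=> ca ab bd hf h0; have ad := le_trans ab bd.
rewrite (RI_chasles ca ad hf) (RI_chasles ab bd (intg_Icc_sub ca (lexx d) hf)).
rewrite (RI_zero_oo (intg_Icc_sub (lexx c) ad hf)); last by move=> x /andP[_ xa]; apply: h0; left.
rewrite (RI_zero_oo (intg_Icc_sub (le_trans ca ab) (lexx d) hf)) ?addr0 ?add0r //.
by move=> x /andP[bx _]; apply: h0; right.
Qed.

Lemma intg_supp a b c d f : c <= a -> b <= d -> intg (Icc a b) f ->
  (forall x, x < a \/ b < x -> f x = 0) -> intg (Icc c d) f.
Proof.
move=> ca bd hf h0.
have hf' : intg setT (f \_ (Icc a b)).
  have := (@integrable_mkcond _ (measurableTypeR R) R mu (Icc a b) (EFin \o f) (measurable_Icc a b)).1 hf.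
  by rewrite /intg -restrict_EFin.
apply: (intg_eq (f := f \_ (Icc a b))) => //.
  move=> x _; rewrite patchE; case: ifPn => // /negP xab; rewrite h0 //.
  have [xa|ax] := ltP x a; [by left | right; rewrite ltNge; apply/negP => xb].
  by apply: xab; rewrite inE; apply/IccP; rewrite ax.
exact: (intg_sub measurableT (measurable_Icc c d) (@subsetT _ _) hf').
Qed.

(** Expand the nonnegative integral of [(f - m)^2] for the mean [m] of [f]. *)
Lemma jensen_sqr a b f : a < b -> intg (Icc a b) f -> intg (Icc a b) (fun x => f x ^+ 2) ->
  RI (Icc a b) f ^+ 2 <= (b - a) * RI (Icc a b) (fun x => f x ^+ 2).
Proof.
move=> ab hf hf2; have ba : 0 < b - a by rewrite subr_gt0.
pose m := RI (Icc a b) f / (b - a).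
have := @RI_ge0 R (Icc a b) (fun x => f x ^+ 2 - 2 * m * f x + m ^+ 2).
have -> : RI (Icc a b) (fun x => f x ^+ 2 - 2 * m * f x + m ^+ 2) =
  RI (Icc a b) (fun x => f x ^+ 2) - 2 * m * RI (Icc a b) f + m ^+ 2 * (b - a).
  have i1 := intgZ (2 * m) (measurable_Icc a b) hf.
  rewrite RID //; [|by apply: intgB|exact: intg_cst].
  by rewrite RIB // RIZ // RI_cst // ltW.
move=> h; have {h} : 0 <= RI (Icc a b) (fun x => f x ^+ 2) - 2 * m * RI (Icc a b) f + m ^+ 2 * (b - a).
  by apply: h => x _; have := sqr_ge0 (f x - m); congr (0 <= _); ring.
have -> : RI (Icc a b) f = m * (b - a) by rewrite /m divfK // gt_eqF.
nra.
Qed.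

Lemma prim_holder a b F f x y : prim a b F f -> intg (Icc a b) (fun x => f x ^+ 2) ->
  a <= x -> x <= y -> y <= b -> (F y - F x) ^+ 2 <= (y - x) * RI (Icc a b) (fun x => f x ^+ 2).
Proof.
move=> [hf hF] hf2 ax; rewrite le_eqVlt => /predU1P[<- _|xy yb].
  by rewrite !subrr expr0n mul0r.
rewrite hF // ?(ltW xy) //; apply: (le_trans (jensen_sqr xy _ _)).
- exact: intg_Icc_sub hf.
- exact: intg_Icc_sub hf2.
rewrite ler_wpM2l ?subr_ge0 ?(ltW xy) //.
have ay := le_trans ax (ltW xy).
rewrite (RI_chasles ay yb hf2) (RI_chasles ax (ltW xy) (intg_Icc_sub (lexx a) yb hf2)).
have p1 : 0 <= RI (Icc a x) (fun x => f x ^+ 2) by apply: RI_ge0 => z _; exact: sqr_ge0.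
have p2 : 0 <= RI (Icc y b) (fun x => f x ^+ 2) by apply: RI_ge0 => z _; exact: sqr_ge0.
lra.
Qed.

(** Backward, so that no value beyond [x = 1] is used; the price is a margin [k] at the left end. *)
Definition diffq k F : R -> R := fun x => (F x - F (x - k)) / k.

Lemma prim_diffq a b k F f : 0 <= k -> prim (a - k) b F f -> prim a b (diffq k F) (diffq k f).
Proof.
move=> k0 pF.
have p1 : prim a b F f by apply: prim_sub pF => //; lra.
have p2 : prim a b (fun x => F (x - k)) (fun x => f (x - k)).
  by apply: prim_shift; apply: prim_sub pF; lra.
have := primZ k^-1 (primB p1 p2).
by apply: prim_eq => x _; rewrite /diffq mulrC.
Qed.

(** Jensen on [[x - k, x]] bounds the square by [k^-1 * (P x - P (x - k))], with [P] the primitive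
    of the square of [f]; the integral of this telescopes and is at most [P b]. The constant is 1
    for every [k], which makes the later bounds uniform in the step. *)
Lemma RI_diffq_sqr a b k F f : 0 < k -> a <= b -> prim (a - k) b F f ->
  intg (Icc (a - k) b) (fun x => f x ^+ 2) ->
  RI (Icc a b) (fun x => diffq k F x ^+ 2) <= RI (Icc (a - k) b) (fun x => f x ^+ 2).
Proof.
move=> k0 ab pF hf2; have [hf hF] := pF.
pose P x := RI (Icc (a - k) x) (fun x => f x ^+ 2).
have pP : prim (a - k) b P (fun x => f x ^+ 2) by exact: prim_RI.
have cP := prim_contI pP.
have cd : contI a b (diffq k F) by apply: (prim_contI (prim_diffq _ pF)); exact: ltW.
have cPs : contI a b (fun x => P (x - k)).
  have := prim_contI (@prim_shift R a b (- k) P (fun x => f x ^+ 2) _); apply.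
  by apply: prim_sub pP; lra.
have cPa : contI a b P by apply: contI_sub cP => //; lra.
apply: (@le_trans _ _ (RI (Icc a b) (fun x => k^-1 * (P x - P (x - k))))).
  apply: RI_le => //.
  - by apply: intg_contI; under eq_fun do rewrite expr2; exact: contIM.
  - by apply: intg_contI; apply: contIZ; exact: contIB.
  move=> x /IccP /andP[ax xb].
  rewrite /diffq expr_div_n ler_pdivrMr ?exprn_gt0 // mulrAC.
  rewrite (_ : k^-1 * k ^+ 2 = k); last by rewrite expr2 mulrA mulVf ?mul1r // gt_eqF.
  have xk : x - k < x by lra.
  have [_ hP] := pP.
  rewrite hF ?hP ?(ltW xk) //; try lra.
  have := @jensen_sqr (x - k) x f xk; rewrite opprB addrCA subrr addr0; apply.
  - by apply: intg_Icc_sub hf; lra.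
  - by apply: intg_Icc_sub hf2; lra.
rewrite RIZ //; last by apply: intg_contI; exact: contIB.
rewrite RI_telescope ?(ltW k0) //; last exact: intg_contI.
have Pnd x y : a - k <= x -> x <= y -> y <= b -> P x <= P y.
  move=> ax xy yb; have [_ hP] := pP; rewrite -subr_ge0 hP //.
  by apply: RI_ge0 => z _; exact: sqr_ge0.
have P0 x : 0 <= P x by apply: RI_ge0 => z _; exact: sqr_ge0.
have h1 : 0 <= RI (Icc (a - k) a) P by apply: RI_ge0 => z _.
have h2 : RI (Icc (b - k) b) P <= P b * (b - (b - k)).
  rewrite -RI_cst; last lra.
  apply: RI_le => //; [by apply: intg_contI; apply: contI_sub cP; lra|exact: intg_cst|].
  by move=> x /IccP xI; apply: Pnd; lra.
rewrite mulrC ler_pdivrMr // -/(P b); lra.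
Qed.

(** Discrete integration by parts. As [G] vanishes outside [[a, b]] and [k <= a], its translate to
    the left is still supported in [[0, 1]], so no boundary term appears. *)
Lemma shift_adjoint a b k K G : 0 <= a - k -> 0 <= k -> a <= b -> b <= 1 ->
  (forall x, x < a \/ b < x -> G x = 0) ->
  intg (Icc a b) (fun x => K x * G x) -> intg (Icc a b) (fun x => K (x - k) * G x) ->
  RI (Icc 0 1) (fun y => K y * (G (y + k) - G y)) =
  - RI (Icc a b) (fun x => (K x - K (x - k)) * G x).
Proof.
move=> ak k0 ab b1 G0 i1 i2.
have j1 : intg (Icc 0 1) (fun x => K x * G x).
  by apply: (intg_supp (a := a) (b := b)) => //; [lra | move=> x hx; rewrite G0 ?mulr0].
have j2 : intg (Icc (0 + k) (1 + k)) (fun x => K (x - k) * G x).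
  apply: (intg_supp (a := a) (b := b)) => //; [lra | lra |].
  by move=> x hx; rewrite G0 ?mulr0.
have j3 := intg_shift j2.
have j4 : intg (Icc 0 1) (fun y => K y * G (y + k)).
  by apply: intg_eq j3 => // y _; rewrite addrK.
rewrite (@RI_eq _ _ _ (fun y => K y * G (y + k) - K y * G y)); last by move=> y _; rewrite mulrBr.
rewrite RIB //.
rewrite (@RI_eq _ _ (fun y => K y * G (y + k)) (fun y => K (y + k - k) * G (y + k))); last first.
  by move=> y _; rewrite addrK.
rewrite (RI_shift j2) (RI_supp (a := a) (b := b) _ _ _ j2) //; [|lra|lra|]; last first.
  by move=> x hx; rewrite G0 ?mulr0.
rewrite (RI_supp (a := a) (b := b) _ _ _ j1) //; [|lra|]; last first.
  by move=> x hx; rewrite G0 ?mulr0.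
rewrite -opprB -RIB //; congr (- _); apply: RI_eq => x _; ring.
Qed.

Lemma contI_derive a b F f : (forall x : R, a <= x <= b -> is_derive x (1 : R) F (f x)) ->
  contI a b F.
Proof.
move=> dF x xab e e0; have [dx _] := dF x xab.
have : F @ x --> F x by apply: differentiable_continuous; exact/derivable1_diffP.
move=> /cvgrPdist_lt /(_ e e0) [d /= d0 hd]; exists d => // y _ yx.
by rewrite distrC; apply: hd; rewrite /= distrC.
Qed.

Lemma prim_powR a b r : 0 < a ->
  prim a b (fun x => x `^ r) (fun x => r * x `^ (r - 1)).
Proof.
move=> a0; have dp s x : a <= x <= b -> is_derive x (1 : R) (fun x => x `^ s) (s * x `^ (s - 1)).
  by move=> /andP[ax _]; apply: is_derive1_powR; exact: lt_le_trans ax.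
apply: (prim_C1 (fun x xab => dp r x xab)).
apply: contIZ; apply: (contI_derive (f := fun x => (r - 1) * x `^ (r - 1 - 1))).
Qed.

End SpatialCalculus.

Section Restrict.
Context {R : realType}.
Local Notation mu := (@lebesgue_measure R).
Implicit Types (f g : R -> R) (a b c d x : R).
Hint Resolve mI01 measurable_Icc : core.

Lemma I01_sub : @I01 R `<=` Icc 0 1.
Proof. by move=> x /I01P /andP[/ltW x0 /ltW x1]; apply/IccP; rewrite x0. Qed.

Lemma intg_I01 f : intg I01 f <-> intg (Icc 0 1) f.
Proof.
split=> [h|h]; last by apply: intg_sub h => //; exact: I01_sub.
have m : measurable_fun (Icc 0 1) f.
  have := intg_measurable h; rewrite /I01 => mf.
  by apply/measurable_fun_itv_bndo_bndcP; apply/measurable_fun_itv_obnd_cbndP.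
apply/integrableP; split; first exact/measurable_EFinP.
have ma : measurable_fun (@I01 R) (fun x => `|(f x)%:E|)%E.
  by apply: measurableT_comp => //; apply/measurable_EFinP; exact: intg_measurable h.
rewrite /Icc -integral_itv_bndo_bndc.
  rewrite -integral_itv_obnd_cbnd; last exact: ma.
  by move/integrableP : h => [_].
apply/emeasurable_fun_itv_obnd_cbndP; exact: ma.
Qed.

Lemma RI_I01 f : intg (Icc 0 1) f -> RI I01 f = RI (Icc 0 1) f.
Proof.
move=> h; have h1 := (intg_I01 f).2 h; rewrite /RI /I01 /Icc.
have i1 : mu.-integrable `[0, 1[ (EFin \o f).
  by apply: intg_sub h => // x; rewrite /Icc /= !in_itv /= => /andP[-> /ltW ->].
by rewrite -(Rintegral_itv_bndo_bndc i1) (Rintegral_itv_obnd_cbnd h1).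
Qed.

Lemma inL2_sqr f : inL2 f -> intg (Icc 0 1) (fun x => f x ^+ 2).
Proof. by move=> /inL2P[_ h]; exact/intg_I01. Qed.

Lemma inL2_meas_Icc f : inL2 f -> measurable_fun (Icc 0 1) f.
Proof.
move=> [mf _]; apply/measurable_fun_itv_bndo_bndcP.
by apply/measurable_fun_itv_obnd_cbndP.
Qed.

Lemma inL2_intg f : inL2 f -> intg (Icc 0 1) f.
Proof.
move=> hf; have i2 := inL2_sqr hf.
apply: (intg_le _ _ (g := fun x => 1 + f x ^+ 2)) => //; first exact: inL2_meas_Icc.
  move=> x _; have := sqr_ge0 (f x - 1); have := sqr_ge0 (f x + 1).
  rewrite sqrrD sqrrB !mulr1 expr1n ler_norml => ? ?; apply/andP; split; lra.
by apply: intgD => //; exact: intg_cst.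
Qed.

Lemma sqL2_Icc f : inL2 f -> sqL2 f = RI (Icc 0 1) (fun x => f x ^+ 2).
Proof. by move=> hf; rewrite /sqL2 RI_I01 //; exact: inL2_sqr. Qed.

Lemma contI_inL2 f : contI 0 1 f -> inL2 f.
Proof.
move=> cf; apply/inL2P; split.
  by apply: intg_measurable; apply/intg_I01; exact: intg_contI.
by apply/intg_I01/intg_contI; under eq_fun do rewrite expr2; exact: contIM.
Qed.

Lemma RI_sub_le a b c d f : c <= a -> a <= b -> b <= d -> intg (Icc c d) f ->
  (forall x, c <= x <= d -> 0 <= f x) -> RI (Icc a b) f <= RI (Icc c d) f.
Proof.
move=> ca ab bd hf h0; have ad := le_trans ab bd.
rewrite (RI_chasles ca ad hf) (RI_chasles ab bd (intg_Icc_sub ca (lexx d) hf)).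
have h1 : 0 <= RI (Icc c a) f.
  by apply: RI_ge0 => x /IccP /andP[cx xa]; apply: h0; rewrite cx (le_trans xa).
have h2 : 0 <= RI (Icc b d) f.
  by apply: RI_ge0 => x /IccP /andP[bx xd]; apply: h0; rewrite xd andbT (le_trans (le_trans ca ab)).
lra.
Qed.

(** Integrate the derivative of [q z^2], whose end values vanish with [q]. *)
Lemma RI_quadratic_ibp a b (q dq z dz : R -> R) : a <= b -> prim a b q dq -> prim a b z dz ->
  q a = 0 -> q b = 0 ->
  [/\ intg (Icc a b) (fun x => q x * z x * dz x), intg (Icc a b) (fun x => dq x * z x ^+ 2) &
  RI (Icc a b) (fun x => q x * z x * dz x) = - (2^-1 * RI (Icc a b) (fun x => dq x * z x ^+ 2))].
Proof.
move=> ab pq pz qa qb; have cq := prim_contI pq; have cz := prim_contI pz.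
have i1 : intg (Icc a b) (fun x => q x * z x * dz x).
  have := intg_mul_contI (contIM cq cz) (prim_intg pz).
  by apply: intg_eq => // x _; exact: mulrC.
have i2 : intg (Icc a b) (fun x => dq x * z x ^+ 2).
  have := intg_mul_contI (contIM cz cz) (prim_intg pq).
  by apply: intg_eq => // x _; rewrite expr2.
split=> //; have [_] := prim_mul (prim_mul pq pz) pz.
move=> /(_ a b (lexx a) ab (lexx b)); rewrite qa qb !mul0r subrr => /esym.
rewrite (@RI_eq _ _ _ (fun x => dq x * z x ^+ 2 + 2 * (q x * z x * dz x))); last first.
  by move=> x _; rewrite expr2; ring.
rewrite RID ?RIZ //; [lra | exact: intgZ].
Qed.

End Restrict.

(** * The multiplier and its forward average *)

Section Multiplier.
Context {R : realType}.
Local Notation mu := (@lebesgue_measure R).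
Local Notation mset := (@measurable _ (measurableTypeR R)).
Implicit Types (f g h w p F G K P : R -> R) (a b c d x y r : R).
Hint Resolve mI01 measurable_Icc : core.
Variables (dl eps k : R).
Hypotheses (dl0 : 0 < dl) (dl1 : dl < 1 / 2) (eps0 : 0 < eps) (epsdl : eps <= 1 - 2 * dl).
Hypotheses (k0 : 0 < k) (kdl : k <= dl / 2).

(** The zero at [dl] cuts off the degenerate end, the zero at 1 removes the boundary terms there,
    and the denominator concentrates the descent of [q] in a layer of width [eps]. *)
Definition qf x := (x - dl) * (1 - x) / (1 - x + eps).
(** The derivative of [qf], split into a term between 0 and 1 on [[dl, 1]], which the energy
    absorbs, and the subtracted term, which is of size [1 / eps] on the layer. *)
Definition qd x := (1 - x) / (1 - x + eps) - (x - dl) * eps / (1 - x + eps) ^+ 2.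

Let den x : x <= 1 -> 0 < 1 - x + eps.
Proof. by move: (eps0) => e x1; lra. Qed.

Let is_derive_den x : x <= 1 ->
  is_derive x (1 : R) (fun x => (1 - x + eps)^-1) ((1 - x + eps) ^- 2).
Proof.
move=> x1; have dn : 1 - x + eps != 0 by rewrite gt_eqF // den.
have d1 : is_derive x (1 : R) (fun x => 1 - x + eps) (-1).
  by apply: is_derive_eq; rewrite ?scaler0; ring.
have := @is_deriveV R (fun x => 1 - x + eps) x (-1) 1 dn d1.
by rewrite /GRing.scale /= mulrN1 opprK.
Qed.

Lemma is_derive_qf x : x <= 1 -> is_derive x (1 : R) qf (qd x).
Proof.
move=> x1; have dn : 1 - x + eps != 0 by rewrite gt_eqF // den.
have d1 : is_derive x (1 : R) (fun x => x - dl) 1 by apply: is_derive_eq; ring.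
have d2 : is_derive x (1 : R) (fun x => 1 - x) (-1) by apply: is_derive_eq; ring.
have d3 := is_deriveM (is_deriveM d1 d2) (is_derive_den x1).
apply: (@is_derive_eq _ _ _ _ _ _ _ _ d3).
by rewrite /qd /GRing.scale fctE /=; field.
Qed.

Lemma prim_qf : prim dl 1 qf qd.
Proof.
apply: (prim_C1 (fun x xI => is_derive_qf (proj2 (andP xI)))).
have cden : contI dl 1 (fun x => (1 - x + eps)^-1).
  exact: (contI_derive (fun x xI => is_derive_den (proj2 (andP xI)))).
have cx : contI dl 1 (fun x => 1 - x) by apply: contIB; [exact: contI_cst|exact: contI_id].
have cd : contI dl 1 (fun x => (x - dl) * eps).
  by apply: contIM; [apply: contIB; [exact: contI_id|exact: contI_cst]|exact: contI_cst].
have := contIB (contIM cx cden) (contIM cd (contIM cden cden)).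
by apply: contI_eq => x _; rewrite /qd expr2 invfM.
Qed.

Lemma qf_bound x : dl <= x <= 1 -> 0 <= qf x <= 1.
Proof.
move=> /andP[dx x1]; have dn := den x1; have e0 := eps0; have d0 := dl0.
rewrite /qf divr_ge0 ?mulr_ge0 ?subr_ge0 ?(ltW dn) //= ler_pdivrMr // mul1r.
have : (x - dl) * (1 - x) <= 1 * (1 - x) by rewrite ler_wpM2r ?subr_ge0 //; lra.
lra.
Qed.

Lemma qf_dl : qf dl = 0. Proof. by rewrite /qf subrr !mul0r. Qed.
Lemma qf_1 : qf 1 = 0. Proof. by rewrite /qf subrr mulr0 mul0r. Qed.

Definition qz h x := if dl <= x <= 1 then qf x * diffq k h x else 0.
(** The forward average is adjoint to the backward quotient: paired with [p] it gives [qz h] paired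
    with the difference quotient of a primitive of [p]. As [qz h] vanishes outside [[dl, 1]], the
    average vanishes on [[0, dl - k]] and at 1. *)
Definition mult h y := k^-1 * RI (Icc y (y + k)) (qz h).
Definition mult' h y := k^-1 * (qz h (y + k) - qz h y).

Lemma qz_out h x : x < dl \/ 1 < x -> qz h x = 0.
Proof.
by rewrite /qz => -[] hx; rewrite ?(leNgt dl) ?(leNgt x) hx ?andbF.
Qed.

Lemma qz_in h x : dl <= x <= 1 -> qz h x = qf x * diffq k h x.
Proof. by rewrite /qz => ->. Qed.

Let dlk : 0 <= dl - k. Proof. by move: (dl0) (kdl) => *; lra. Qed.
Let dl1' : dl <= 1. Proof. by move: (dl1) => *; lra. Qed.

Lemma intg_diffq a f : intg (Icc (a - k) 1) f -> intg (Icc a 1) (diffq k f).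
Proof.
move=> hf; have k0' := k0.
have h1 : intg (Icc a 1) f by apply: intg_Icc_sub hf; lra.
have h2 : intg (Icc a 1) (fun x => f (x - k)).
  by apply: intg_shift; apply: intg_Icc_sub hf; lra.
apply: (intg_eq (f := fun x => k^-1 * (f x - f (x - k)))) => //.
  by move=> x _; rewrite /diffq mulrC.
by apply: intgZ => //; exact: intgB.
Qed.

Lemma intg_qz h c d : intg (Icc (dl - k) 1) h -> intg (Icc c d) (qz h).
Proof.
(* Widening to an interval that contains [[dl, 1]] lets [intg_supp] apply for every [c] and [d]. *)
move=> hh; apply: (@intg_Icc_sub _ _ _ (Num.min c dl) (Num.max d 1)).
- by rewrite ge_min lexx.
- by rewrite le_max lexx.
apply: (intg_supp (a := dl) (b := 1)); rewrite ?ge_min ?le_max ?lexx ?orbT //.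
  apply: (intg_eq (f := fun x => diffq k h x * qf x)) => //.
    by move=> x /IccP xI; rewrite qz_in // mulrC.
  by apply: intg_mul_contI; [exact: prim_contI prim_qf|exact: intg_diffq].
exact: qz_out.
Qed.

Lemma prim_mult h : intg (Icc (dl - k) 1) h -> prim 0 1 (mult h) (mult' h).
Proof.
move=> hh; have k0' := k0.
have pG : prim 0 (1 + k) (fun x => RI (Icc 0 x) (qz h)) (qz h) by exact: prim_RI (intg_qz _ _ hh).
have p1 : prim 0 1 (fun x => RI (Icc 0 (x + k)) (qz h)) (fun x => qz h (x + k)).
  apply: (prim_shift (F := fun x => RI (Icc 0 x) (qz h))).
  by apply: prim_sub pG; lra.
have p2 : prim 0 1 (fun x => RI (Icc 0 x) (qz h)) (qz h) by apply: prim_sub pG; lra.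
have := primZ k^-1 (primB p1 p2); apply: prim_eq => // x /andP[x0 _].
have xk : x <= x + k by lra.
by rewrite /mult (RI_chasles x0 xk (intg_qz _ _ hh)); congr (_ * _); ring.
Qed.

Lemma mult_0 h : intg (Icc (dl - k) 1) h -> mult h 0 = 0.
Proof.
move=> hh; rewrite /mult RI_zero_oo ?mulr0 //; first exact: intg_qz.
by move=> x /andP[_ xk]; apply: qz_out; left; apply: (lt_le_trans xk); move: dlk; lra.
Qed.

Lemma mult_1 h : intg (Icc (dl - k) 1) h -> mult h 1 = 0.
Proof.
move=> hh; rewrite /mult RI_zero_oo ?mulr0 //; first exact: intg_qz.
by move=> x /andP[x1 _]; apply: qz_out; right.
Qed.

(** Integration by parts moves the derivative from [P] to [mult h], which vanishes at both ends;
    [mult' h] is a translation difference, and [shift_adjoint] moves that difference onto [P]. *)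
Lemma mult_adjoint p P h : prim 0 1 P p -> intg (Icc (dl - k) 1) h ->
  RI (Icc 0 1) (fun y => p y * mult h y) = RI (Icc dl 1) (fun x => diffq k P x * qz h x).
Proof.
move=> pP hh; have pm := prim_mult hh; have cP := prim_contI pP; have k0' := k0.
have [im hm] := prim_mul pP pm.
have := hm 0 1 (lexx 0) ler01 (lexx 1); rewrite mult_0 // mult_1 // !mulr0 subrr => /esym.
have i1 : intg (Icc 0 1) (fun y => p y * mult h y).
  exact: intg_mul_contI (prim_contI pm) (prim_intg pP).
have i2 : intg (Icc 0 1) (fun y => P y * mult' h y).
  by have := intg_mul_contI cP (prim_intg pm); apply: intg_eq => // x _; exact: mulrC.
rewrite RID // => /eqP; rewrite addr_eq0 => /eqP ->.
have cP1 : contI dl 1 P by apply: contI_sub cP => //; move: (dl0) => /ltW.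
have cP2 : contI dl 1 (fun x => P (x - k)).
  have pP' : prim (dl - k) (1 - k) P p by apply: prim_sub pP; move: dlk; lra.
  exact: prim_contI (prim_shift pP').
have g1 : intg (Icc dl 1) (fun x => P x * qz h x).
  have := intg_mul_contI cP1 (intg_qz dl 1 hh); apply: intg_eq => // x _; exact: mulrC.
have g2 : intg (Icc dl 1) (fun x => P (x - k) * qz h x).
  have := intg_mul_contI cP2 (intg_qz dl 1 hh); apply: intg_eq => // x _; exact: mulrC.
have sa := shift_adjoint dlk (ltW k0) dl1' (lexx 1) (@qz_out h) g1 g2.
have i3 : intg (Icc 0 1) (fun y => P y * (qz h (y + k) - qz h y)).
  have := intgZ k (measurable_Icc 0 1) i2; apply: intg_eq => // y _.
  by rewrite /mult'; field; rewrite gt_eqF.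
rewrite (@RI_eq _ _ (fun y => P y * mult' h y)
   (fun y => k^-1 * (P y * (qz h (y + k) - qz h y)))); last first.
  by move=> y _; rewrite /mult' mulrCA.
rewrite RIZ // sa mulrN opprK -RIZ.
- by apply: RI_eq => x _; rewrite /diffq; ring.
- exact: measurable_Icc.
- by have := intgB (measurable_Icc dl 1) g1 g2; apply: intg_eq => // x _; rewrite mulrBl.
Qed.

End Multiplier.

(** * Norms of the averaged multiplier *)

Section MultiplierBounds.
Context {R : realType}.
Local Notation mu := (@lebesgue_measure R).
Local Notation mset := (@measurable _ (measurableTypeR R)).
Implicit Types (f g h w p F G K P : R -> R) (a b c d x y r : R).
Hint Resolve mI01 measurable_Icc : core.
Variables (dl eps k : R).
Hypotheses (dl0 : 0 < dl) (dl1 : dl < 1 / 2) (eps0 : 0 < eps) (epsdl : eps <= 1 - 2 * dl).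
Hypotheses (k0 : 0 < k) (kdl : k <= dl / 2).
Local Notation qf := (qf dl eps).
Local Notation qd := (qd dl eps).
Local Notation qz := (qz dl eps k).
Local Notation mult := (mult dl eps k).
Local Notation mult' := (mult' dl eps k).

Let facts : [/\ 0 < dl, dl < 1 / 2, 0 < eps, eps <= 1 - 2 * dl & 0 < k /\ k <= dl / 2].
Proof. by []. Qed.

Lemma sqr_addr_le (x y : R) : (x + y) ^+ 2 <= 2 * (x ^+ 2 + y ^+ 2).
Proof. have := sqr_ge0 (x - y); rewrite sqrrB sqrrD; lra. Qed.

Lemma sqr_intg_le D (f g : R -> R) : mset D -> measurable_fun D f ->
  (forall x, D x -> f x ^+ 2 <= g x) -> intg D g -> intg D (fun x => f x ^+ 2).
Proof.
move=> mD mf fg ig; apply: (intg_le mD _ _ ig); first exact: measurable_funX.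
by move=> x Dx; rewrite ger0_norm ?sqr_ge0 //; exact: fg.
Qed.

Lemma intg_shift_sqr a h : intg (Icc (a - k) 1) (fun x => h x ^+ 2) ->
  intg (Icc a 1) (fun x => h (x - k) ^+ 2).
Proof.
have [d0 d1 e0 ed [kk kd]] := facts => i.
apply: (@intg_shift R (- k) a 1 (fun x => h x ^+ 2)).
by apply: intg_Icc_sub i; lra.
Qed.

(** Here [h] is merely square integrable, hence the factor [4 / k ^+ 2]; the bound serves to make
    the multiplier a bounded operator at fixed [k]. *)
Lemma diffq_sqr_intg h : intg (Icc (dl - k) 1) h ->
  intg (Icc (dl - k) 1) (fun x => h x ^+ 2) ->
  intg (Icc dl 1) (fun x => diffq k h x ^+ 2) /\
  RI (Icc dl 1) (fun x => diffq k h x ^+ 2) <=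
    4 / k ^+ 2 * RI (Icc (dl - k) 1) (fun x => h x ^+ 2).
Proof.
have [d0 d1 e0 ed [kk kd]] := facts => hh h2.
have j1 : intg (Icc dl 1) (fun x => h x ^+ 2) by apply: intg_Icc_sub h2; lra.
have j2 := intg_shift_sqr h2.
have j3 := intgZ (2 / k ^+ 2) (measurable_Icc dl 1) (intgD (measurable_Icc dl 1) j1 j2).
have le x : diffq k h x ^+ 2 <= 2 / k ^+ 2 * (h x ^+ 2 + h (x - k) ^+ 2).
  rewrite /diffq expr_div_n [leRHS]mulrAC ler_pM2r ?invr_gt0 ?exprn_gt0 //.
  by have := sqr_addr_le (h x) (- h (x - k)); rewrite sqrrN.
have ii : intg (Icc dl 1) (fun x => diffq k h x ^+ 2).
  apply: (sqr_intg_le _ _ _ j3) => //.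
  exact: intg_measurable (intg_diffq k0 hh).
split=> //; apply: (@le_trans _ _ (RI (Icc dl 1) (fun x => 2 / k ^+ 2 * (h x ^+ 2 + h (x - k) ^+ 2)))).
  exact: RI_le.
rewrite RIZ ?RID //; last exact: intgD.
have e1 : RI (Icc dl 1) (fun x => h x ^+ 2) <= RI (Icc (dl - k) 1) (fun x => h x ^+ 2).
  by apply: RI_sub_le => //; [lra|lra|move=> x _; exact: sqr_ge0].
have e2 : RI (Icc dl 1) (fun x => h (x - k) ^+ 2) <= RI (Icc (dl - k) 1) (fun x => h x ^+ 2).
  rewrite (@RI_shift R (- k) dl 1 (fun x => h x ^+ 2)); last by apply: intg_Icc_sub h2; lra.
  by apply: RI_sub_le => //; [lra|lra|move=> x _; exact: sqr_ge0].
have c0 : 0 <= 2 / k ^+ 2 by rewrite divr_ge0 // sqr_ge0.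
have -> : 4 / k ^+ 2 = 2 / k ^+ 2 * 2 by rewrite mulrAC; congr (_ / _); ring.
rewrite -mulrA ler_wpM2l //; lra.
Qed.

Lemma qz_sqr h c d : intg (Icc (dl - k) 1) h -> intg (Icc dl 1) (fun x => diffq k h x ^+ 2) ->
  c <= dl -> 1 <= d ->
  intg (Icc c d) (fun x => qz h x ^+ 2) /\
  RI (Icc c d) (fun x => qz h x ^+ 2) <= RI (Icc dl 1) (fun x => diffq k h x ^+ 2).
Proof.
have [d0 d1 e0 ed [kk kd]] := facts => hh h2 cdl d1'.
have le x : dl <= x <= 1 -> qz h x ^+ 2 <= diffq k h x ^+ 2.
  move=> xI; rewrite qz_in // exprMn -[leRHS]mul1r ler_wpM2r ?sqr_ge0 //.
  by have := qf_bound dl0 eps0 xI; rewrite expr2; nra.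
have i1 : intg (Icc dl 1) (fun x => qz h x ^+ 2).
  apply: (sqr_intg_le _ _ (fun x xI => le x ((IccP _ _ _).1 xI)) h2) => //.
  exact: intg_measurable (intg_qz eps0 k0 _ _ hh).
have z x : x < dl \/ 1 < x -> qz h x ^+ 2 = 0 by move=> hx; rewrite qz_out // expr0n.
have i2 : intg (Icc c d) (fun x => qz h x ^+ 2) by apply: intg_supp i1 _.
split=> //; rewrite (RI_supp (a := dl) (b := 1)) //; last by lra.
by apply: RI_le => // x /IccP; exact: le.
Qed.

(** Up to a translation by [k], [mult h] is the difference quotient of a primitive of [qz h], so
    [RI_diffq_sqr] applies and nothing is lost in [k]. *)
Lemma mult_sqr h : intg (Icc (dl - k) 1) h -> intg (Icc dl 1) (fun x => diffq k h x ^+ 2) ->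
  RI (Icc 0 1) (fun y => mult h y ^+ 2) <= RI (Icc dl 1) (fun x => diffq k h x ^+ 2).
Proof.
have [d0 d1 e0 ed [kk kd]] := facts => hh h2.
have iz := intg_qz eps0 k0 _ _ hh.
have [z2 zle] : intg (Icc (k - k) (1 + k)) (fun x => qz h x ^+ 2) /\
  RI (Icc (k - k) (1 + k)) (fun x => qz h x ^+ 2) <= RI (Icc dl 1) (fun x => diffq k h x ^+ 2).
  by apply: qz_sqr => //; lra.
(* The base point [k - k] is 0 in the shape that [RI_diffq_sqr] expects. *)
apply: le_trans zle; pose F x := RI (Icc (k - k) x) (qz h).
have pF : prim (k - k) (1 + k) F (qz h) by exact: prim_RI (iz _ _).
have k1 : k <= 1 + k by lra.
apply: le_trans (RI_diffq_sqr k0 k1 pF z2).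
have cD : contI k (1 + k) (diffq k F) by apply: (prim_contI (prim_diffq (ltW k0) pF)).
have iD : intg (Icc (0 + k) (1 + k)) (fun x => diffq k F x ^+ 2).
  rewrite add0r; apply: intg_contI; under eq_fun do rewrite expr2; exact: contIM.
have := RI_shift iD; rewrite add0r => <-.
rewrite le_eqVlt; apply/orP; left; apply/eqP; apply: RI_eq => y /IccP /andP[y0 y1].
have yk : y <= y + k by lra.
congr (_ ^+ 2); rewrite /diffq addrK /F subrr (RI_chasles y0 yk (iz _ _)) /mult mulrC.
by congr (_ * _); ring.
Qed.

Lemma mult'_sqr h : intg (Icc (dl - k) 1) h -> intg (Icc dl 1) (fun x => diffq k h x ^+ 2) ->
  intg (Icc 0 1) (fun y => mult' h y ^+ 2) /\
  RI (Icc 0 1) (fun y => mult' h y ^+ 2) <=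
    4 / k ^+ 2 * RI (Icc dl 1) (fun x => diffq k h x ^+ 2).
Proof.
have [d0 d1 e0 ed [kk kd]] := facts => hh h2.
have [z1 z1le] : intg (Icc 0 1) (fun x => qz h x ^+ 2) /\
  RI (Icc 0 1) (fun x => qz h x ^+ 2) <= RI (Icc dl 1) (fun x => diffq k h x ^+ 2).
  by apply: qz_sqr => //; lra.
have [z2 z2le] : intg (Icc (0 + k) (1 + k)) (fun x => qz h x ^+ 2) /\
  RI (Icc (0 + k) (1 + k)) (fun x => qz h x ^+ 2) <= RI (Icc dl 1) (fun x => diffq k h x ^+ 2).
  by apply: qz_sqr => //; lra.
have z3 := intg_shift z2.
have le x : mult' h x ^+ 2 <= 2 / k ^+ 2 * (qz h (x + k) ^+ 2 + qz h x ^+ 2).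
  rewrite /mult' exprMn exprVn [leRHS]mulrAC [leRHS]mulrC ler_wpM2l ?invr_ge0 ?sqr_ge0 //.
  by have := sqr_addr_le (qz h (x + k)) (- qz h x); rewrite sqrrN.
have j3 := intgZ (2 / k ^+ 2) (measurable_Icc 0 1) (intgD (measurable_Icc 0 1) z3 z1).
have ii : intg (Icc 0 1) (fun x => mult' h x ^+ 2).
  apply: (sqr_intg_le _ _ _ j3) => //.
  exact: intg_measurable (prim_intg (prim_mult eps0 k0 hh)).
split=> //; apply: (@le_trans _ _ (RI (Icc 0 1) (fun x => 2 / k ^+ 2 * (qz h (x + k) ^+ 2 + qz h x ^+ 2)))).
  exact: RI_le.
rewrite RIZ ?RID //; last exact: intgD.
rewrite (RI_shift z2).
have c0 : 0 <= 2 / k ^+ 2 by rewrite divr_ge0 // sqr_ge0.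
have -> : 4 / k ^+ 2 = 2 / k ^+ 2 * 2 by rewrite mulrAC; congr (_ / _); ring.
rewrite -mulrA ler_wpM2l //; lra.
Qed.

Variable alpha : R.
Hypothesis alpha02 : 0 < alpha < 2.

Lemma powR_le1 x : 0 < x <= 1 -> x `^ alpha <= 1.
Proof.
move=> xI; have := ger_powR xI (ltW (proj1 (andP alpha02))).
by rewrite powRr0.
Qed.

Lemma powR_ge_sqr x : 0 < x <= 1 -> x ^+ 2 <= x `^ alpha.
Proof.
move=> xI; have := ger_powR xI (ltW (proj2 (andP alpha02))).
by rewrite powR_mulrn // ltW //; case/andP: xI.
Qed.

Lemma wgt_sqr_le f : inL2 f -> inL2 (wgt alpha f) /\ sqL2 (wgt alpha f) <= sqL2 f.
Proof.
move=> hf; have [mf f2] := (inL2P f).1 hf.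
have le x : I01 x -> wgt alpha f x ^+ 2 <= f x ^+ 2.
  move=> /I01P /andP[x0 x1]; rewrite wgt_sqr -[leRHS]mul1r ler_wpM2r ?sqr_ge0 //.
  by apply: powR_le1; rewrite x0 ltW.
have i : intg I01 (fun x => wgt alpha f x ^+ 2).
  by apply: (sqr_intg_le _ _ le f2) => //; exact: measurable_wgt.
split; first by apply/inL2P; split => //; exact: measurable_wgt.
exact: RI_le.
Qed.

Section Rep.
Variables (w g : R -> R).
Hypothesis hw : H1rep alpha w g.

Lemma H1rep_prim a : 0 < a -> a <= 1 -> prim a 1 w g.
Proof.
move=> a0 a1; have [_ [_ [w1 [hx _]]]] := hw.
have [ia _] : intg (Icc a 1) g /\ w a = w 1 - RI (Icc a 1) g by apply: hx; rewrite a0.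
split=> // x y ax xy y1.
have [_ ->] : intg (Icc y 1) g /\ w y = w 1 - RI (Icc y 1) g.
  by apply: hx; rewrite y1 (lt_le_trans a0 (le_trans ax xy)).
have [_ ->] : intg (Icc x 1) g /\ w x = w 1 - RI (Icc x 1) g.
  by apply: hx; rewrite (le_trans xy y1) (lt_le_trans a0 ax).
rewrite (RI_chasles xy y1); first by ring.
exact: intg_Icc_sub ia.
Qed.

Let iwg : inL2 (wgt alpha g).
Proof. by have [mg [ig _]] := hw; exact/(wint_inL2 alpha mg). Qed.

(** Since [alpha < 2], the weight on [[dl / 2, 1]] is at least [x^2], hence at least
    [(dl / 2)^2]. *)
Lemma H1rep_grad_sqr : intg (Icc (dl / 2) 1) (fun x => g x ^+ 2) /\
  RI (Icc (dl / 2) 1) (fun x => g x ^+ 2) <= 4 / dl ^+ 2 * sqL2 (wgt alpha g).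
Proof.
have [d0 d1 e0 ed [kk kd]] := facts.
have dh : 0 < dl / 2 by lra.
have dh1 : dl / 2 <= 1 by lra.
have [ig _] := H1rep_prim dh dh1.
have w2 : intg (Icc 0 1) (fun x => wgt alpha g x ^+ 2) by exact: inL2_sqr.
have w2' : intg (Icc (dl / 2) 1) (fun x => wgt alpha g x ^+ 2).
  by apply: intg_Icc_sub w2 => //; exact: ltW.
have le x : dl / 2 <= x <= 1 -> g x ^+ 2 <= 4 / dl ^+ 2 * wgt alpha g x ^+ 2.
  move=> /andP[dx x1]; have x0 : 0 < x := lt_le_trans dh dx.
  rewrite wgt_sqr mulrA -[leLHS]mul1r ler_wpM2r ?sqr_ge0 //.
  have h1 : x ^+ 2 <= x `^ alpha by apply: powR_ge_sqr; rewrite x0.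
  have h2 : (dl / 2) ^+ 2 <= x ^+ 2 by rewrite ler_pXn2r ?nnegrE ?(ltW dh) ?(ltW x0).
  have e1 : 4 / dl ^+ 2 * (dl / 2) ^+ 2 = 1 by field; rewrite gt_eqF.
  rewrite -[leLHS]e1.
  by rewrite ler_wpM2l ?divr_ge0 ?sqr_ge0 // (le_trans h2).
have j := intgZ (4 / dl ^+ 2) (measurable_Icc (dl / 2) 1) w2'.
have ii : intg (Icc (dl / 2) 1) (fun x => g x ^+ 2).
  apply: (sqr_intg_le _ _ (fun x xI => le x ((IccP _ _ _).1 xI)) j) => //.
  exact: intg_measurable ig.
split=> //; rewrite sqL2_Icc //.
apply: (@le_trans _ _ (4 / dl ^+ 2 * RI (Icc (dl / 2) 1) (fun x => wgt alpha g x ^+ 2))).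
  by rewrite -RIZ //; apply: RI_le => // x /IccP; exact: le.
rewrite ler_wpM2l ?divr_ge0 ?sqr_ge0 //.
by apply: RI_sub_le => //; [exact: ltW|move=> x _; exact: sqr_ge0].
Qed.

Let dk : dl / 2 <= dl - k. Proof. by have [d0 d1 e0 ed [kk kd]] := facts; lra. Qed.
Let dk0 : 0 < dl - k. Proof. by have [d0 d1 e0 ed [kk kd]] := facts; lra. Qed.
Let dk1 : dl - k <= 1. Proof. by have [d0 d1 e0 ed [kk kd]] := facts; lra. Qed.

Lemma H1rep_diffq : intg (Icc dl 1) (fun x => diffq k w x ^+ 2) /\
  RI (Icc dl 1) (fun x => diffq k w x ^+ 2) <= RI (Icc (dl / 2) 1) (fun x => g x ^+ 2).
Proof.
have [d0 d1 e0 ed [kk kd]] := facts.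
have pw := H1rep_prim dk0 dk1; have [g2 _] := H1rep_grad_sqr.
have g2' : intg (Icc (dl - k) 1) (fun x => g x ^+ 2) by apply: intg_Icc_sub g2.
split.
  have c := prim_contI (prim_diffq (ltW k0) pw).
  by apply: intg_contI; under eq_fun do rewrite expr2; exact: contIM.
apply: le_trans (RI_diffq_sqr k0 _ pw g2') _; first lra.
by apply: RI_sub_le => // x _; exact: sqr_ge0.
Qed.

Let iw : intg (Icc (dl - k) 1) w.
Proof. exact: intg_contI (prim_contI (H1rep_prim dk0 dk1)). Qed.

Lemma mult_inL2 h : intg (Icc (dl - k) 1) h -> inL2 (mult h).
Proof. by move=> hh; apply: contI_inL2; exact: prim_contI (prim_mult eps0 k0 hh). Qed.

Lemma mult'_inL2 : inL2 (mult' w).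
Proof.
have [i _] := mult'_sqr iw H1rep_diffq.1.
apply/inL2P; split; last exact/intg_I01.
by apply: intg_measurable; apply/intg_I01; exact: prim_intg (prim_mult eps0 k0 iw).
Qed.

(** [mult w] is absolutely continuous on all of [[0, 1]] and vanishes at both ends, so it meets the
    requirements of the weakly and of the strongly degenerate case at once. *)
Lemma mult_H1a : H1a alpha (mult w) (mult' w).
Proof.
have [im hm] := prim_mult eps0 k0 iw.
split; first exact: mult_inL2.
exists (mult w); split; first by apply: aeW.
have m' := mult'_inL2; have [mm _] := m'.
have m1 : mult w 1 = 0 by exact: mult_1.
split=> //; split; first by apply/wint_inL2 => //; exact: (wgt_sqr_le m').1.
split=> //; split.
  move=> x /andP[x0 x1]; split; first by apply: intg_Icc_sub im => //; exact: ltW.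
  by rewrite -hm ?(ltW x0) //; ring.
move=> _; split; first exact: im.
by rewrite -hm // mult_0 // m1; split => //; ring.
Qed.

Lemma mult_sqL2_le : sqL2 (mult w) <= 4 / dl ^+ 2 * sqL2 (wgt alpha g).
Proof.
rewrite sqL2_Icc; last exact: mult_inL2.
apply: le_trans (mult_sqr iw H1rep_diffq.1) _.
exact: le_trans H1rep_diffq.2 H1rep_grad_sqr.2.
Qed.

(** The factor [4 / k ^+ 2] is harmless: this bound only yields continuity in time of the gradient
    of the multiplier. The bound [mult_sqL2_le], which enters the final constant, is free of [k]. *)
Lemma mult'_sqL2_le : sqL2 (wgt alpha (mult' w)) <=
  4 / k ^+ 2 * (4 / dl ^+ 2 * sqL2 (wgt alpha g)).
Proof.
apply: le_trans (wgt_sqr_le mult'_inL2).2 _; rewrite sqL2_Icc; last exact: mult'_inL2.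
apply: le_trans (mult'_sqr iw H1rep_diffq.1).2 _.
rewrite ler_wpM2l ?divr_ge0 ?sqr_ge0 //.
exact: le_trans H1rep_diffq.2 H1rep_grad_sqr.2.
Qed.

End Rep.

Lemma mult_sqL2_le_L2 h : inL2 h -> sqL2 (mult h) <= 4 / k ^+ 2 * sqL2 h.
Proof.
have [d0 d1 e0 ed [kk kd]] := facts => hh.
have ih : intg (Icc (dl - k) 1) h by apply: intg_Icc_sub (inL2_intg hh) => //; lra.
have h2 : intg (Icc (dl - k) 1) (fun x => h x ^+ 2).
  by apply: intg_Icc_sub (inL2_sqr hh) => //; lra.
have [i le] := diffq_sqr_intg ih h2.
rewrite !sqL2_Icc //; last exact: mult_inL2.
apply: le_trans (mult_sqr ih i) _; apply: le_trans le _.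
rewrite ler_wpM2l ?divr_ge0 ?sqr_ge0 //.
by apply: RI_sub_le (inL2_sqr hh) _ => //; [lra|lra|move=> x _; exact: sqr_ge0].
Qed.

End MultiplierBounds.

(** * The multiplier identities and the layer bounds at a fixed time *)

Section MultiplierIdentity.
Context {R : realType}.
Local Notation mu := (@lebesgue_measure R).
Local Notation mset := (@measurable _ (measurableTypeR R)).
Implicit Types (f h F G K P : R -> R) (a b c d x y r : R).
Hint Resolve mI01 measurable_Icc : core.
Variables (dl eps k : R).
Hypotheses (dl0 : 0 < dl) (dl1 : dl < 1 / 2) (eps0 : 0 < eps) (epsdl : eps <= 1 - 2 * dl).
Hypotheses (k0 : 0 < k) (kdl : k <= dl / 2).
Local Notation qf := (qf dl eps).
Local Notation qd := (qd dl eps).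
Local Notation qz := (qz dl eps k).
Local Notation mult := (mult dl eps k).
Local Notation mult' := (mult' dl eps k).
Variable alpha : R.
Hypothesis alpha02 : 0 < alpha < 2.

Let facts : [/\ 0 < dl, dl < 1 / 2, 0 < eps, eps <= 1 - 2 * dl & 0 < k /\ k <= dl / 2].
Proof. by []. Qed.

(** [X] and [X'] stand for the weight and its derivative, [g1 - s] for [qd x], [c] for the
    difference quotient of the weight, [gm] for [g (x - k)]. Only the favourable term in [s * X] is
    kept. In the constant, [1 / dl] pays for [X'], [8 / dl ^+ 2] for the term in [c], and 1 for the
    rest. *)
Lemma pointwise_arith (X X' q g1 s c z zeta gm : R) :
  0 <= X <= 1 -> 0 <= X' <= 2 / dl -> 0 <= q <= 1 -> 0 <= g1 <= 1 -> 0 <= s ->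
  c ^+ 2 <= 16 / dl ^+ 2 ->
  2^-1 * (s * X) * zeta ^+ 2 <=
  - (2^-1 * ((g1 - s) * z ^+ 2)) - 2^-1 * ((X' * q + X * (g1 - s)) * zeta ^+ 2)
   + c * gm * (q * zeta) + (1 + 1 / dl + 8 / dl ^+ 2) * (z ^+ 2 + zeta ^+ 2 + gm ^+ 2).
Proof.
move=> /andP[X0 X1] /andP[X'0 X'1] /andP[q0 q1] /andP[g0 g1'] s0 hc.
have z2 := sqr_ge0 z; have t2 := sqr_ge0 zeta; have m2 := sqr_ge0 gm.
have dli : 0 <= 1 / dl by rewrite divr_ge0 ?ltW.
have dl2 : 0 <= 8 / dl ^+ 2 by rewrite divr_ge0 ?sqr_ge0.
have e1 : g1 * z ^+ 2 <= z ^+ 2 by rewrite -[leRHS]mul1r ler_wpM2r.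
have e2 : 0 <= s * z ^+ 2 by rewrite mulr_ge0.
have e3 : X' * q * zeta ^+ 2 <= 2 / dl * zeta ^+ 2.
  rewrite ler_wpM2r // -[leRHS]mulr1; exact: ler_pM.
have e4 : X * g1 * zeta ^+ 2 <= zeta ^+ 2.
  by rewrite -[leRHS]mul1r ler_wpM2r // -[leRHS]mulr1; exact: ler_pM.
have e5 : (c * gm) ^+ 2 <= 16 / dl ^+ 2 * gm ^+ 2 by rewrite exprMn ler_wpM2r.
have e6 : (q * zeta) ^+ 2 <= zeta ^+ 2.
  rewrite exprMn -[leRHS]mul1r ler_wpM2r // expr2 -[leRHS]mulr1; exact: ler_pM.
have := sqr_ge0 (c * gm + q * zeta); rewrite sqrrD => e7.
have -> : 1 / dl = 2 / dl / 2 by field; rewrite gt_eqF.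
have e8 : 16 / dl ^+ 2 = 2 * (8 / dl ^+ 2) by field; rewrite gt_eqF.
have e9 : 2 / dl = 2 * (1 / dl) by rewrite mulrA mulr1.
move: e5 e3; rewrite e8 e9; set A := 8 / dl ^+ 2; set B := 1 / dl => e5 e3.
have p1 := mulr_ge0 dl2 z2; have p2 := mulr_ge0 dl2 t2.
have p3 := mulr_ge0 dli z2; have p4 := mulr_ge0 dli m2.
rewrite -/A -/B in p1 p2 p3 p4; lra.
Qed.

Lemma powR_bounds x : 0 < x <= 1 ->
  0 <= x `^ alpha <= 1 /\ 0 <= alpha * x `^ (alpha - 1) <= 2 / x.
Proof.
move=> xI; have /andP[x0 x1] := xI; have /andP[a0 a2] := alpha02.
have p1 := powR_le1 alpha02 xI; split; first by rewrite powR_ge0.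
rewrite mulr_ge0 ?powR_ge0 ?(ltW a0) //=; apply: ler_pM; rewrite ?powR_ge0 ?(ltW a0) ?(ltW a2) //.
by rewrite -[leRHS]mul1r ler_pdivlMr // mulrC mulr_powRB1 // ltW.
Qed.

(** On [[dl / 2, 1]] the derivative of the weight is at most [2 / x], hence at most [4 / dl]. *)
Lemma diffq_powR x : dl <= x <= 1 -> diffq k (fun x => x `^ alpha) x ^+ 2 <= 16 / dl ^+ 2.
Proof.
have [d0 d1 e0 ed [kk kd]] := facts => /andP[dx x1].
have dh : 0 < dl / 2 by lra.
have [ip hp] := @prim_powR R (dl / 2) 1 alpha dh.
have h : `|x `^ alpha - (x - k) `^ alpha| <= 4 / dl * (x - (x - k)).
  rewrite hp; [|lra|lra|exact: x1].
  apply: RI_norm_le; [lra| by apply: intg_Icc_sub ip; lra |].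
  move=> y /andP[xy yx]; have yI : 0 < y <= 1 by lra.
  have [_ /andP[b0 b1]] := powR_bounds yI; rewrite ger0_norm //.
  apply: (le_trans b1); rewrite ler_pdivrMr; last by lra.
  rewrite mulrAC ler_pdivlMr //; lra.
have {}h : `|diffq k (fun x => x `^ alpha) x| <= 4 / dl.
  rewrite /diffq normrM normfV (ger0_norm (ltW k0)) ler_pdivrMr //.
  by apply: le_trans h _; rewrite opprB addrCA subrr addr0.
rewrite -(real_normK (num_real (diffq _ _ _))).
have -> : 16 / dl ^+ 2 = (4 / dl) ^+ 2 by rewrite expr_div_n; congr (_ / _); ring.
by rewrite ler_pXn2r ?nnegrE // divr_ge0 // ltW.
Qed.

Section Identity.
Variables (p w g : R -> R).
Hypotheses (hp : inL2 p) (hw : H1rep alpha w g).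
Let P x := RI (Icc 0 x) p.
Let z := diffq k P.
Let zeta := diffq k w.
Let cc := diffq k (fun x => x `^ alpha).

Let dk0 : 0 < dl - k. Proof. by have [d0 d1 e0 ed [kk kd]] := facts; lra. Qed.
Let dk1 : dl - k <= 1. Proof. by have [d0 d1 e0 ed [kk kd]] := facts; lra. Qed.
Let dl1' : dl <= 1. Proof. by have [d0 d1 e0 ed [kk kd]] := facts; lra. Qed.

Let pP : prim 0 1 P p. Proof. exact: prim_RI (inL2_intg hp). Qed.
Let ip : intg (Icc (dl - k) 1) p.
Proof. by apply: intg_Icc_sub (inL2_intg hp) => //; exact: ltW. Qed.
Let pz : prim dl 1 z (diffq k p).
Proof. by apply: prim_diffq (ltW k0) _; apply: prim_sub pP => //; exact: ltW. Qed.
Let pw : prim (dl - k) 1 w g. Proof. exact (H1rep_prim hw dk0 dk1). Qed.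
Let pzeta : prim dl 1 zeta (diffq k g). Proof. exact (prim_diffq (ltW k0) pw). Qed.

(** By [mult_adjoint] the pairing is the integral of [q z z'], where [z] is the difference quotient
    of a primitive of [p]. *)
Lemma mult_kinetic : intg (Icc dl 1) (fun x => qd x * z x ^+ 2) /\
  RI I01 (fun x => p x * mult p x) = - (2^-1 * RI (Icc dl 1) (fun x => qd x * z x ^+ 2)).
Proof.
have im : inL2 (mult p) by exact: mult_inL2.
rewrite RI_I01; last by apply/intg_I01; exact: inL2_mul.
have [i1 i2 <-] := RI_quadratic_ibp dl1' (prim_qf dl eps0) pz (qf_dl dl eps) (qf_1 dl eps).
split=> //; rewrite (mult_adjoint dl0 dl1 eps0 k0 kdl pP ip).
by apply: RI_eq => x /IccP xI; rewrite qz_in // mulrCA mulrA.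
Qed.

Let Qd x := alpha * x `^ (alpha - 1) * qf x + x `^ alpha * qd x.

(** The difference quotient of [x^alpha g] is [x^alpha] times that of [g], which gives a quadratic
    term with weight [x^alpha q], plus the commutator [cc x * g (x - k)], which is bounded because
    the weight is smooth away from 0. *)
Lemma mult_potential : [/\ intg (Icc dl 1) (fun x => Qd x * zeta x ^+ 2),
  intg (Icc dl 1) (fun x => cc x * g (x - k) * (qf x * zeta x)) &
  RI I01 (fun x => wgt alpha g x * wgt alpha (mult' w) x) =
    2^-1 * RI (Icc dl 1) (fun x => Qd x * zeta x ^+ 2) -
    RI (Icc dl 1) (fun x => cc x * g (x - k) * (qf x * zeta x))].
Proof.
have [d0 d1 e0 ed [kk kd]] := facts.
have iw : intg (Icc (dl - k) 1) w by exact: intg_contI (prim_contI pw).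
have iwg : inL2 (wgt alpha g).
  by have [mg [ig _]] := hw; exact/(wint_inL2 alpha mg).
have im' := H1a_wgt (mult_H1a dl0 dl1 eps0 epsdl k0 kdl alpha02 hw).
have iprod := inL2_mul iwg im'.
pose K x := x `^ alpha * g x.
rewrite RI_I01; last exact/intg_I01.
have pp : prim dl 1 (fun x => x `^ alpha) (fun x => alpha * x `^ (alpha - 1)).
  exact: prim_powR.
have pQ : prim dl 1 (fun x => x `^ alpha * qf x) Qd by exact: prim_mul pp (prim_qf dl eps0).
have Q0 : dl `^ alpha * qf dl = 0 by rewrite qf_dl mulr0.
have Q1 : 1 `^ alpha * qf 1 = 0 by rewrite qf_1 mulr0.
have [i1 i2 e1] := RI_quadratic_ibp dl1' pQ pzeta Q0 Q1.
have cqz : contI dl 1 (fun x => qf x * zeta x).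
  by apply: contIM; [exact: prim_contI (prim_qf dl eps0)|exact: prim_contI pzeta].
have iK : intg (Icc (dl - k) 1) K.
  have := intg_mul_contI (prim_contI (@prim_powR R (dl - k) 1 alpha dk0)) (prim_intg pw).
  by apply: intg_eq => // x _; rewrite mulrC.
have iK1 : intg (Icc dl 1) K by apply: intg_Icc_sub iK; lra.
have iK2 : intg (Icc dl 1) (fun x => K (x - k)).
  by apply: intg_shift; apply: intg_Icc_sub iK; lra.
have j1 : intg (Icc dl 1) (fun x => K x * qz w x).
  by have := intg_mul_contI cqz iK1; apply: intg_eq => // x /IccP xI; rewrite qz_in.
have j2 : intg (Icc dl 1) (fun x => K (x - k) * qz w x).
  by have := intg_mul_contI cqz iK2; apply: intg_eq => // x /IccP xI; rewrite qz_in.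
have sa := shift_adjoint (ltW dk0) (ltW k0) dl1' (lexx 1) (@qz_out R dl eps k w) j1 j2.
have ig2 : intg (Icc dl 1) (fun x => g (x - k)).
  by apply: intg_shift; apply: intg_Icc_sub (prim_intg pw); lra.
have ccc : contI dl 1 cc.
  exact: prim_contI (prim_diffq (ltW k0) (@prim_powR R (dl - k) 1 alpha dk0)).
have i3 : intg (Icc dl 1) (fun x => cc x * g (x - k) * (qf x * zeta x)).
  have := intg_mul_contI (contIM ccc cqz) ig2; apply: intg_eq => // x _; ring.
split=> //.
have -> : RI (Icc 0 1) (fun x => wgt alpha g x * wgt alpha (mult' w) x) =
    k^-1 * RI (Icc 0 1) (fun y => K y * (qz w (y + k) - qz w y)).
  rewrite -RIZ //; first by apply: RI_eq => x _; rewrite wgt_mul /mult' /K; ring.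
  have := intgZ k (measurable_Icc 0 1) ((intg_I01 _).1 iprod).
  apply: intg_eq => // x _; rewrite wgt_mul /mult' /K; field; rewrite gt_eqF //.
rewrite sa mulrN -RIZ //; last first.
  by have := intgB (measurable_Icc dl 1) j1 j2; apply: intg_eq => // x _; rewrite mulrBl.
rewrite (@RI_eq _ _ _ (fun x => x `^ alpha * qf x * zeta x * diffq k g x +
   cc x * g (x - k) * (qf x * zeta x))); last first.
  move=> x /IccP xI; rewrite qz_in // /K /cc /zeta /diffq; field; rewrite gt_eqF //.
by rewrite RID // e1; ring.
Qed.

(** The factor [dl ^+ 3 / (8 * eps)] is one half times the lower bounds on the layer,
    [dl / (4 * eps)] for the large part of [- q'] and [dl ^+ 2] for the weight. The factor
    [8 / dl ^+ 2 + 1] bounds the integral of [W]: its [z] part costs [sqL2 p], its two other parts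
    [4 / dl ^+ 2] times the weighted gradient each. *)
Lemma multiplier_bound :
  dl ^+ 3 / (8 * eps) * RI (Icc (1 - eps) 1) (fun x => zeta x ^+ 2) <=
  RI I01 (fun x => p x * mult p x) - RI I01 (fun x => wgt alpha g x * wgt alpha (mult' w) x)
  + (1 + 1 / dl + 8 / dl ^+ 2) * (8 / dl ^+ 2 + 1) * (sqL2 p + sqL2 (wgt alpha g)).
Proof.
have [d0 d1 e0 ed [kk kd]] := facts.
have [i1 ->] := mult_kinetic; have [i2 i3 ->] := mult_potential.
pose W x := z x ^+ 2 + zeta x ^+ 2 + g (x - k) ^+ 2.
pose C1 := 1 + 1 / dl + 8 / dl ^+ 2.
have C10 : 0 <= C1.
  have a1 : 0 <= 1 / dl by rewrite divr_ge0 // ltW.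
  have a2 : 0 <= 8 / dl ^+ 2 by apply: divr_ge0; rewrite ?sqr_ge0.
  rewrite /C1; lra.
pose J x := - (2^-1 * (qd x * z x ^+ 2)) - 2^-1 * (Qd x * zeta x ^+ 2)
   + cc x * g (x - k) * (qf x * zeta x).
have [zeta2 zeta2le] := H1rep_diffq dl0 dl1 eps0 epsdl k0 kdl alpha02 hw.
have [g2 g2le] := H1rep_grad_sqr dl0 dl1 eps0 epsdl k0 kdl alpha02 hw.
have g2' : intg (Icc (dl - k) 1) (fun x => g x ^+ 2) by apply: intg_Icc_sub g2; lra.
have gs2 : intg (Icc dl 1) (fun x => g (x - k) ^+ 2) by exact: (intg_shift_sqr dl0 dl1 eps0 epsdl k0 kdl g2').
have p2 : intg (Icc (dl - k) 1) (fun x => p x ^+ 2).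
  by apply: intg_Icc_sub (inL2_sqr hp) => //; exact: ltW.
have z2 : intg (Icc dl 1) (fun x => z x ^+ 2).
  apply: intg_contI; under eq_fun do rewrite expr2.
  by apply: contIM; exact: prim_contI pz.
have iW : intg (Icc dl 1) W.
  by apply: intgD => //; exact: (intgD (measurable_Icc dl 1) z2 zeta2).
have iJ1 := intgN (measurable_Icc dl 1) (intgZ 2^-1 (measurable_Icc dl 1) i1).
have iJ2 := intgZ 2^-1 (measurable_Icc dl 1) i2.
have iJ : intg (Icc dl 1) J by apply: intgD => //; exact: (intgB (measurable_Icc dl 1) iJ1 iJ2).
have RJ : RI (Icc dl 1) J = - (2^-1 * RI (Icc dl 1) (fun x => qd x * z x ^+ 2)) -
  (2^-1 * RI (Icc dl 1) (fun x => Qd x * zeta x ^+ 2) -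
   RI (Icc dl 1) (fun x => cc x * g (x - k) * (qf x * zeta x))).
  rewrite RID //; last exact: (intgB (measurable_Icc dl 1) iJ1 iJ2).
  rewrite RIB // RIN ?RIZ //; last exact: intgZ.
  by ring.
rewrite -RJ.
pose s x := (x - dl) * eps / (1 - x + eps) ^+ 2.
have low x : dl <= x <= 1 -> 2^-1 * (s x * x `^ alpha) * zeta x ^+ 2 <= J x + C1 * W x.
  move=> xI; have /andP[dx x1] := xI; have x01 : 0 < x <= 1 by rewrite (lt_le_trans d0 dx).
  have dn : 0 < 1 - x + eps by lra.
  have [b1 /andP[b2 b2']] := powR_bounds x01.
  apply: pointwise_arith => //.
  - rewrite b2 /=; apply: (le_trans b2'); rewrite ler_pM2l // lef_pV2 ?posrE //.
    exact: lt_le_trans dx.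
  - exact: qf_bound.
  - by rewrite divr_ge0 ?subr_ge0 ?(ltW dn) //= ler_pdivrMr // mul1r; lra.
  - by rewrite /s !mulr_ge0 ?subr_ge0 ?invr_ge0 ?sqr_ge0 // ltW.
  - exact: diffq_powR.
have s0 x : dl <= x <= 1 -> 0 <= s x.
  by move=> /andP[dx x1]; rewrite /s !mulr_ge0 ?subr_ge0 ?invr_ge0 ?sqr_ge0 // ltW.
(* Nonnegativity lets the integral over [[dl, 1]] dominate the one over the layer. *)
have nn x : dl <= x <= 1 -> 0 <= J x + C1 * W x.
  move=> xI; apply: le_trans (low x xI).
  apply: mulr_ge0; last exact: sqr_ge0.
  by apply: mulr_ge0; rewrite ?invr_ge0 //; apply: mulr_ge0; [exact: s0|exact: powR_ge0].
have iCW := intgZ C1 (measurable_Icc dl 1) iW.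
have iT := intgD (measurable_Icc dl 1) iJ iCW.
have de : dl <= 1 - eps by lra.
have ze : intg (Icc (1 - eps) 1) (fun x => zeta x ^+ 2) by apply: intg_Icc_sub zeta2.
have step1 : dl ^+ 3 / (8 * eps) * RI (Icc (1 - eps) 1) (fun x => zeta x ^+ 2) <=
   RI (Icc dl 1) (fun x => J x + C1 * W x).
  apply: (@le_trans _ _ (RI (Icc (1 - eps) 1) (fun x => J x + C1 * W x))); last first.
    by apply: RI_sub_le => //; lra.
  rewrite -RIZ //; apply: RI_le => //; [exact: intgZ|by apply: intg_Icc_sub iT|].
  move=> x /IccP /andP[ex x1]; have xI : dl <= x <= 1 by rewrite (le_trans de).
  apply: le_trans (low x xI); rewrite ler_wpM2r ?sqr_ge0 //.
  have dn : 0 < 1 - x + eps by lra.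
  (* On the layer [x - dl >= dl] and [1 - x + eps <= 2 * eps]. *)
  have sl : dl / (4 * eps) <= s x.
    rewrite /s ler_pdivlMr ?exprn_gt0 // mulrAC ler_pdivrMr; last by lra.
    have q1 : (1 - x + eps) ^+ 2 <= 4 * eps * eps.
      rewrite expr2; have : (1 - x + eps) * (1 - x + eps) <= (2 * eps) * (2 * eps).
        by apply: ler_pM; lra.
      lra.
    have q2 : dl * (1 - x + eps) ^+ 2 <= dl * (4 * eps * eps) by rewrite ler_wpM2l // ltW.
    apply: (le_trans q2).
    have q3 : dl * eps <= (x - dl) * eps by rewrite ler_wpM2r ?(ltW e0) //; lra.
    have q4 : dl * eps * (4 * eps) <= (x - dl) * eps * (4 * eps).
      by rewrite ler_wpM2r // mulr_ge0 // ltW.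
    by apply: le_trans q4; rewrite le_eqVlt; apply/orP; left; apply/eqP; ring.
  have Xl : dl ^+ 2 <= x `^ alpha.
    have x01 : 0 < x <= 1 by lra.
    apply: le_trans (powR_ge_sqr alpha02 x01).
    by rewrite ler_pXn2r ?nnegrE //; lra.
  have -> : dl ^+ 3 / (8 * eps) = 2^-1 * (dl / (4 * eps) * dl ^+ 2).
    by field; rewrite gt_eqF.
  rewrite ler_wpM2l ?invr_ge0 //; apply: ler_pM => //; last exact: sqr_ge0.
  by rewrite divr_ge0 ?mulr_ge0 // ltW.
apply: (le_trans step1); rewrite RID // RIZ // lerD2l -mulrA ler_wpM2l //.
rewrite RID //; last exact: (intgD (measurable_Icc dl 1) z2 zeta2).
rewrite RID //.
have h1 : RI (Icc dl 1) (fun x => z x ^+ 2) <= sqL2 p.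
  rewrite sqL2_Icc //; apply: (@le_trans _ _ (RI (Icc (dl - k) 1) (fun x => p x ^+ 2))).
    apply: RI_diffq_sqr => //.
    by apply: prim_sub pP => //; exact: ltW.
  by apply: RI_sub_le (inL2_sqr hp) _ => //; [exact: ltW|move=> x _; exact: sqr_ge0].
have h2 : RI (Icc dl 1) (fun x => g (x - k) ^+ 2) <= RI (Icc (dl / 2) 1) (fun x => g x ^+ 2).
  rewrite (@RI_shift R (- k) dl 1 (fun x => g x ^+ 2)); last by apply: intg_Icc_sub g2; lra.
  by apply: RI_sub_le g2 _ => //; [lra|lra|lra|move=> x _; exact: sqr_ge0].
have wg0 : 0 <= sqL2 (wgt alpha g) by apply: RI_ge0 => x _; exact: sqr_ge0.
have p0 : 0 <= sqL2 p by apply: RI_ge0 => x _; exact: sqr_ge0.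
have c8 : 8 / dl ^+ 2 = 2 * (4 / dl ^+ 2) by field; rewrite gt_eqF.
have c4 : 0 <= 4 / dl ^+ 2 by rewrite divr_ge0 ?sqr_ge0.
rewrite c8; move: (4 / dl ^+ 2) g2le c4 => c4' g2le c4.
have := mulr_ge0 c4 p0; lra.
Qed.

(** Compare [w] with its backward average [Av]: the integral of [zeta] over [[x, 1]] telescopes to
    [Av 1 - Av x], and [w] differs from [Av] by at most the root of [k * H2], by Hoelder continuity
    of exponent 1/2. As [w 1 = 0], this bounds [w x]; integrating over the layer gives one more
    factor [eps]. *)
Lemma sqr_boundary_bound :
  intg (Icc (1 - eps) 1) (fun x => w x ^+ 2) /\
  RI (Icc (1 - eps) 1) (fun x => w x ^+ 2) <=
  2 * eps ^+ 2 * RI (Icc (1 - eps) 1) (fun x => zeta x ^+ 2)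
  + 8 * k * eps * RI (Icc (dl / 2) 1) (fun x => g x ^+ 2).
Proof.
have [d0 d1 e0 ed [kk kd]] := facts.
have [g2 _] := H1rep_grad_sqr dl0 dl1 eps0 epsdl k0 kdl alpha02 hw.
set H2 := RI (Icc (dl / 2) 1) _; set Z := RI (Icc (1 - eps) 1) (fun x => zeta x ^+ 2).
have H20 : 0 <= H2 by apply: RI_ge0 => x _; exact: sqr_ge0.
have pwh : prim (dl / 2) 1 w g by apply: (H1rep_prim hw); lra.
have cw := prim_contI pwh.
have [zeta2 _] := H1rep_diffq dl0 dl1 eps0 epsdl k0 kdl alpha02 hw.
have [_ [_ [w1 _]]] := hw.
pose Av y := k^-1 * RI (Icc (y - k) y) w.
have av y : 1 - eps <= y <= 1 -> `|w y - Av y| <= Num.sqrt (k * H2).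
  move=> yI; have iwy : intg (Icc (y - k) y) w.
    by apply: intg_contI; apply: contI_sub cw; lra.
  have -> : w y - Av y = k^-1 * RI (Icc (y - k) y) (fun t => w y - w t).
    rewrite RIB //; [|exact: intg_cst]; rewrite RI_cst; last by lra.
    by rewrite /Av; field; rewrite gt_eqF.
  rewrite normrM ger0_norm ?invr_ge0 ?(ltW k0) // mulrC ler_pdivrMr //.
  rewrite [leRHS](_ : _ = Num.sqrt (k * H2) * (y - (y - k))); last by ring.
  apply: RI_norm_le; [lra|by apply: intgB => //; exact: intg_cst|].
  move=> t /andP[yt ty].
  rewrite -(@ler_pXn2r _ 2) ?nnegrE ?sqrtr_ge0 // real_normK ?num_real //.
  rewrite sqr_sqrtr ?mulr_ge0 ?(ltW k0) //.
  have := @prim_holder R (dl / 2) 1 w g t y pwh g2 ltac:(lra) ty ltac:(lra).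
  move/le_trans; apply; rewrite ler_wpM2r //; lra.
have pt x : 1 - eps <= x <= 1 -> w x ^+ 2 <= 2 * eps * Z + 8 * k * H2.
  move=> xI; have Z0 : 0 <= Z by apply: RI_ge0 => t _; exact: sqr_ge0.
  have [x1|x1] := leP 1 x.
    have -> : x = 1 by lra.
    by rewrite w1 expr0n addr_ge0 // !mulr_ge0 // ltW.
  have iz2 : intg (Icc x 1) (fun t => zeta t ^+ 2) by apply: intg_Icc_sub zeta2; lra.
  have iz : intg (Icc x 1) zeta.
    by apply: intg_contI; apply: contI_sub (prim_contI pzeta); lra.
  have tel : RI (Icc x 1) zeta = Av 1 - Av x.
    rewrite /Av -mulrBr -RI_telescope; [|exact: ltW|lra|]; last first.
      by apply: intg_contI; apply: contI_sub cw; lra.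
    rewrite -RIZ //; first by apply: RI_eq => t _; rewrite /zeta /diffq mulrC.
    apply: (intg_eq (f := fun t => k * zeta t)) => //; last exact: intgZ.
    by move=> t _; rewrite /zeta /diffq mulrCA mulfV ?mulr1 // gt_eqF.
  have jz : RI (Icc x 1) zeta ^+ 2 <= eps * Z.
    apply: (le_trans (jensen_sqr x1 iz iz2)); apply: ler_pM; rewrite ?subr_ge0 ?(ltW x1) //.
    - by apply: RI_ge0 => t _; exact: sqr_ge0.
    - by lra.
    apply: RI_sub_le => //; [lra|lra|by apply: intg_Icc_sub zeta2; lra|].
    by move=> t _; exact: sqr_ge0.
  have a1 := av x xI; have a2 := av 1 ltac:(lra).
  set S := Num.sqrt (k * H2) in a1 a2.
  have S2 : S ^+ 2 = k * H2 by rewrite sqr_sqrtr // mulr_ge0 // ltW.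
  have S0 : 0 <= S by exact: sqrtr_ge0.
  pose e := (w x - Av x) - (w 1 - Av 1).
  have eS : `|e| <= 2 * S.
    by apply: (le_trans (ler_normB _ _)); lra.
  have e2 : e ^+ 2 <= 4 * (k * H2).
    rewrite -S2 -(real_normK (num_real e)) (_ : 4 * S ^+ 2 = (2 * S) ^+ 2); last by ring.
    by rewrite ler_pXn2r ?nnegrE ?mulr_ge0.
  have -> : w x = e + - RI (Icc x 1) zeta by rewrite tel /e w1; ring.
  apply: (le_trans (sqr_addr_le _ _)); rewrite sqrrN.
  lra.
have iw2 : intg (Icc (1 - eps) 1) (fun x => w x ^+ 2).
  have cw' : contI (1 - eps) 1 w by apply: contI_sub cw; lra.
  by apply: intg_contI; under eq_fun do rewrite expr2; exact: contIM.
split=> //; apply: (@le_trans _ _ (RI (Icc (1 - eps) 1) (fun=> 2 * eps * Z + 8 * k * H2))).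
  by apply: RI_le => //; try exact: intg_cst; move=> x /IccP; exact: pt.
rewrite RI_cst; last by lra.
by rewrite le_eqVlt; apply/orP; left; apply/eqP; ring.
Qed.

End Identity.
End MultiplierIdentity.

(** * Lipschitz maps and an orthogonality limit *)

Section HilbertMaps.
Context {R : realType} (H : lmodType R) (ip : H -> H -> R).
Hypothesis sip : semi_inner ip.
Implicit Types (a b C : R) (c d : R -> H).

Lemma contH_lip a b c d C : 0 <= C -> contH ip a b c ->
  (forall x y, a <= x <= b -> a <= y <= b -> nrm ip (d y - d x) <= C * nrm ip (c y - c x)) ->
  contH ip a b d.
Proof.
move=> C0 cc hd x xab e e0; have C1 : 0 < C + 1 by lra.
have [k k0 hk] := cc x xab _ (divr_gt0 e0 C1); exists k => // y yab yx.
have := hk y yab yx; rewrite ltr_pdivlMr //; have := hd x y xab yab.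
have := nrm_ge0 ip (c y - c x); nra.
Qed.

Lemma rderivH_lip a b c c' (A : H -> H) C : 0 <= C -> rderivH ip a b c c' ->
  (forall v w, A (v - w) = A v - A w) -> (forall r v, A (r *: v) = r *: A v) ->
  (forall v, nrm ip (A v) <= C * nrm ip v) ->
  rderivH ip a b (fun t => A (c t)) (fun t => A (c' t)).
Proof.
move=> C0 cc AB AZ hA x xab e e0; have C1 : 0 < C + 1 by lra.
have [k k0 hk] := cc x xab _ (divr_gt0 e0 C1); exists k => // h hh xh.
rewrite -AB -AZ -AB; apply: (le_trans (hA _)); have := hk h hh xh.
have /andP[h0 _] := hh; rewrite mulrAC ler_pdivlMr //.
have := nrm_ge0 ip (c (x + h) - c x - h *: c' x); nra.
Qed.

(** The vectors orthogonal to [x] have the form [h u + o(h)]; dividing by [h] leaves [u]. *)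
Lemma ip_limit_eq0 (x u : H) : (forall e : R, 0 < e -> exists h v, [/\ 0 < h, ip x v = 0 &
  nrm ip (v - h *: u) <= e * h]) -> ip x u = 0.
Proof.
move=> hx; apply/eqP; rewrite -normr_le0; apply/ler_addgt0Pr => e e0; rewrite add0r.
have n0 := nrm_ge0 ip x; have n1 : 0 < nrm ip x + 1 by rewrite ltr_wpDl.
have [h [v [h0 xv vu]]] := hx _ (divr_gt0 e0 n1).
rewrite -(ler_pM2l h0).
have -> : h * `|ip x u| = `|ip x (v - h *: u)|.
  by rewrite (ipBr sip) xv sub0r normrN (ipZr sip) normrM gtr0_norm.
apply: (le_trans (cauchy_schwarz sip _ _)); apply: (le_trans (ler_wpM2l n0 vu)).
rewrite mulrA [leRHS]mulrC ler_wpM2r ?(ltW h0) // mulrCA ler_piMr ?(ltW e0) //.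
by rewrite ler_pdivrMr // mul1r lerDl.
Qed.

Lemma nrm_le_of_ipBl_eq0 (u v : H) : ip (u - v) u = 0 -> nrm ip u ^+ 2 <= nrm ip v ^+ 2.
Proof.
rewrite (ipBl sip) => /eqP; rewrite subr_eq0 => /eqP e.
have : nrm ip u ^+ 2 <= nrm ip v * nrm ip u.
  by rewrite (nrm2 sip) e; exact: le_trans (ler_norm _) (cauchy_schwarz sip _ _).
have := nrm_ge0 ip u; rewrite le_eqVlt => /orP[/eqP <- _|p]; first by rewrite expr0n sqr_ge0.
by rewrite {1}expr2 ler_pM2r // => uv; rewrite ler_pXn2r // nnegrE nrm_ge0.
Qed.

End HilbertMaps.

(** * The multiplier as a bounded operator on L^2 *)

Section Operators.
Context {R : realType}.
Local Notation mu := (@lebesgue_measure R).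
Implicit Types (f g h w : R -> R) (a b c d x y r : R).
Hint Resolve mI01 measurable_Icc : core.

Lemma nrm2_mkL2 f : inL2 f -> nrm (@ip2 R) (mkL2 f) ^+ 2 = sqL2 f.
Proof.
move=> hf; by rewrite (nrm2 (@semi_inner_ip2 R)) ip2E.
Qed.

Lemma mkL2_coe (v : L2T) : mkL2 (v : R -> R) = v.
Proof. by apply: val_inj; exact: mkL2K (L2T_inL2 v). Qed.

Lemma nrm_le_sqL2 f (C : R) : inL2 f -> 0 <= C -> sqL2 f <= C ^+ 2 -> nrm (@ip2 R) (mkL2 f) <= C.
Proof.
by move=> hf C0 h; rewrite -(@ler_pXn2r _ 2) ?nnegrE ?nrm_ge0 // nrm2_mkL2.
Qed.

Section Mult.
Variables (dl eps k : R).
Hypotheses (dl0 : 0 < dl) (dl1 : dl < 1 / 2) (eps0 : 0 < eps) (epsdl : eps <= 1 - 2 * dl).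
Hypotheses (k0 : 0 < k) (kdl : k <= dl / 2).

Let sub1 h : intg (Icc 0 1) h -> intg (Icc (dl - k) 1) h.
Proof.
by move: (dl0) (kdl) => d0 kd hh; apply: intg_Icc_sub hh => //; lra.
Qed.

Lemma diffqB f g x : diffq k (fun x => f x - g x) x = diffq k f x - diffq k g x.
Proof. by rewrite /diffq; ring. Qed.

Lemma qzB f g x : qz dl eps k (fun x => f x - g x) x = qz dl eps k f x - qz dl eps k g x.
Proof. by rewrite /qz; case: ifP => _; rewrite ?subrr // diffqB mulrBr. Qed.

Lemma qzZ r f x : qz dl eps k (fun x => r * f x) x = r * qz dl eps k f x.
Proof. by rewrite /qz /diffq; case: ifP => _; rewrite ?mulr0 // -mulrBr; ring. Qed.

Lemma multB f g y : intg (Icc (dl - k) 1) f -> intg (Icc (dl - k) 1) g ->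
  mult dl eps k (fun x => f x - g x) y = mult dl eps k f y - mult dl eps k g y.
Proof.
move=> hf hg; rewrite /mult -mulrBr; congr (_ * _).
rewrite -RIB //; try exact: intg_qz.
by apply: RI_eq => x _; exact: qzB.
Qed.

Lemma multZ r f y : intg (Icc (dl - k) 1) f ->
  mult dl eps k (fun x => r * f x) y = r * mult dl eps k f y.
Proof.
move=> hf; rewrite /mult mulrCA; congr (_ * _).
rewrite -RIZ //; last exact: intg_qz.
by apply: RI_eq => x _; exact: qzZ.
Qed.

Lemma mult'B f g y :
  mult' dl eps k (fun x => f x - g x) y = mult' dl eps k f y - mult' dl eps k g y.
Proof. by rewrite /mult' !qzB; ring. Qed.

Definition Mop (v : L2T) : L2T := mkL2 (mult dl eps k v).

Let iv (v : @L2T R) : intg (Icc (dl - k) 1) v.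
Proof. exact: sub1 (inL2_intg (L2T_inL2 v)). Qed.

Lemma MopB (v w : @L2T R) : Mop (v - w) = Mop v - Mop w.
Proof.
rewrite /Mop -mkL2B; try exact: mult_inL2.
by congr mkL2; apply/funext => x; rewrite -(multB _ (iv v) (iv w)).
Qed.

Lemma MopZ r (v : @L2T R) : Mop (r *: v) = r *: Mop v.
Proof.
rewrite /Mop -mkL2Z; last exact: mult_inL2.
by congr mkL2; apply/funext => x; rewrite -(multZ r _ (iv v)).
Qed.

Lemma nrm_Mop (v : @L2T R) : nrm (@ip2 R) (Mop v) <= 2 / k * nrm (@ip2 R) v.
Proof.
have n0 := nrm_ge0 (@ip2 R) v.
apply: nrm_le_sqL2; first exact: mult_inL2.
  by rewrite mulr_ge0 // divr_ge0 // ltW.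
rewrite exprMn -{2}(mkL2_coe v) nrm2_mkL2; last exact: L2T_inL2.
have -> : (2 / k) ^+ 2 = 4 / k ^+ 2 by rewrite expr_div_n; congr (_ / _); ring.
exact: (mult_sqL2_le_L2 dl0 dl1 eps0 epsdl k0 kdl (L2T_inL2 v)).
Qed.

End Mult.

(** Cutting contracts L^2 and turns an integral over [[a, 1]] into a squared norm, which is
    continuous along continuous curves. *)
Definition cut_from a f : R -> R := fun x => if a <= x then f x else 0.

Lemma inL2_cut a f : inL2 f -> inL2 (cut_from a f) /\ sqL2 (cut_from a f) <= sqL2 f.
Proof.
move=> /inL2P[mf f2].
have le x : cut_from a f x ^+ 2 <= f x ^+ 2.
  by rewrite /cut_from; case: ifP => _ //; rewrite expr0n sqr_ge0.
have mc : measurable_fun I01 (cut_from a f).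
  have -> : cut_from a f = fun x => \1_(`[a, +oo[%classic : set R) x * f x.
    apply/funext => x; rewrite /cut_from indicE; case: ifPn => h.
      by rewrite mem_set ?mul1r //= in_itv /= h.
    by rewrite memNset ?mul0r //= in_itv /= andbT; exact/negP.
  by apply: measurable_funM => //; exact: measurable_indic.
have i : intg I01 (fun x => cut_from a f x ^+ 2).
  by apply: (sqr_intg_le _ _ (fun x _ => le x) f2).
by split; [apply/inL2P|exact: RI_le].
Qed.

Lemma sqL2_cut a f : 0 < a -> a <= 1 -> inL2 f ->
  sqL2 (cut_from a f) = RI (Icc a 1) (fun x => f x ^+ 2).
Proof.
move=> a0 a1 hf; have [hc _] := inL2_cut a hf; rewrite sqL2_Icc //.
have i := inL2_sqr hc.
rewrite (RI_chasles (ltW a0) a1 i) RI_zero_oo ?add0r.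
- by apply: RI_eq => x /IccP /andP[ax _]; rewrite /cut_from ax.
- by apply: intg_Icc_sub i.
- by move=> x /andP[_ xa]; rewrite /cut_from leNgt xa expr0n.
Qed.

End Operators.

(** * Continuous representatives *)

Section Representatives.
Context {R : realType}.
Local Notation mu := (@lebesgue_measure R).
Implicit Types (f g h w : R -> R) (a b c d x y r alpha : R).
Hint Resolve mI01 measurable_Icc : core.

Lemma H1rep_measurable alpha w g : H1rep alpha w g -> measurable_fun I01 w.
Proof.
move=> hw; suff cw : {within I01, continuous w}.
  exact: (subspace_continuous_measurable_fun mI01 cw).
apply/subspace_continuousP => x /I01P /andP[x0 x1]; apply: cvg_within_filter.
apply/cvgrPdist_lt => e e0.
have x20 : 0 < x / 2 by lra.
have x21 : x / 2 <= 1 by lra.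
have [|d d0 hd] := prim_contI (H1rep_prim hw x20 x21) (x := x) _ e0; first by lra.
exists (Num.min d (Num.min (x / 2) (1 - x))) => /=; first by rewrite !lt_min d0; lra.
move=> y /=; rewrite !lt_min => /and3P[y1 y2 y3]; rewrite distrC; apply: hd; last by rewrite distrC.
move: y2 y3; rewrite !ltr_norml; lra.
Qed.

Lemma ae_sqL2_inL2 f g : inL2 f -> measurable_fun I01 g ->
  {ae mu, forall x, 0 < x < 1 -> f x = g x} -> inL2 g.
Proof.
move=> [mf if2] mg fg; split=> //.
rewrite (@ge0_ae_eq_integral _ _ R mu _ _ (fun x => (f x ^+ 2)%:E)) //.
- by apply/measurable_EFinP; exact: measurable_funX.
- by apply/measurable_EFinP; exact: measurable_funX.
- by move=> x _; rewrite lee_fin sqr_ge0.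
- by move=> x _; rewrite lee_fin sqr_ge0.
- by apply: (@filterS _ _ (ae_filter_ringOfSetsType mu)) fg => x h /I01P xI; rewrite h.
Qed.

(** An interval [[x, b]] of positive length cannot lie in the exceptional null set, so points of
    agreement come arbitrarily close to [x], and continuity concludes. *)
Lemma H1rep_eq_oo alpha w g w' g' : H1rep alpha w g -> H1rep alpha w' g' ->
  {ae mu, forall x, 0 < x < 1 -> w x = w' x} -> forall x, 0 < x < 1 -> w x = w' x.
Proof.
move=> hw hw' [N [mN N0 hN]] x /andP[x0 x1]; apply/eqP; rewrite -subr_eq0; apply/eqP.
apply/eqP; rewrite -normr_le0; apply/ler_addgt0Pr => e e0; rewrite add0r.
have x20 : 0 < x / 2 by lra.
have x21 : x / 2 <= 1 by lra.
have c := contIB (prim_contI (H1rep_prim hw x20 x21)) (prim_contI (H1rep_prim hw' x20 x21)).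
have [|d d0 hd] := c x _ e e0; first by lra.
pose b := Num.min (x + d / 2) ((x + 1) / 2).
have xb : x < b by rewrite lt_min; lra.
have b1 : b <= (x + 1) / 2 by rewrite ge_min lexx orbT.
have bd : b <= x + d / 2 by rewrite ge_min lexx.
have [y [/IccP yI yN]] : exists y, Icc x b y /\ ~ N y.
  apply/not_existsP => h; have sub : Icc x b `<=` N.
    by move=> y yI; apply: contrapT => yN; exact: (h y).
  have : (mu (Icc x b) <= mu N)%E by apply: le_measure; rewrite ?inE //; exact: measurable_Icc.
  by rewrite N0 (lebesgue_Icc (ltW xb)) lee_fin leNgt subr_gt0 xb.
have wy : w y = w' y.
  apply: contrapT => ne; apply: yN; apply: hN => /= h; apply: ne; apply: h; lra.
have := hd y ltac:(lra); rewrite wy subrr sub0r normrN => h.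
by apply/ltW/h; rewrite ltr_norml; lra.
Qed.

(** Lebesgue differentiation: almost everywhere [h] is the derivative of its primitive, which is
    locally 0. *)
Lemma ae_zero_primitive a h : a < 1 -> intg (Icc a 1) h ->
  (forall x, a < x < 1 -> RI (Icc a x) h = 0) -> {ae mu, forall x, a < x < 1 -> h x = 0}.
Proof.
move=> a1 ih h0; pose hh := h \_ (Icc a 1).
have ihh : mu.-integrable setT (EFin \o hh).
  have := (@integrable_mkcond _ (measurableTypeR R) R mu (Icc a 1) (EFin \o h) (measurable_Icc a 1)).1 ih.
  by rewrite -restrict_EFin.
have := @FTC1 R hh (BLeft a).
move=> /(_ _ (integrable_locally (measurable_Icc a 1) ih)) H.
have {H} H := H (fun y => intg_sub measurableT (measurable_Icc a y) (@subsetT _ _) ihh).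
apply: (@filterS _ _ (ae_filter_ringOfSetsType mu)) H => x H /andP[ax x1].
have [|_] := H; first by rewrite /= lte_fin.
rewrite /hh patchE mem_set; last by apply/IccP; rewrite !ltW.
move=> <-; pose F y := RI (Icc a y) (h \_ (Icc a 1)).
have F0 y : a < y < 1 -> F y = 0.
  move=> /[dup] yI /andP[ay y1]; rewrite -(h0 y yI); apply: RI_eq => z /IccP /andP[az zy].
  by rewrite patchE mem_set //; apply/IccP; rewrite az (le_trans zy) ?ltW.
have d0 : 0 < Num.min (x - a) (1 - x) by rewrite lt_min; lra.
apply/cvg_lim => //; apply: cvg_near_cst; exists (Num.min (x - a) (1 - x)) => //= y.
rewrite /ball_ /= sub0r normrN lt_min !ltr_norml => /andP[y1 y2] _.
transitivity (y^-1 *: (F (y + x) - F x)); first by [].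
rewrite !F0 ?subrr ?scaler0 //; first by lra.
by move: y1 y2 => /andP[? ?] /andP[? ?]; lra.
Qed.

End Representatives.

(** * The boundary layer *)

Section Boundary.
Context {R : realType}.
Local Notation mu := (@lebesgue_measure R).
Local Notation ip2 := (@ip2 R).
Hint Resolve mI01 measurable_Icc : core.
Implicit Types (a b t s : R).

Lemma H1repB alpha (v g w h : R -> R) : H1rep alpha v g -> H1rep alpha w h ->
  H1rep alpha (fun x => v x - w x) (fun x => g x - h x).
Proof.
move=> hv /(H1repZ (-1)) hw; have := H1repD hv hw.
by congr H1rep; apply/funext => x; rewrite mulN1r.
Qed.

Lemma wgtB alpha (g h : R -> R) :
  wgt alpha (fun x => g x - h x) = fun x => wgt alpha g x - wgt alpha h x.
Proof. by apply/funext => x; rewrite /wgt mulrBr. Qed.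

(** A relation rather than a function of [V], since the gradient accompanies [v] as a separate
    datum. *)
Definition inV alpha (V G : @L2T R) : Prop :=
  exists v g, [/\ H1a alpha v g, V = mkL2 v & G = mkL2 (wgt alpha g)].

Lemma inVB alpha V G V' G' : inV alpha V G -> inV alpha V' G' -> inV alpha (V - V') (G - G').
Proof.
move=> [v [g [hv -> ->]]] [w [h [hw -> ->]]].
exists (fun x => v x - w x), (fun x => g x - h x); split; first exact: H1aB.
  by rewrite mkL2B //; [exact: H1a_inL2 hv|exact: H1a_inL2 hw].
by rewrite wgtB mkL2B //; [exact: H1a_wgt hv|exact: H1a_wgt hw].
Qed.

Lemma inVN alpha V G : inV alpha V G -> inV alpha (- V) (- G).
Proof.
move=> [v [g [hv -> ->]]].
exists (fun x => - 1 * v x), (fun x => - 1 * g x); split; first exact: H1aZ.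
  by rewrite mkL2Z ?scaleN1r //; exact: H1a_inL2 hv.
by rewrite wgtZ mkL2Z ?scaleN1r //; exact: H1a_wgt hv.
Qed.

(** Carries to the final time a bound obtained from the increments, which stop before [T]. *)
Lemma contI_le_end a b (F : R -> R) (C : R) : a < b -> contI a b F ->
  (forall t, a <= t < b -> F t <= C) -> F b <= C.
Proof.
move=> ab cF hF; apply/ler_addgt0Pr => e e0.
have [|d d0 hd] := cF b _ e e0; first by rewrite lexx ltW.
pose t := Num.max a (b - d / 2).
have at_ : a <= t by rewrite le_max lexx.
have tb : t < b by rewrite gt_max ab /=; lra.
have td : b - d / 2 <= t by rewrite le_max lexx orbT.
have := hd t; rewrite at_ (ltW tb) => /(_ isT).
have -> : `|t - b| < d by rewrite ltr_norml; lra.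
move=> /(_ isT); rewrite ltr_norml; have := hF t; rewrite at_ tb => /(_ isT); lra.
Qed.

Lemma increment_le (x y I K S F : R) : - x - - y <= - I + K * F ->
  `|x| <= S * K -> `|y| <= S * K -> F <= S -> 0 <= K -> I <= 3 * (S * K).
Proof.
rewrite !ler_norml => h /andP[x1 x2] /andP[y1 y2] FS K0.
have := ler_wpM2l K0 FS; rewrite [K * S]mulrC; lra.
Qed.

Variables (T alpha dl eps : R) (Fp : R -> R) (w ux ut : R -> R -> R) (D : R).
Hypotheses (T0 : 0 < T) (alpha02 : 0 < alpha < 2).
Hypotheses (dl0 : 0 < dl) (dl1 : dl < 1 / 2) (eps0 : 0 < eps) (epsdl : eps <= 1 - 2 * dl).
Hypothesis hrep : forall t, 0 <= t <= T -> H1rep alpha (w t) (ux t).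
Hypothesis iw : forall t, 0 <= t <= T -> inL2 (w t).
Hypothesis iut : forall t, 0 <= t <= T -> inL2 (ut t).
Hypothesis cW : contH ip2 0 T (fun t => mkL2 (w t)).
Hypothesis cUT : contH ip2 0 T (fun t => mkL2 (ut t)).
Hypothesis cDU : contH ip2 0 T (fun t => mkL2 (wgt alpha (ux t))).
Hypothesis rW : rderivH ip2 0 T (fun t => mkL2 (w t)) (fun t => mkL2 (ut t)).
Hypothesis cFp : contI 0 T Fp.
Hypothesis Fp_nd : forall s t, 0 <= s -> s <= t -> t <= T -> Fp s <= Fp t.
Hypothesis weq : forall v gv, inV alpha v gv -> forall s t, 0 <= s -> s <= t -> t < T ->
  `|ip2 (mkL2 (ut t) - mkL2 (ut s)) v + RI (Icc s t) (fun r => ip2 (mkL2 (wgt alpha (ux r))) gv)|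
    <= nrm ip2 v * (Fp t - Fp s).
Hypothesis D0 : 0 <= D.
Hypothesis hD : forall t, 0 <= t <= T -> sqL2 (ut t) + sqL2 (wgt alpha (ux t)) <= 4 * D.
Hypothesis hF : (Fp T - Fp 0) ^+ 2 <= D.

Let sip := @semi_inner_ip2 R.
Let k := eps ^+ 2 * dl / 2.
Let eps1 : eps < 1. Proof. by move: (dl0) (epsdl); lra. Qed.
Let k0 : 0 < k. Proof. by rewrite /k divr_gt0 // mulr_gt0 // exprn_gt0. Qed.
Let kdl : k <= dl / 2.
Proof.
have d0 := ltW dl0; rewrite /k ler_pM2r // -[leRHS]mul1r ler_wpM2r //.
by rewrite expr2 -[leRHS]mul1r; apply: ler_pM; rewrite ?(ltW eps0) ?(ltW eps1).
Qed.

Local Notation mult := (mult dl eps k).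
Local Notation mult' := (mult' dl eps k).
Local Notation Mop := (Mop dl eps k).
Let W t := mkL2 (w t).
Let UT t := mkL2 (ut t).
Let DU t := mkL2 (wgt alpha (ux t)).
Let DM t := mkL2 (wgt alpha (mult' (w t))).

Let iDU t : 0 <= t <= T -> inL2 (wgt alpha (ux t)).
Proof. by move=> /hrep[mg [ig _]]; exact/(wint_inL2 alpha mg). Qed.

Let iDM t : 0 <= t <= T -> inL2 (wgt alpha (mult' (w t))).
Proof. by move=> /hrep h; exact: H1a_wgt (mult_H1a dl0 dl1 eps0 epsdl k0 kdl alpha02 h). Qed.

Let MopW t : 0 <= t <= T -> Mop (W t) = mkL2 (mult (w t)).
Proof. by move=> tI; rewrite /Mop /W mkL2K //; exact: iw. Qed.

Let MopUT t : 0 <= t <= T -> Mop (UT t) = mkL2 (mult (ut t)).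
Proof. by move=> tI; rewrite /Mop /UT mkL2K //; exact: iut. Qed.

Let c2k : 0 <= 2 / k. Proof. by rewrite divr_ge0 // ltW // k0. Qed.

Let nrm_MopB (v v' : @L2T R) : nrm ip2 (Mop v - Mop v') <= 2 / k * nrm ip2 (v - v').
Proof.
rewrite -(MopB dl0 eps0 k0 kdl).
exact: (nrm_Mop dl0 dl1 eps0 epsdl k0 kdl).
Qed.

Let cMW : contH ip2 0 T (fun t => Mop (W t)).
Proof. by apply: (contH_lip c2k cW) => x y _ _; exact: nrm_MopB. Qed.

Let cMUT : contH ip2 0 T (fun t => Mop (UT t)).
Proof. by apply: (contH_lip c2k cUT) => x y _ _; exact: nrm_MopB. Qed.

Let cDM : contH ip2 0 T DM.
Proof.
have C0 : 0 <= 2 / k * (2 / dl) by rewrite mulr_ge0 ?c2k // divr_ge0 // ltW.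
apply: (contH_lip C0 cDU) => x y xI yI.
have hB := H1repB (hrep yI) (hrep xI).
have iB : inL2 (wgt alpha (fun z => ux y z - ux x z)).
  by rewrite wgtB; apply: inL2B; exact: iDU.
have e1 : DM y - DM x = mkL2 (wgt alpha (mult' (fun z => w y z - w x z))).
  rewrite /DM -mkL2B; [|exact: iDM|exact: iDM]; rewrite -wgtB; congr (mkL2 (wgt _ _)); apply/funext => z.
  by rewrite mult'B.
have e2 : mkL2 (wgt alpha (ux y)) - mkL2 (wgt alpha (ux x)) =
    mkL2 (wgt alpha (fun z => ux y z - ux x z)).
  by rewrite wgtB mkL2B //; exact: iDU.
rewrite e1 e2; apply: nrm_le_sqL2.
- exact: H1a_wgt (mult_H1a dl0 dl1 eps0 epsdl k0 kdl alpha02 hB).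
- by rewrite mulr_ge0 ?nrm_ge0.
rewrite exprMn nrm2_mkL2 //.
apply: le_trans (mult'_sqL2_le dl0 dl1 eps0 epsdl k0 kdl alpha02 hB) _.
rewrite le_eqVlt; apply/orP; left; apply/eqP; rewrite mulrA; congr (_ * _).
have e (c d : R) : 4 / c ^+ 2 * (4 / d ^+ 2) = (2 / c * (2 / d)) ^+ 2 by rewrite -!exprVn; ring.
exact: e.
Qed.

(** Apart from the source, the time derivative of the pairing of [UT t] with [Mop (W t)]. *)
Let Y t := ip2 (UT t) (Mop (UT t)) - ip2 (DU t) (DM t).

Let cY : contI 0 T Y.
Proof. exact (contIB (contH_ip sip cUT cMUT) (contH_ip sip cDU cDM)). Qed.

Let S := Num.sqrt (4 * D).
Let S0 : 0 <= S. Proof. exact: sqrtr_ge0. Qed.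
Let S2 : S ^+ 2 = 4 * D. Proof. by rewrite sqr_sqrtr // mulr_ge0. Qed.

Let nUT t : 0 <= t <= T -> nrm ip2 (UT t) <= S.
Proof.
move=> tI; apply: nrm_le_sqL2 => //; first exact: iut.
by rewrite S2; have := hD tI; have := sqL2_ge0 (wgt alpha (ux t)); lra.
Qed.

Let sDU t : 0 <= t <= T -> sqL2 (wgt alpha (ux t)) <= 4 * D.
Proof. by move=> tI; have := hD tI; have := sqL2_ge0 (ut t); lra. Qed.

Let nMW t : 0 <= t <= T -> nrm ip2 (Mop (W t)) <= 2 / dl * S.
Proof.
move=> tI; rewrite MopW //; apply: nrm_le_sqL2.
- have d0 := dl0; have hk := kdl.
  apply: mult_inL2 => //; apply: intg_Icc_sub (inL2_intg (iw tI)) => //; lra.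
- by rewrite mulr_ge0 // divr_ge0 // ltW.
apply: le_trans (mult_sqL2_le dl0 dl1 eps0 epsdl k0 kdl alpha02 (hrep tI)) _.
rewrite exprMn S2 expr_div_n (_ : (2 : R) ^+ 2 = 4); last by ring.
by rewrite ler_wpM2l ?divr_ge0 ?sqr_ge0 // sDU.
Qed.

Let Fp_le b : 0 <= b < T -> Fp b - Fp 0 <= S.
Proof.
move=> /andP[b0 bT]; have h1 : Fp b <= Fp T by apply: Fp_nd => //; exact: ltW.
have h2 : Fp 0 <= Fp T by apply: Fp_nd => //; exact: ltW.
apply: (@le_trans _ _ (Fp T - Fp 0)); first by rewrite lerD2r.
rewrite -(@ler_pXn2r _ 2) ?nnegrE ?subr_ge0 // S2; have := D0; have := hF; lra.
Qed.

(** [pairing_increment] is one-sided, so it is applied to [- Mop (W t)] to bound the integral from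
    above. The two end pairings and the source cost [S * (2 / dl * S)] each, and
    [S ^+ 2 = 4 * D]. *)
Let RI_Y_lt b : 0 <= b < T -> RI (Icc 0 b) Y <= 24 / dl * D.
Proof.
move=> bT'; have FT := Fp_le bT'; have /andP[b0 bT] := bT'; have bI : 0 <= b <= T by rewrite b0 ltW.
have zI : 0 <= (0 : R) <= T by rewrite lexx ltW.
have sub c : contH ip2 0 T c -> contH ip2 0 b c by apply: contH_sub => //; exact: ltW.
have neg c : contH ip2 0 T c -> contH ip2 0 b (fun t => - c t).
  move=> /sub cc; apply: (contH_lip ler01 cc) => x y _ _.
  by rewrite mul1r -opprD nrmN.
have sI t : 0 <= t <= b -> 0 <= t <= T by move=> /andP[t0 tb]; rewrite t0 (le_trans tb) // ltW.
have vV t : 0 <= t <= b -> inV alpha (- Mop (W t)) (- DM t).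
  move=> /sI tI; apply: inVN; exists (mult (w t)), (mult' (w t)).
  exact: (And3 (mult_H1a dl0 dl1 eps0 epsdl k0 kdl alpha02 (hrep tI)) (MopW tI) erefl).
have rv : rderivH ip2 0 b (fun t => - Mop (W t)) (fun t => - Mop (UT t)).
  have rW' : rderivH ip2 0 b W UT by apply: rderivH_sub rW => //; exact: ltW.
  apply: (rderivH_lip (A := fun v => - Mop v) c2k rW').
  - by move=> v v'; rewrite (MopB dl0 eps0 k0 kdl) opprB opprK addrC.
  - by move=> r v; rewrite (MopZ dl0 eps0 k0 kdl) scalerN.
  - by move=> v; rewrite nrmN //; exact: (nrm_Mop dl0 dl1 eps0 epsdl k0 kdl).
have hK t : 0 <= t <= b -> nrm ip2 (- Mop (W t)) <= 2 / dl * S.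
  by move=> /sI tI; rewrite nrmN // nMW.
have := pairing_increment sip cUT cDU cFp Fp_nd weq (lexx 0) b0 bT vV (neg _ cMW) (neg _ cDM)
  (neg _ cMUT) rv hK.
rewrite !(ipNr sip) (@RI_eq _ _ _ (fun t => - Y t)); last first.
  by move=> t _; rewrite !(ipNr sip) opprK /Y opprB addrC.
have iY : intg (Icc 0 b) Y by apply: intg_contI; apply: contI_sub cY => //; exact: ltW.
rewrite RIN // => pI.
have bd t : 0 <= t <= T -> `|ip2 (UT t) (Mop (W t))| <= S * (2 / dl * S).
  move=> tI; apply: (le_trans (cauchy_schwarz sip _ _)).
  exact (ler_pM (nrm_ge0 _ _) (nrm_ge0 _ _) (nUT tI) (nMW tI)).
have d2 : 0 <= 2 / dl * S by rewrite mulr_ge0 // divr_ge0 // ltW.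
have e : 24 / dl * D = 3 * (S * (2 / dl * S)).
  have -> : S * (2 / dl * S) = 2 / dl * S ^+ 2 by ring.
  by rewrite S2; ring.
rewrite e; exact (increment_le pI (bd b bI) (bd 0 zI) FT d2).
Qed.

Let RI_Y : RI (Icc 0 T) Y <= 24 / dl * D.
Proof.
apply: (@contI_le_end 0 T (fun b => RI (Icc 0 b) Y)) => //.
exact: contI_RI (intg_contI cY).
Qed.

(** After removal of the factor [eps ^+ 3]: [16 / dl ^+ 3] is [2 eps^2] from [sqr_boundary_bound]
    times [8 eps / dl^3] from inverting [multiplier_bound]; the bracket bounds the integral in time
    of [Y] and of the energy terms; [64 / dl] is [8 k eps] times [4 / dl^2] times 4 at
    [k = eps^2 dl / 2]. *)
Definition boundary_cst : R := 16 / dl ^+ 3 *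
  (24 / dl + 4 * ((1 + 1 / dl + 8 / dl ^+ 2) * (8 / dl ^+ 2 + 1)) * T) + 64 / dl * T.

(** The bound at a fixed time contains [Y t], for which [RI_Y] controls only the integral in time;
    hence a majorant [B] that is affine in [Y]. *)
Lemma boundary_estimate : exists B : R -> R, [/\ contI 0 T B,
  forall t, 0 <= t <= T -> RI (Icc (1 - eps) 1) (fun x => w t x ^+ 2) <= B t &
  RI (Icc 0 T) B <= eps ^+ 3 * (boundary_cst * D)].
Proof.
pose C2 := (1 + 1 / dl + 8 / dl ^+ 2) * (8 / dl ^+ 2 + 1).
have dinv : 0 < dl^-1 by rewrite invr_gt0.
have C20 : 0 <= C2.
  have a1 : 0 <= 1 / dl by rewrite divr_ge0 // ltW.
  have a2 : 0 <= 8 / dl ^+ 2 by apply: divr_ge0; rewrite ?sqr_ge0.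
  rewrite /C2 mulr_ge0 //; lra.
pose B t := eps ^+ 3 * (16 / dl ^+ 3) * Y t +
  eps ^+ 3 * (16 / dl ^+ 3 * (4 * C2 * D) + 64 / dl * D).
have cB : contI 0 T B by apply: contID; [exact: contIZ|exact: contI_cst].
have e3 : 0 <= eps ^+ 3 by rewrite exprn_ge0 // ltW.
have d3 : 0 < dl ^+ 3 by rewrite exprn_gt0.
exists B; split=> //.
- move=> t tI; have iu := iut tI.
  have [_ h1] := sqr_boundary_bound dl0 dl1 eps0 epsdl k0 kdl alpha02 (hrep tI).
  have h2 := multiplier_bound dl0 dl1 eps0 epsdl k0 kdl alpha02 iu (hrep tI).
  have [_ h3] := H1rep_grad_sqr dl0 dl1 eps0 epsdl k0 kdl alpha02 (hrep tI).
  have im : inL2 (mult (ut t)).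
    have d0 := dl0; have hk := kdl.
    apply: mult_inL2 => //; apply: intg_Icc_sub (inL2_intg iu) => //; lra.
  have eY : Y t = RI I01 (fun x => ut t x * mult (ut t) x) -
      RI I01 (fun x => wgt alpha (ux t) x * wgt alpha (mult' (w t)) x).
    rewrite /Y MopUT // /UT /DU /DM !ip2E //; [exact: iDU|exact: iDM].
  rewrite -eY -/C2 in h2.
  move: h1 h2 h3; set Z := RI (Icc (1 - eps) 1) (fun x => diffq _ _ _ ^+ 2).
  set H2 := RI (Icc (dl / 2) 1) _ => h1 h2 h3.
  apply: (le_trans h1).
  have hC : C2 * (sqL2 (ut t) + sqL2 (wgt alpha (ux t))) <= C2 * (4 * D).
    by rewrite ler_wpM2l // hD.
  have zb : Z <= 8 * eps / dl ^+ 3 * (Y t + C2 * (4 * D)).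
    have p : 0 < 8 * eps / dl ^+ 3 by rewrite divr_gt0 // mulr_gt0.
    have := ler_wpM2l (ltW p) (le_trans h2 (lerD (lexx (Y t)) hC)).
    rewrite mulrA (_ : 8 * eps / dl ^+ 3 * (dl ^+ 3 / (8 * eps)) = 1) ?mul1r //.
    by field; rewrite !gt_eqF.
  have hb : H2 <= 4 / dl ^+ 2 * (4 * D).
    apply: (le_trans h3); rewrite ler_wpM2l ?sDU //.
    by apply: divr_ge0; rewrite ?sqr_ge0.
  have q1 : 2 * eps ^+ 2 * Z <= 2 * eps ^+ 2 * (8 * eps / dl ^+ 3 * (Y t + C2 * (4 * D))).
    by rewrite ler_wpM2l // mulr_ge0 // sqr_ge0.
  have q2 : 8 * k * eps * H2 <= 8 * k * eps * (4 / dl ^+ 2 * (4 * D)).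
    by rewrite ler_wpM2l // mulr_ge0 ?(ltW eps0) // mulr_ge0 // ltW // k0.
  apply: (le_trans (lerD q1 q2)); rewrite le_eqVlt; apply/orP; left; apply/eqP.
  by rewrite /B /k; field; rewrite gt_eqF.
have iY := intg_contI cY.
have eB : RI (Icc 0 T) B = eps ^+ 3 * (16 / dl ^+ 3) * RI (Icc 0 T) Y +
    eps ^+ 3 * (16 / dl ^+ 3 * (4 * C2 * D) + 64 / dl * D) * (T - 0).
  rewrite -(RI_cst _ (ltW T0)) -RIZ // -RID //; last exact: intg_cst.
  exact: intgZ.
have c1 : 0 <= eps ^+ 3 * (16 / dl ^+ 3) by rewrite mulr_ge0 // divr_ge0 // ltW.
rewrite eB; apply: (le_trans (lerD (ler_wpM2l c1 RI_Y) (lexx _))).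
rewrite le_eqVlt; apply/orP; left; apply/eqP.
by rewrite /boundary_cst -/C2; ring.
Qed.

End Boundary.

(** * From convergence of distances to curves in L^2 *)

Section Distances.
Context {R : realType}.
Local Notation mu := (@lebesgue_measure R).
Local Notation ip2 := (@ip2 R).
Hint Resolve mI01 measurable_Icc : core.
Implicit Types (T t s e : R) (v w g h : R -> R) (c : R -> R -> R).

Lemma cvg0_within (G : R -> R) (A : set R) t : G @ within A (nbhs t) --> (0 : R) ->
  forall e, 0 < e -> exists2 d, 0 < d & forall s, A s -> `|s - t| < d -> G s < e.
Proof.
move=> /cvgrPdist_lt h e e0; have [d /= d0 hd] := h e e0.
exists d => // s As sd; apply: le_lt_trans (ler_norm _) _.
by rewrite -normrN -sub0r; apply: hd => //=; rewrite distrC.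
Qed.

Lemma sqL2_ae v w : inL2 v -> inL2 w -> {ae mu, forall x, 0 < x < 1 -> v x = w x} ->
  sqL2 v = sqL2 w.
Proof.
move=> [mv _] [mw _] vw; apply: RI_ae_eq => //; try exact: measurable_funX.
by apply: (@filterS _ _ (ae_filter_ringOfSetsType mu)) vw => x h /I01P /h ->.
Qed.

Lemma nrm_mkL2B_lt v w e : inL2 v -> inL2 w -> 0 < e ->
  sqL2 (fun x => v x - w x) < e ^+ 2 -> nrm ip2 (mkL2 v - mkL2 w) < e.
Proof.
move=> hv hw e0 h; rewrite -mkL2B // -(@ltr_pXn2r _ 2) ?nnegrE ?nrm_ge0 ?(ltW e0) //.
by rewrite nrm2_mkL2 //; exact: inL2B.
Qed.

Lemma contH_mkL2 T c : (forall t, 0 <= t <= T -> inL2 (c t)) ->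
  (forall t, 0 <= t <= T -> forall e, 0 < e -> exists2 d, 0 < d &
     forall s, 0 <= s <= T -> `|s - t| < d -> sqL2 (fun x => c s x - c t x) < e) ->
  contH ip2 0 T (fun t => mkL2 (c t)).
Proof.
move=> ic hc t tI e e0; have [d d0 hd] := hc t tI _ (exprn_gt0 2 e0).
exists d => // s sI sd; apply: nrm_mkL2B_lt => //; [exact: ic|exact: ic|exact: hd].
Qed.

Lemma contI_sqL2_tail T a c : 0 < a -> a <= 1 -> (forall t, 0 <= t <= T -> inL2 (c t)) ->
  contH ip2 0 T (fun t => mkL2 (c t)) ->
  contI 0 T (fun t => RI (Icc a 1) (fun x => c t x ^+ 2)).
Proof.
move=> a0 a1 ic cc.
have ct : contH ip2 0 T (fun t => mkL2 (cut_from a (c t))).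
  apply: (contH_lip ler01 cc) => s t sI tI; rewrite mul1r.
  have is_ := ic s sI; have it := ic t tI; have ib := inL2B it is_.
  have -> : mkL2 (cut_from a (c t)) - mkL2 (cut_from a (c s)) =
      mkL2 (cut_from a (fun x => c t x - c s x)).
    rewrite -mkL2B; [|exact: (inL2_cut a it).1|exact: (inL2_cut a is_).1].
    by congr mkL2; apply/funext => x; rewrite /cut_from; case: ifP => _; rewrite ?subrr.
  apply: nrm_le_sqL2; [exact: (inL2_cut a ib).1|exact: nrm_ge0|].
  by rewrite -mkL2B // nrm2_mkL2 //; exact: (inL2_cut a ib).2.
apply: (contI_eq _ (contH_ip (@semi_inner_ip2 R) ct ct)) => t /ic it.
have ict := (inL2_cut a it).1.
by rewrite ip2E // -(sqL2_cut a0 a1 it).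
Qed.

(** In the strongly degenerate case a gradient is known to be integrable only away from 0, so the
    primitives are compared on [[a n, 1]] with [a n] tending to 0. *)
Lemma H1rep_unique_grad alpha v g w h : H1rep alpha v g -> H1rep alpha w h ->
  {ae mu, forall x, 0 < x < 1 -> v x = w x} -> {ae mu, forall x, 0 < x < 1 -> g x = h x}.
Proof.
move=> hv hw vw; have e := H1rep_eq_oo hv hw vw.
(* Starting at 1/2 keeps every [a n] below 1. *)
pose a (n : nat) : R := n.+2%:R^-1.
have a0 n : 0 < a n by rewrite invr_gt0 ltr0n.
have a1 n : a n < 1 by rewrite invf_lt1 ?ltr0n // ltr1n.
have ae n : {ae mu, forall x, a n < x < 1 -> g x - h x = 0}.
  have [ip hp] := primB (H1rep_prim hv (a0 n) (ltW (a1 n))) (H1rep_prim hw (a0 n) (ltW (a1 n))).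
  apply: ae_zero_primitive ip _ => // x /andP[ax x1].
  rewrite -(hp _ _ (lexx _) (ltW ax) (ltW x1)) !e ?subrr ?a0 ?a1 //.
  by rewrite x1 (lt_trans (a0 n)).
apply: (@filterS _ _ (ae_filter_ringOfSetsType mu)) (ae_foralln ae) => x hx /andP[x0 x1].
apply/eqP; rewrite -subr_eq0; apply/eqP.
have [n nx] : exists n, a n < x.
  have := archi_boundP (ltW (_ : 0 < x^-1)); rewrite invr_gt0 x0 => /(_ isT).
  set n := Num.bound _ => hn; exists n; rewrite /a invf_plt ?posrE ?ltr0n //.
  by apply: (lt_trans hn); rewrite ltr_nat ltnS leqnSn.
by apply: (hx n); rewrite nx.
Qed.

End Distances.

(** * The weak solution as a curve in L^2 *)

Section WeakSolution.
Context {R : realType}.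
Local Notation mu := (@lebesgue_measure R).
Local Notation ip2 := (@ip2 R).
Hint Resolve mI01 measurable_Icc : core.
Implicit Types (t s e : R).
Let sip := @semi_inner_ip2 R.

Variables (T alpha : R) (u0 g0 u1 : R -> R) (f u ux ut w : R -> R -> R).
Hypotheses (T0 : 0 < T) (hu0 : H1a alpha u0 g0) (hu1 : inL2 u1) (hf : inL1L2 T f).
Hypothesis hsol : weak_solution T alpha f u0 u1 u ux ut.
Hypothesis hw : forall t, 0 <= t <= T ->
  {ae mu, forall x, 0 < x < 1 -> u t x = w t x} /\ H1rep alpha (w t) (ux t).

Lemma weak_solution_rep t : 0 <= t <= T -> H1rep alpha (w t) (ux t).
Proof. by move=> /hw[]. Qed.

Let iu t : 0 <= t <= T -> inL2 (u t).
Proof. by have [_ [[h _] _]] := hsol; move=> /h[]. Qed.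

Lemma weak_solution_inL2_dt t : 0 <= t <= T -> inL2 (ut t).
Proof. by have [_ [[h _] _]] := hsol; move=> /h[]. Qed.
Let iut := weak_solution_inL2_dt.

Lemma weak_solution_inL2_rep t : 0 <= t <= T -> inL2 (w t).
Proof.
move=> tI; have [h1 h2] := hw tI.
exact: ae_sqL2_inL2 (iu tI) (H1rep_measurable h2) h1.
Qed.
Let iw := weak_solution_inL2_rep.

Let iDU t : 0 <= t <= T -> inL2 (wgt alpha (ux t)).
Proof. by move=> /weak_solution_rep[mg [ig _]]; exact/(wint_inL2 alpha mg). Qed.

Let hwa t : 0 <= t <= T -> H1a alpha (w t) (ux t).
Proof.
move=> tI; split; first exact: iw.
exists (w t); split; last exact: weak_solution_rep.
exact: (@filterE _ _ (ae_filter_ringOfSetsType mu)).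
Qed.

Let H1dist_lt t : 0 <= t <= T -> forall e, 0 < e -> exists2 d, 0 < d &
  forall s, 0 <= s <= T -> `|s - t| < d ->
    sqL2 (fun x => w s x - w t x) < e /\
    sqL2 (fun x => wgt alpha (ux s) x - wgt alpha (ux t) x) < e.
Proof.
move=> tI e e0; have [[_ h] _] := hsol; have [d d0 hd] := cvg0_within (h t tI) e0.
exists d => // s sI sd; have := hd s; rewrite IccP => /(_ sI sd).
rewrite /H1dist2 /L2dist2.
have -> : RI I01 (fun x => (u s x - u t x) ^+ 2) = sqL2 (fun x => w s x - w t x).
  apply: sqL2_ae; [exact: inL2B (iu sI) (iu tI)|exact: inL2B (iw sI) (iw tI)|].
  apply: (@filterS2 _ _ (ae_filter_ringOfSetsType mu)) (hw sI).1 (hw tI).1 => x h1 h2 xI.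
  by rewrite h1 // h2.
have -> : RI I01 (fun x => x `^ alpha * (ux s x - ux t x) ^+ 2) =
    sqL2 (fun x => wgt alpha (ux s) x - wgt alpha (ux t) x).
  by apply: RI_eq => x _; rewrite -[RHS](congr1 (fun F => F x ^+ 2) (wgtB _ _ _)) wgt_sqr.
have := sqL2_ge0 (fun x => w s x - w t x).
have := sqL2_ge0 (fun x => wgt alpha (ux s) x - wgt alpha (ux t) x).
by move=> p q pq; split; apply: le_lt_trans pq; [rewrite lerDl|rewrite lerDr].
Qed.

Lemma weak_solution_contH : contH ip2 0 T (fun t => mkL2 (w t)).
Proof.
apply: contH_mkL2 => [t /iw//|t tI e e0]; have [d d0 hd] := H1dist_lt tI e0.
by exists d => // s sI sd; exact: (hd s sI sd).1.
Qed.

Lemma weak_solution_contH_grad : contH ip2 0 T (fun t => mkL2 (wgt alpha (ux t))).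
Proof.
apply: contH_mkL2 => [t /iDU//|t tI e e0]; have [d d0 hd] := H1dist_lt tI e0.
by exists d => // s sI sd; exact: (hd s sI sd).2.
Qed.

Lemma weak_solution_contH_dt : contH ip2 0 T (fun t => mkL2 (ut t)).
Proof.
apply: contH_mkL2 => [t /iut//|t tI e e0]; have [_ [[_ h] _]] := hsol.
have [d d0 hd] := cvg0_within (h t tI).1 e0.
by exists d => // s sI sd; apply: hd => //; exact/IccP.
Qed.

Lemma weak_solution_rderivH : rderivH ip2 0 T (fun t => mkL2 (w t)) (fun t => mkL2 (ut t)).
Proof.
move=> t /andP[t0 tT] e e0; have tI : 0 <= t <= T by rewrite t0 ltW.
have [_ [[_ h] _]] := hsol.
have [d d0 hd] := cvg0_within (h t tI).2 (exprn_gt0 2 e0).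
exists d => // k /andP[k0 kd] tkT.
have kI : 0 <= t + k <= T by rewrite tkT addr_ge0 // ltW.
have ekt : t + k - t = k by ring.
have := hd (t + k); rewrite ekt gtr0_norm // => /(_ _ kd) H.
have {}H : L2dist2 (fun x => (u (t + k) x - u t x) / k) (ut t) < e ^+ 2.
  by apply: H; split => //; rewrite -subr_eq0 ekt gt_eqF.
have ib := inL2B (iw kI) (iw tI); have iz := inL2Z k (iut tI).
rewrite -mkL2B; [|exact: iw|exact: iw]; rewrite -mkL2Z; last exact: iut.
rewrite -mkL2B //; apply: nrm_le_sqL2; [exact: inL2B|by rewrite mulr_ge0 ?ltW|].
have iq := inL2B (inL2Z k^-1 ib) (iut tI).
have -> : sqL2 (fun x => w (t + k) x - w t x - k * ut t x) =
    k ^+ 2 * sqL2 (fun x => k^-1 * (w (t + k) x - w t x) - ut t x).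
  rewrite /sqL2 -RIZ //; last by have /inL2P[] := iq.
  by apply: RI_eq => x _; rewrite -exprMn mulrBr mulVKf // gt_eqF.
rewrite exprMn mulrC ler_wpM2r ?sqr_ge0 // -(@sqL2_ae _ (fun x => (u (t + k) x - u t x) / k - ut t x)) //.
- exact: ltW.
- have := inL2B (inL2Z k^-1 (inL2B (iu kI) (iu tI))) (iut tI).
  by congr inL2; apply/funext => x; rewrite mulrC.
- apply: (@filterS2 _ _ (ae_filter_ringOfSetsType mu)) (hw kI).1 (hw tI).1 => x h1 h2 xI.
  by rewrite h1 // h2 // mulrC.
Qed.

Let weak_form := let: conj _ (conj _ (conj _ h)) := hsol in h.

Let contI_pair c v : (forall t, 0 <= t <= T -> inL2 (c t)) -> inL2 v ->
  contH ip2 0 T (fun t => mkL2 (c t)) -> contI 0 T (fun t => RI I01 (fun x => c t x * v x)).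
Proof.
move=> ic iv cc; have := contH_ip sip cc (contH_cst sip (a := 0) (b := T) (mkL2 v)); apply: contI_eq => t tI.
by rewrite ip2E //; exact: ic.
Qed.

Lemma weak_solution_increment v gv : inV alpha v gv -> forall s t, 0 <= s -> s <= t -> t < T ->
  `|ip2 (mkL2 (ut t) - mkL2 (ut s)) v + RI (Icc s t) (fun r => ip2 (mkL2 (wgt alpha (ux r))) gv)|
    <= nrm ip2 v * (Fp f t - Fp f s).
Proof.
move=> [v0 [g [hv -> ->]]] s t s0 st tT; have iv := H1a_inL2 hv; have ig := H1a_wgt hv.
have := weak_increment hf iv hv iut iDU (contI_pair iut iv weak_solution_contH_dt)
  (contI_pair iDU ig weak_solution_contH_grad) weak_form s0 st tT.
have tI : 0 <= t <= T by rewrite (le_trans s0 st) ltW.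
have sI : 0 <= s <= T by rewrite s0 (le_trans st) ?ltW.
rewrite (ipBl sip) (ip2E (iut tI) iv) (ip2E (iut sI) iv).
suff -> : RI (Icc s t) (fun r => ip2 (mkL2 (wgt alpha (ux r))) (mkL2 (wgt alpha g))) =
  RI (Icc s t) (fun r => RI I01 (fun x => wgt alpha (ux r) x * wgt alpha g x)) by [].
apply: RI_eq => r /IccP /andP[sr rt]; apply: ip2E => //; apply: iDU.
by rewrite (le_trans s0 sr) (le_trans rt) ?ltW.
Qed.

(* [u1] and [ut 0] agree against every [w h - w 0], hence against the limit [ut 0] of the
   difference quotients. *)
Lemma weak_solution_initial_dt : sqL2 (ut 0) <= sqL2 u1.
Proof.
have zI : 0 <= (0 : R) <= T by rewrite lexx ltW.
have iU := iut zI.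
have orth : ip2 (mkL2 (ut 0) - mkL2 u1) (mkL2 (ut 0)) = 0.
  apply: (ip_limit_eq0 sip) => e e0.
  have [|k k0 hk] := weak_solution_rderivH (x := 0) _ e0; first by rewrite lexx.
  have [h h0 hkT] : exists2 h, 0 < h & (h < k) && (h <= T).
    exists (Num.min (k / 2) T); first by rewrite lt_min T0 divr_gt0.
    by rewrite gt_min ge_min lexx orbT andbT ltr_pdivrMr // mulr_natr mulr2n ltrDl k0.
  have /andP[hk' hT] := hkT.
  have := hk h; rewrite h0 hk' add0r => /(_ isT hT) H.
  have hI : 0 <= h <= T by rewrite (ltW h0).
  have hv := H1aB (hwa hI) (hwa zI); have iv := H1a_inL2 hv; have ig := H1a_wgt hv.
  have eq1 := weak_initial T0 hf iv hv iut iDU (contI_pair iut iv weak_solution_contH_dt)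
    (contI_pair iDU ig weak_solution_contH_grad) weak_form.
  have eq2 : ip2 (mkL2 (ut 0)) (mkL2 (w h) - mkL2 (w 0)) =
      ip2 (mkL2 u1) (mkL2 (w h) - mkL2 (w 0)).
    rewrite -(mkL2B (iw hI) (iw zI)).
    exact (etrans (ip2E iU iv) (etrans eq1 (esym (ip2E hu1 iv)))).
  exists h, (mkL2 (w h) - mkL2 (w 0)).
  exact (And3 h0 (etrans (ipBl sip _ _ _) (etrans (congr2 (fun x y => x - y) eq2 erefl) (subrr _))) H).
have := @nrm_le_of_ipBl_eq0 _ _ _ sip (mkL2 (ut 0)) (mkL2 u1) orth.
have eq_le (p q p' q' : R) : p = p' -> q = q' -> p <= q -> p' <= q' by move=> -> ->.
exact (eq_le _ _ _ _ (nrm2_mkL2 iU) (nrm2_mkL2 hu1)).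
Qed.

(** [g0] and [ux 0] are separate data, tied only by the almost everywhere equality of [u 0] and
    [u0]; a function determines its gradient almost everywhere. *)
Lemma weak_solution_initial_grad : sqL2 (wgt alpha (ux 0)) = sqL2 (wgt alpha g0).
Proof.
have zI : 0 <= (0 : R) <= T by rewrite lexx ltW.
have [_ [w0 [h0 rw0]]] := hu0; have [_ [_ [u00 _]]] := hsol; have [h1 rw] := hw zI.
apply: sqL2_ae; [exact: iDU|exact: H1a_wgt hu0|].
have E : {ae mu, forall x, 0 < x < 1 -> w 0 x = w0 x}.
  apply: (@filterS2 _ _ (ae_filter_ringOfSetsType mu)) h0
    (@filterI _ _ (ae_filter_ringOfSetsType mu) _ _ u00 h1) => x a [b c] xI.
  by rewrite -a // -b // -c.
apply: (@filterS _ _ (ae_filter_ringOfSetsType mu)) (H1rep_unique_grad rw rw0 E) => x h xI.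
by rewrite /wgt h.
Qed.

Lemma energy_le (x y a b c d F : R) : 0 <= b -> 0 <= c -> 0 <= d -> a <= c ->
  (x + y) / 2 <= 2 * ((a + b) / 2 + F) -> x + y <= 4 * (F + (d + b) + c).
Proof. lra. Qed.

Definition data_size : R := Fp f T ^+ 2 + (sqL2 u0 + sqL2 (wgt alpha g0)) + sqL2 u1.

Lemma Fp0 : Fp f 0 = 0. Proof. exact: RI_point. Qed.

(** The factor 4 is 2 from [energy_bound] times 2 for the half in [energy]. *)
Lemma weak_solution_energy t : 0 <= t <= T ->
  sqL2 (ut t) + sqL2 (wgt alpha (ux t)) <= 4 * data_size.
Proof.
move=> tI; have zI : 0 <= (0 : R) <= T by rewrite lexx ltW.
have inVw s : 0 <= s <= T -> inV alpha (mkL2 (w s)) (mkL2 (wgt alpha (ux s))).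
  by move=> sI; exists (w s), (ux s); exact: (And3 (hwa sI) erefl erefl).
have := energy_bound sip T0 weak_solution_contH weak_solution_contH_dt weak_solution_contH_grad
  weak_solution_rderivH inVw (fun v gv w gw => @inVB _ alpha v gv w gw) (contI_Fp hf)
  (Fp_nd hf) weak_solution_increment tI.
have q v : inL2 v -> ip2 (mkL2 v) (mkL2 v) = sqL2 v.
  by move=> iv; exact (etrans (esym (nrm2 sip _)) (nrm2_mkL2 iv)).
have eE s : 0 <= s <= T -> energy ip2 (fun t => mkL2 (ut t)) (fun t => mkL2 (wgt alpha (ux t))) s =
    (sqL2 (ut s) + sqL2 (wgt alpha (ux s))) / 2.
  by move=> sI; exact (congr1 (fun z => z / 2) (congr2 +%R (q _ (iut sI)) (q _ (iDU sI)))).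
rewrite (eE t tI) (eE 0 zI) weak_solution_initial_grad Fp0 subr0 /data_size.
have := weak_solution_initial_dt; have := sqL2_ge0 u0; have := sqL2_ge0 u1.
have := sqL2_ge0 (wgt alpha g0).
exact: energy_le.
Qed.

End WeakSolution.

(** * The boundary layer of the weak solution *)

Section BoundaryLayer.
Context {R : realType}.
Local Notation mu := (@lebesgue_measure R).
Local Notation ip2 := (@ip2 R).
Hint Resolve mI01 measurable_Icc : core.

Lemma intg_EFin (D : set R) (h : R -> R) : @measurable _ (measurableTypeR R) D -> intg D h ->
  (\int[mu]_(x in D) (h x)%:E = (RI D h)%:E)%E.
Proof. by move=> mD ih; rewrite /RI /Rintegral fineK //; exact: integrable_fin_num. Qed.

Lemma integral_sqr_tail (a : R) (v w : R -> R) : 0 < a < 1 -> inL2 v -> measurable_fun I01 w ->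
  intg (Icc a 1) (fun x => w x ^+ 2) -> {ae mu, forall x, 0 < x < 1 -> v x = w x} ->
  (\int[mu]_(x in Icc a 1) (v x ^+ 2)%:E = (RI (Icc a 1) (fun x => w x ^+ 2))%:E)%E.
Proof.
move=> /andP[a0 a1] [mv _] mw iw vw; rewrite -(intg_EFin (measurable_Icc _ _) iw).
have sub : (`]a, 1[%classic : set R) `<=` I01.
  move=> x; rewrite /= in_itv /= => /andP[ax x1]; apply/I01P.
  by rewrite x1 (lt_trans a0 ax).
have me (h : R -> R) : measurable_fun I01 h -> measurable_fun `]a, 1[ (fun x => (h x ^+ 2)%:E).
  move=> mh; apply/measurable_EFinP; apply: measurable_funX.
  exact: (measurable_funS mI01 sub).
have mv2 := me _ mv; have mw2 := me _ mw.
(* Dropping both ends brings the domain inside []0, 1[], where [v] and [w] are compared. *)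
rewrite /Icc (integral_itv_bndoo true false mv2) (integral_itv_bndoo true false mw2).
apply: ge0_ae_eq_integral => //.
- by move=> x _; rewrite lee_fin sqr_ge0.
- by move=> x _; rewrite lee_fin sqr_ge0.
- apply: (@filterS _ _ (ae_filter_ringOfSetsType mu)) vw => x h /sub /I01P /h -> //.
Qed.

Lemma boundary_cst_gt0 (T dl : R) : 0 < T -> 0 < dl -> 0 < boundary_cst T dl.
Proof.
move=> T0 d0; have p n c : 0 <= c -> 0 <= c / dl ^+ n :> R.
  by move=> c0; rewrite divr_ge0 // exprn_ge0 // ltW.
have h : 0 < 64 / dl * T by rewrite mulr_gt0 // divr_gt0.
rewrite /boundary_cst ltr_wpDl // mulr_ge0 ?p //.
have := p 1 1 ler01; have := p 2 8 _; have := p 1 24 _; rewrite expr1 => p1 p2 p3.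
by rewrite addr_ge0 ?p1 // mulr_ge0 ?(ltW T0) // mulr_ge0 // mulr_ge0 // addr_ge0 ?p2 ?addr_ge0.
Qed.

Variables (T alpha : R) (u0 g0 u1 : R -> R) (f u ux ut : R -> R -> R).
Hypotheses (T0 : 0 < T) (alpha02 : 0 < alpha < 2).
Hypotheses (hu0 : H1a alpha u0 g0) (hu1 : inL2 u1) (hf : inL1L2 T f).
Hypothesis hsol : weak_solution T alpha f u0 u1 u ux ut.

Lemma boundary_layer_estimate (dl eps : R) : 0 < dl -> dl < 1 / 2 -> 0 < eps -> eps <= 1 - 2 * dl ->
  ((eps ^- 3)%:E * \int[mu]_(t in Icc 0 T) \int[mu]_(x in Icc (1 - eps) 1) (u t x ^+ 2)%:E <=
   (boundary_cst T dl * data_size T alpha u0 g0 u1 f)%:E)%E.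
Proof.
move=> d0 d1 e0 ed; have e1 : eps < 1 by lra.
have a01 : 0 < 1 - eps < 1 by lra.
have /andP[a0 a1] := a01.
have [[hu _] _] := hsol.
(* The continuous representatives are chosen for all times at once; outside [[0, T]] the choice is
   arbitrary. *)
have /choice[w hw] : forall t, exists w, 0 <= t <= T ->
    {ae mu, forall x, 0 < x < 1 -> u t x = w x} /\ H1rep alpha w (ux t).
  move=> t; case: (boolP (0 <= t <= T)) => [/hu[_ [w h]]|_]; first by exists w.
  by exists (fun=> 0).
have rep := weak_solution_rep hw; have iw := weak_solution_inL2_rep hsol hw.
have D0 : 0 <= data_size T alpha u0 g0 u1 f.
  by rewrite /data_size !addr_ge0 ?sqr_ge0 ?sqL2_ge0.
have hF : (Fp f T - Fp f 0) ^+ 2 <= data_size T alpha u0 g0 u1 f.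
  by rewrite Fp0 subr0 /data_size -addrA lerDl !addr_ge0 ?sqL2_ge0.
have cW := weak_solution_contH hsol hw.
have [B [cB hB RB]] := boundary_estimate T0 alpha02 d0 d1 e0 ed rep iw (weak_solution_inL2_dt hsol)
  cW (weak_solution_contH_dt hsol) (weak_solution_contH_grad hsol hw)
  (weak_solution_rderivH hsol hw) (contI_Fp hf) (Fp_nd hf)
  (weak_solution_increment hf hsol hw) D0 (weak_solution_energy T0 hu0 hu1 hf hsol hw) hF.
pose Z t := RI (Icc (1 - eps) 1) (fun x => w t x ^+ 2).
have eZ t : 0 <= t <= T -> (\int[mu]_(x in Icc (1 - eps) 1) (u t x ^+ 2)%:E = (Z t)%:E)%E.
  move=> tI; have [h1 h2] := hw t tI; have [_ [[iu _] _]] := hsol.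
  have c := prim_contI (H1rep_prim h2 a0 (ltW a1)).
  apply: integral_sqr_tail => //; first exact: (iu t tI).1.
    exact: H1rep_measurable h2.
  by apply: intg_contI; exact: contIM.
have iZ : intg (Icc 0 T) Z := intg_contI (contI_sqL2_tail a0 (ltW a1) iw cW).
(* The layer integral [Z] is continuous in time, so the iterated extended integral is a real one. *)
have -> : (\int[mu]_(t in Icc 0 T) \int[mu]_(x in Icc (1 - eps) 1) (u t x ^+ 2)%:E =
    (RI (Icc 0 T) Z)%:E)%E.
  by rewrite -(intg_EFin (measurable_Icc _ _) iZ); apply: eq_integral => t; rewrite inE => /IccP /eZ.
rewrite -EFinM lee_fin ler_pdivrMl ?exprn_gt0 //; apply: le_trans RB.
by apply: (RI_le (measurable_Icc _ _) iZ (intg_contI cB)) => // t /IccP; exact: hB.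
Qed.

End BoundaryLayer.

Theorem mainTheorem1 (R : realType) (T alpha eps0 : R) :
  0 < T -> 0 < alpha < 2 -> 0 < eps0 < 1 ->
  exists C : R, 0 < C /\
  forall (u0 g0 u1 : R -> R) (f u ux ut : R -> R -> R),
    H1a alpha u0 g0 -> inL2 u1 -> inL1L2 T f ->
    weak_solution T alpha f u0 u1 u ux ut ->
    forall eps : R, 0 < eps <= eps0 ->
      ((eps ^- 3)%:E *
        \int[@lebesgue_measure R]_(t in Icc 0 T)
          \int[@lebesgue_measure R]_(x in Icc (1 - eps) 1) ((u t x) ^+ 2)%:E
       <= (C * ((fine (L1L2norm T f)) ^+ 2 + fine (H1norm2 alpha u0 g0)
                + fine (\int[@lebesgue_measure R]_(x in I01) ((u1 x) ^+ 2)%:E)))%:E)%E.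
Proof.
(* Then [1 - 2 * dl = eps0], so [eps <= eps0] is the condition under which the layer stays in
   [[2 * dl, 1]]. *)
move=> T0 alpha02 /andP[ep0 ep1]; pose dl := (1 - eps0) / 2.
have d0 : 0 < dl by rewrite divr_gt0 ?subr_gt0.
have d1 : dl < 1 / 2 by rewrite ltr_pM2r ?invr_gt0 // gtrBl.
exists (boundary_cst T dl); split; first exact: boundary_cst_gt0.
move=> u0 g0 u1 f u ux ut hu0 hu1 hf hsol eps /andP[e0 ee0].
have ed : eps <= 1 - 2 * dl by rewrite /dl mulrC divfK // opprB addrC subrK.
rewrite (H1norm2E hu0) (sqL2E hu1).
(* [Fp f T] and the real value of [L1L2norm T f] agree by definition, so [data_size] is the bracket
   of the statement. *)
exact: (boundary_layer_estimate T0 alpha02 hu0 hu1 hf hsol d0 d1 e0 ed).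
Qed.
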